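(* Let $n,d$ be positive integers with $n\geq 29d$. Then $f(n,d)=\left\lceil\frac{n+d-2}{2}\right\rceil$.
   Context: All graphs are finite and simple. A $d$-dimensional framework $(G,p)$ is a graph $G=(V,E)$ with a map $p:V\to\mathbb{R}^d$; it is rigid if every continuous motion of the vertices starting at $p$ that keeps all edge lengths constant also keeps all pairwise distances constant. It is generic if the coordinates of $p$ are algebraically independent over $\mathbb{Q}$. A graph $G$ is $d$-rigid if some (equivalently every) generic $d$-dimensional framework $(G,p)$ is rigid. $\delta(G)$ is the minimum degree. For $n,d\in\mathbb{N}$, $f(n,d)$ is the smallest integer such that every $n$-vertex graph $G$ with $\delta(G)\geq f(n,d)$ is $d$-rigid. *)

(* Defs.v *)
From HB Require Import structures.
From mathcomp Require Import all_boot all_order all_algebra.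
From mathcomp Require Import all_classical all_reals all_analysis.
From mathcomp Require Import Rstruct Rstruct_topology.
From Stdlib Require Import Rdefinitions.

Set Implicit Arguments.
Unset Strict Implicit.
Unset Printing Implicit Defensive.

Import Order.TTheory GRing.Theory Num.Theory.
Local Open Scope ring_scope.
Local Open Scope classical_set_scope.

Definition simple_graph (V : finType) (e : rel V) : Prop :=
  symmetric e /\ irreflexive e.

Definition degree (V : finType) (e : rel V) (v : V) : nat := #|[set u | e v u]|.

(* minimum degree (the empty graph on no vertices gets #|V| = 0) *)
Definition min_degree (V : finType) (e : rel V) : nat :=
  \big[minn/#|V|]_(v : V) degree e v.

Definition edist (d : nat) (x y : 'rV[R]_d) : R :=
  Num.sqrt (\sum_(k < d) (x ord0 k - y ord0 k) ^+ 2).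

(* Algebraic independence over Q of a finite family (x_i)_{i in I} of reals:
   every polynomial with rational coefficients (of degree < k in each variable,
   for some k) vanishing at x is the zero polynomial. *)
Definition alg_indep_Q (I : finType) (x : I -> R) : Prop :=
  forall (k : nat) (c : {ffun {ffun I -> 'I_k} -> rat}),
    \sum_(m : {ffun I -> 'I_k}) ratr (c m) * \prod_(i : I) x i ^+ (m i) = 0 ->
    c = 0.

Definition generic (V : finType) (d : nat) (p : V -> 'rV[R]_d) : Prop :=
  alg_indep_Q (fun ik : V * 'I_d => p ik.1 ord0 ik.2).

Definition motion (V : finType) (d : nat) (x : R -> V -> 'rV[R]_d) : Prop :=
  forall (v : V) (k : 'I_d),
    {within `[0%R, 1%R], continuous (fun t : R => x t v ord0 k)}.

Definition rigid_framework (V : finType) (d : nat) (e : rel V)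
    (p : V -> 'rV[R]_d) : Prop :=
  forall x : R -> V -> 'rV[R]_d,
    motion x -> x 0 = p ->
    (forall t, 0 <= t <= 1 -> forall u v, e u v ->
        edist (x t u) (x t v) = edist (p u) (p v)) ->
    forall t, 0 <= t <= 1 -> forall u v,
        edist (x t u) (x t v) = edist (p u) (p v).

Definition d_rigid (V : finType) (d : nat) (e : rel V) : Prop :=
  exists p : V -> 'rV[R]_d, generic p /\ rigid_framework e p.

Definition mindeg_forces_rigid (n d k : nat) : Prop :=
  forall e : rel 'I_n, simple_graph e -> leq k (min_degree e) -> d_rigid d e.

Definition f_is (n d K : nat) : Prop :=
  mindeg_forces_rigid n d K /\
  forall k : nat, mindeg_forces_rigid n d k -> leq K k.

(* Main.v *)
(** Upper bound.  A framework is infinitesimally rigid once its edge equations, completed by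
    [binomial (d+1) 2] linear "pins", force all velocities to vanish; the completed system has
    rational coefficients, so it is nonsingular at a generic point as soon as it is nonsingular at
    one rational point.  Such a point is found by reducing the graph: two vertices with [d] common
    neighbours (or adjacent, with [d - 1]) may be merged, and an apex [v] may be removed at the
    price of one dimension, provided every non-neighbour [b] of [v] gives up one edge (to its first
    neighbour in a fixed ordering).  If the minimum degree is at least [(n + d - 2) / 2] and
    [n >= 29 d], one merges [d] disjoint pairs of vertices with large joint neighbourhoods, lets
    each of them absorb three more vertices so as to dominate most of the graph, and then removes
    the [d] merged vertices as successive apexes, which leads to dimension [0].  When too few pairs
    have both a large joint neighbourhood and [2 d - 1] common neighbours, the graph is close to two
    disjoint cliques, and an averaging argument finds [d] pairs running between the two parts.

    Infinitesimal rigidity at a generic point yields rigidity: the configurations of a motion that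
    are congruent to the initial one form a closed set, which is open because two configurations
    with equal edge lengths differ by an infinitesimal flex of their midpoint.

    Lower bound.  Two cliques of almost equal sizes sharing [d - 1] vertices can be rotated relatively
    to each other about the affine span of the shared vertices. *)

Require Import Defs.
From HB Require Import structures.
From mathcomp Require Import all_boot all_order all_algebra.
From mathcomp Require Import perm ring lra zify.
Set Implicit Arguments.
Unset Strict Implicit.
Unset Printing Implicit Defensive.
Import Order.TTheory GRing.Theory Num.Theory.

(** * Moves that preserve infinitesimal rigidity *)

(** Every move is read backwards: [pinned] for the reduced graph gives [pinned] for the larger one,
    by placing the larger framework in a degenerate position, rescaling the equations that would
    vanish there, and perturbing. No topology enters: through the Gram determinant, injectivity of a
    linear system is the nonvanishing of one polynomial, so it persists off finitely many
    parameters, even over the rationals. The obstacle is that the edges given up to successive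
    apexes accumulate, so they are charged only to vertices that have lost little so far. If a
    merged vertex misses [x * n] vertices, the choice of a parent must avoid up to about
    [3 * x * n + n / 2] vertices, so [x < 1/6] is needed. A starting pair misses at most about half
    of the graph; each absorption multiplies this by [2/3], and three of them reach [4/27], while
    two do not suffice. The constant 29 is what the averaging over pairs between the two parts
    consumes ([gain_pair]). Dimension 1 is treated apart, because the inequality behind the two
    parts fails there for [n = 29]. *)

Section Moves.
Local Open Scope ring_scope.

(** * Injectivity of linear systems through Gram determinants *)

Section Limit.
Variables (F : realFieldType) (I J : finType).

Definition sys_inj (M : I -> J -> F) : Prop :=
  forall m : J -> F, (forall i, \sum_j M i j * m j = 0) -> forall j, m j = 0.

Definition gram (S : comNzRingType) (M : I -> J -> S) : 'M[S]_#|J| :=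
  \matrix_(a, b) \sum_i M i (enum_val a) * M i (enum_val b).

(** Over an ordered field the quadratic form of the Gram matrix is a sum of squares, so it has the
    same kernel as [M]. An overdetermined system is thus tested by a single polynomial, without
    choosing a minor. *)
Lemma gram_inj (M : I -> J -> F) : \det (gram M) != 0 <-> sys_inj M.
Proof.
split=> [dn0 m Mm j | inj].
- have: gram M *m (\col_b m (enum_val b)) = 0.
    apply/matrixP=> a b; rewrite !mxE.
    under eq_bigr => c _ do rewrite !mxE mulr_suml.
    rewrite exchange_big big1 //= => i _.
    under eq_bigr => c _ do rewrite -mulrA.
    rewrite -mulr_sumr -(big_enum_val (A:=J) (fun c => M i c * m c)) /=.
    by rewrite (eq_bigl xpredT) // Mm mulr0.
  move=> /(congr1 (mulmx (invmx (gram M)))).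
  rewrite mulmxA mulVmx ?mul1mx ?mulmx0; last by rewrite unitmxE unitfE.
  by move=> /matrixP/(_ (enum_rank j) 0); rewrite !mxE enum_rankK.
- apply/negP=> /det0P [v vn0 vG].
  pose m j := v 0 (enum_rank j).
  have s0: \sum_i (\sum_j M i j * m j) ^+ 2 = 0.
    have: (v *m gram M *m v^T) 0 0 = 0 by rewrite vG mul0mx mxE.
    rewrite mxE => E; rewrite -[RHS]E.
    under [RHS]eq_bigr => b _ do rewrite !mxE mulr_suml.
    have E1 i : \sum_j M i j * m j = \sum_(b < #|J|) M i (enum_val b) * v 0 b.
      rewrite (reindex_onto (@enum_val _ J) enum_rank); last by move=> *; apply: enum_rankK.
      by apply: eq_big => [b|b _]; rewrite /m ?enum_valK ?eqxx.
    under [LHS]eq_bigr => i _ do rewrite E1 expr2 mulr_suml.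
    rewrite exchange_big; apply: eq_bigr => b _ /=.
    under [LHS]eq_bigr => i _ do rewrite mulr_sumr.
    rewrite exchange_big; apply: eq_bigr => c _ /=.
    rewrite !mxE mulr_sumr mulr_suml; apply: eq_bigr => i _; ring.
  have z i : \sum_j M i j * m j = 0.
    apply/eqP; rewrite -sqrf_eq0; apply/eqP.
    by move/psumr_eq0P: s0 => -> // *; apply: sqr_ge0.
  case/negP: vn0; apply/eqP/matrixP=> a b; rewrite !mxE.
  by have := inj m z (enum_val b); rewrite /m enum_valK ord1.
Qed.

(** The Gram determinant of a polynomial family is itself a polynomial in the parameter; it serves
    as [q]. This replaces every limit argument below. *)
Lemma sys_inj_limit (M : I -> J -> {poly F}) (c0 : F) :
  sys_inj (fun i j => (M i j).[c0]) ->
  exists2 q : {poly F}, q.[c0] != 0 &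
    forall c, q.[c] != 0 -> sys_inj (fun i j => (M i j).[c]).
Proof.
have E c : \det (gram (fun i j => (M i j).[c])) = (\det (gram M)).[c].
  rewrite -[RHS]/(horner_eval c _) -det_map_mx; congr (\det _).
  apply/matrixP=> a b; rewrite !mxE raddf_sum /=.
  by apply: eq_bigr => i _; rewrite -hornerM.
move=> /gram_inj; rewrite E => h; exists (\det (gram M)) => // c.
by rewrite -E => /gram_inj.
Qed.
End Limit.

(** * Linear systems carried by the edges of a graph *)

Section EdgeSystems.
Variables (F : realFieldType) (V : finType) (d : nat).
Implicit Types (m p : V -> 'I_d -> F).

(** The coefficients [a] and [b] at the two ends are independent because a rescaled limit of
    frameworks need not be a framework: in the cone limit they are not opposite. *)
Definition edge_inj (J : finType) (E : rel V) (Z : V -> 'I_d -> bool)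
    (a b : V -> V -> 'I_d -> F) (phi : J -> V -> 'I_d -> F) : Prop :=
  forall m, (forall x i, Z x i -> m x i = 0) ->
    (forall x y, E x y -> \sum_i (a x y i * m x i + b x y i * m y i) = 0) ->
    (forall j, \sum_x \sum_i phi j x i * m x i = 0) ->
    forall x i, m x i = 0.

Definition edge_mx (S : comNzRingType) (J : finType) (E : rel V) (Z : V -> 'I_d -> bool)
    (a b : V -> V -> 'I_d -> S) (phi : J -> V -> 'I_d -> S)
    (t : V * V + J + V * 'I_d) (u : V * 'I_d) : S :=
  match t with
  | inl (inl xy) => if E xy.1 xy.2 then
      (u.1 == xy.1)%:R * a xy.1 xy.2 u.2 + (u.1 == xy.2)%:R * b xy.1 xy.2 u.2 else 0
  | inl (inr j) => phi j u.1 u.2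
  | inr xi => (Z xi.1 xi.2 && (u == xi))%:R
  end.

Lemma edge_mxP (J : finType) (E : rel V) (Z : V -> 'I_d -> bool)
    (a b : V -> V -> 'I_d -> F) (phi : J -> V -> 'I_d -> F) :
  sys_inj (edge_mx E Z a b phi) <-> edge_inj E Z a b phi.
Proof.
have pick (f : V -> 'I_d -> F) z :
    \sum_x \sum_i (x == z)%:R * f x i = \sum_i f z i.
  rewrite (bigD1 z) //= [X in _ + X]big1 ?addr0.
    by apply: eq_bigr => i _; rewrite eqxx mul1r.
  by move=> x /negPf xz; rewrite big1 // => i _; rewrite xz mul0r.
have key (m : V -> 'I_d -> F) x y :
    E x y -> \sum_u edge_mx E Z a b phi (inl (inl (x, y))) u * m u.1 u.2
      = \sum_i (a x y i * m x i + b x y i * m y i).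
  move=> Exy; rewrite /= Exy big_split /=.
  rewrite -(pick (fun z i => a x y i * m z i) x) -(pick (fun z i => b x y i * m z i) y).
  rewrite 2!pair_big /= -big_split /=; apply: eq_bigr => -[z i] _ /=; ring.
split=> [inj m mZ mE mP x i | inj m Mm [x i]].
- apply: (inj (fun u => m u.1 u.2) _ (x, i)) => -[[[y z]|j]|[y k]].
  + by case Eyz: (E y z); [rewrite key ?mE | rewrite big1 //= => u _; rewrite Eyz mul0r].
  + by rewrite -[RHS](mP j) pair_big.
  + rewrite big1 //= => -[z l] _ /=; case: (boolP (Z y k)) => [Zyk|]; last by rewrite mul0r.
    by case: eqP => [[-> ->]|]; rewrite ?(mZ _ _ Zyk) /= ?mulr0 ?mul0r.
- apply: (inj (fun x i => m (x, i))) => [y k Zyk|y z Eyz|j].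
  + have /= := Mm (inr (y, k)); rewrite (bigD1 (y, k)) //= eqxx Zyk mul1r.
    by rewrite [X in _ + X]big1 ?addr0 // => u /negPf ->; rewrite mul0r.
  + by rewrite -(key (fun x i => m (x, i))) // -[RHS](Mm (inl (inl (y, z)))); apply: eq_bigr => -[].
  + by rewrite pair_big -[RHS](Mm (inl (inr j))); apply: eq_bigr => -[].
Qed.

Lemma edge_inj_limit (J : finType) (E : rel V) (Z : V -> 'I_d -> bool)
    (a b : V -> V -> 'I_d -> {poly F}) (phi : J -> V -> 'I_d -> {poly F}) (c0 : F) :
  let at_ c := edge_inj E Z (fun x y i => (a x y i).[c]) (fun x y i => (b x y i).[c])
                 (fun j x i => (phi j x i).[c]) in
  at_ c0 -> exists2 q : {poly F}, q.[c0] != 0 & forall c, q.[c] != 0 -> at_ c.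
Proof.
move=> at_ h.
have E1 c t u : (edge_mx E Z a b phi t u).[c] =
  edge_mx E Z (fun x y i => (a x y i).[c]) (fun x y i => (b x y i).[c])
    (fun j x i => (phi j x i).[c]) t u.
  have nat1 (B : bool) : (B%:R : {poly F}).[c] = B%:R by case: B; rewrite ?horner0 ?hornerC.
  rewrite /edge_mx; case: t => [[xy|j]|xi]; first 1 last.
  - by [].
  - by rewrite nat1.
  - by case: ifP; rewrite ?horner0 // hornerD !hornerM !nat1.
have [q q0 qP] : exists2 q : {poly F}, q.[c0] != 0 & forall c, q.[c] != 0 ->
    sys_inj (fun t u => (edge_mx E Z a b phi t u).[c]).
  apply: sys_inj_limit => m mP; apply: (proj2 (edge_mxP _ _ _ _ _) h) => t.
  by rewrite -[RHS](mP t); apply: eq_bigr => u _; rewrite E1.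
exists q => // c /qP inj; apply/edge_mxP => m mP; apply: inj => t.
by rewrite -[RHS](mP t); apply: eq_bigr => u _; rewrite E1.
Qed.

(* An active graph is a vertex set [A] with a relation [e], read inside [A]. *)
Definition flex (A : {set V}) (e : rel V) p m : Prop :=
  (forall x i, x \notin A -> m x i = 0) /\
  (forall x y, x \in A -> y \in A -> e x y ->
     \sum_i (p x i - p y i) * (m x i - m y i) = 0).

Definition pinned_at (J : finType) (A : {set V}) (e : rel V) p
    (phi : J -> V -> 'I_d -> F) : Prop :=
  forall m, flex A e p m -> (forall j, \sum_x \sum_i phi j x i * m x i = 0) ->
    forall x i, m x i = 0.

(** The point [p] may be very special; genericity enters only after all the moves. The number [k] is
    recorded so that the pins can later be compared with the dimension of the space of
    isometries. *)
Definition pinned (A : {set V}) (e : rel V) (k : nat) : Prop :=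
  exists p (J : finType) (phi : J -> V -> 'I_d -> F), #|J| = k /\ pinned_at A e p phi.

Definition act (A : {set V}) (e : rel V) : rel V :=
  fun x y => [&& x \in A, y \in A & e x y].

Lemma nonroot (q1 q2 : {poly F}) : q1 != 0 -> q2 != 0 ->
  exists c, [/\ c != 0, q1.[c] != 0 & q2.[c] != 0].
Proof.
move=> q10 q20; pose q := 'X * (q1 * q2).
have q0 : q != 0 by rewrite !mulf_neq0 // polyX_eq0.
pose s := [seq (i%:R : F) | i <- iota 0 (size q)].
have us : uniq s by rewrite map_inj_uniq ?iota_uniq //; apply: mulrIn; rewrite oner_eq0.
have : ~~ all (root q) s.
  by apply/negP=> al; have := max_poly_roots q0 al us; rewrite size_map size_iota ltnn.
case/allPn=> c _; rewrite /root /q !hornerM hornerX !mulf_eq0 !negb_or.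
by case/and3P=> ? ? ?; exists c.
Qed.

Lemma horner_neq0 (q : {poly F}) c : q.[c] != 0 -> q != 0.
Proof. by apply: contraNneq => ->; rewrite horner0. Qed.

(** Applied with a [p1] at which some further independence is evident: pinning holds at [c = 0], the
    independence at [c = 1], hence both at almost every [c]. *)
Lemma pinned_perturb (J : finType) A e p (phi : J -> V -> 'I_d -> F) p1 :
  pinned_at A e p phi ->
  exists2 q : {poly F}, q != 0 & forall c, q.[c] != 0 ->
    pinned_at A e (fun x i => p x i + c * (p1 x i - p x i)) phi.
Proof.
move=> pin; pose P x i : {poly F} := (p x i)%:P + 'X * (p1 x i - p x i)%:P.
have PE c x i : (P x i).[c] = p x i + c * (p1 x i - p x i) by rewrite /P !hornerE.
have [|q q0 qP] := @edge_inj_limit J (act A e) (fun x _ => x \notin A)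
  (fun x y i => P x i - P y i) (fun x y i => - (P x i - P y i))
  (fun j x i => (phi j x i)%:P) 0.
- move=> m mA mE mP; apply: pin; last first.
    by move=> j; rewrite -[RHS](mP j); do 2!apply: eq_bigr => ? _; rewrite hornerC.
  split=> // x y xA yA exy; rewrite -[RHS](mE x y); last exact/and3P.
  apply: eq_bigr => i _; rewrite hornerN hornerD hornerN !PE; ring.
- exists q; first exact: horner_neq0 q0.
  move=> c /qP inj m [mA mE] mP; apply: inj => //.
  + move=> x y /and3P[xA yA exy]; rewrite -[RHS](mE x y xA yA exy).
    apply: eq_bigr => i _; rewrite hornerN hornerD hornerN !PE; ring.
  + by move=> j; rewrite -[RHS](mP j); do 2!apply: eq_bigr => ? _; rewrite hornerC.
Qed.

End EdgeSystems.

(** * Merging two vertices, and one-extension *)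

Section MoveLemmas.
Variables (F : realFieldType) (V : finType) (d : nat).
Implicit Types (m p : V -> 'I_d -> F) (A : {set V}) (e : rel V).

Lemma pinned_sub A e e' k :
  (forall x y, x \in A -> y \in A -> x != y -> e' x y -> e x y) ->
  pinned F d A e' k -> pinned F d A e k.
Proof.
move=> sub [p [J [phi [cJ pin]]]]; exists p, J, phi; split=> // m [mA mE] mP.
apply: pin => //; split=> // x y xA yA exy; have [<-|nxy] := eqVneq x y.
  by rewrite big1 // => i _; rewrite !subrr mulr0.
by apply: mE => //; apply: sub.
Qed.

Definition merge_rel e (u x : V) : rel V :=
  fun z w => [|| e z w, (z == u) && e x w | (w == u) && e z x].

(* The points [u] and [x] are placed at the same position (infinitesimally
   separated along the first axis): the common neighbours force equal velocities. *)
Lemma pinned_merge A e u x (good : pred 'I_d) (c : 'I_d -> V) k :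
  symmetric e -> u \in A -> x \in A -> u != x -> injective c ->
  (forall i, good i -> [/\ c i \in A, c i != u, c i != x, e u (c i) & e x (c i)]) ->
  (forall i, ~~ good i -> i = 0%N :> nat /\ e u x) ->
  pinned F d (A :\ x) (merge_rel e u x) k -> pinned F d A e k.
Proof.
move=> se uA xA nux injc goodP badP [p0 [J [phi [cJ pin0]]]].
(* At [p1] the vertex [u] is the origin and [c i] the [i]-th basis vector, so the directions from
   [u] to the good [c i] are independent. *)
pose p1 z j : F := ((z != u) && (c j == z))%:R.
have [q1 q10 q1P] := pinned_perturb p1 pin0.
pose P0 z j : {poly F} := (p0 z j)%:P + 'X * (p1 z j - p0 z j)%:P.
have P0E t z j : (P0 z j).[t] = p0 z j + t * (p1 z j - p0 z j) by rewrite /P0 !hornerE.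
(* A bad index contributes the first axis instead, the direction of the infinitesimal edge [u x]. *)
have [|q2 q20 q2P] := @sys_inj_limit F 'I_d 'I_d
  (fun i j => if good i then P0 u j - P0 (c i) j else (i == j)%:R%:P) 1.
  move=> h hP i; have := hP i; case: (boolP (good i)) => gi.
    rewrite (bigD1 i) //= big1 ?addr0 => [|j nji].
      rewrite hornerD hornerN !P0E !mul1r !subrKC /p1 eqxx /=.
      have [_ -> _ _ _] := goodP i gi; rewrite eqxx /= sub0r mulN1r => /eqP.
      by rewrite oppr_eq0 => /eqP.
    rewrite hornerD hornerN !P0E !mul1r !subrKC /p1 eqxx /=.
    by rewrite (inj_eq injc) (negPf nji) andbF subrr mul0r.
  rewrite (bigD1 i) //= big1 ?addr0 => [|j nji]; first by rewrite hornerC eqxx mul1r.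
  by rewrite hornerC eq_sym (negPf nji) mul0r.
have [t [_ t1 t2]] := nonroot q10 (horner_neq0 q20).
move: (q1P t t1) (q2P t t2); clear q1P q2P.
set p := (fun x i => p0 x i + _) => pin hinj0.
pose wd (j : 'I_d) : F := (j == 0%N :> nat)%:R.
have hinj (h : 'I_d -> F) :
    (forall i, good i -> \sum_j (p u j - p (c i) j) * h j = 0) ->
    (e u x -> \sum_j wd j * h j = 0) -> forall j, h j = 0.
  move=> h1 h2; apply: hinj0 => i; case: (boolP (good i)) => gi.
    rewrite -[RHS](h1 i gi); apply: eq_bigr => j _.
    by rewrite hornerD hornerN !P0E.
  have [i0 /h2 eux] := badP i gi; rewrite -[RHS]eux; apply: eq_bigr => j _.
  by rewrite hornerC /wd -i0 eq_sym.
clear hinj0.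
pose P z j : {poly F} := if z == x then (p u j)%:P + 'X * (wd j)%:P else (p z j)%:P.
(* With [x] at [u + s * wd], the equation of the edge [u x] is divided by [s], so that it survives
   at [s = 0]. *)
pose D z y j : {poly F} := if (z == u) && (y == x) then - (wd j)%:P
  else if (z == x) && (y == u) then (wd j)%:P else P z j - P y j.
pose phi' j z i : {poly F} := if z == x then 0 else (phi j z i)%:P.
have PE z j s : (P z j).[s] = if z == x then p u j + s * wd j else p z j.
  by rewrite /P; case: ifP; rewrite !hornerE.
have phiE j z i s : (phi' j z i).[s] = if z == x then 0 else phi j z i.
  by rewrite /phi'; case: ifP; rewrite ?horner0 ?hornerC.
have DE z y j s : (D z y j).[s] = if (z == u) && (y == x) then - wd j
  else if (z == x) && (y == u) then wd j else (P z j).[s] - (P y j).[s].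
  rewrite /D; case: ((z == u) && (y == x)); first by rewrite hornerN hornerC.
  by case: ((z == x) && (y == u)); rewrite ?hornerC // hornerD hornerN.
have [|q q0 qP] := @edge_inj_limit F V d J (act A e) (fun z _ => z \notin A)
   D (fun z y j => - D z y j) phi' 0.
- move=> m mA mE mP.
  have {}mE z y : z \in A -> y \in A -> e z y -> \sum_i (D z y i).[0] * (m z i - m y i) = 0.
    move=> zA yA ezy; rewrite -[RHS](mE z y); last exact/and3P.
    by apply: eq_bigr => i _; rewrite hornerN; ring.
  have h0 : forall j, m x j - m u j = 0.
    apply: hinj => [i gi|eux].
    + have [cA cu cx eu ex] := goodP i gi.
      have := mE u (c i) uA cA eu; have := mE x (c i) xA cA ex.
      move=> E1 E2; rewrite -[RHS](subr0 0) -[X in _ = X - _]E1 -[X in _ = _ - X]E2 -sumrB; apply: eq_bigr => j _.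
      rewrite !DE !PE (negPf cu) (negPf cx) !andbF (negPf nux) eqxx; ring.
    + rewrite -[RHS](mE u x uA xA eux); apply: eq_bigr => j _.
      rewrite DE !eqxx /=; ring.
  have mu z i : (if z == x then 0 else m z i) = 0.
    apply: (pin (fun z i => if z == x then 0 else m z i)); last first.
      move=> j; rewrite -[RHS](mP j); do 2!apply: eq_bigr => ? _.
      by rewrite phiE; case: ifP; rewrite ?mulr0 ?mul0r.
    split=> [y j|y w].
      by rewrite !inE negb_and negbK; case: eqP => //= _; apply: mA.
    rewrite !inE => /andP[nyx yA] /andP[nwx wA]; rewrite (negPf nyx) (negPf nwx).
    have [->|nyw] := eqVneq y w; first by rewrite big1 // => ? _; rewrite !subrr mulr0.
    move=> /or3P[eyw|/andP[/eqP yu exw]|/andP[/eqP wu eyx]].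
    + rewrite -[RHS](mE y w yA wA eyw); apply: eq_bigr => j _.
      by rewrite DE !PE (negPf nyx) (negPf nwx) !andbF.
    + rewrite -[RHS](mE x w xA wA exw); apply: eq_bigr => j _; subst y.
      rewrite DE !PE eqxx (negPf nwx) (eq_sym w) (negPf nyw) !andbF.
      by rewrite mul0r addr0 -[m x j](subrK (m u j)) h0 add0r.
    + rewrite -[RHS](mE y x yA xA eyx); apply: eq_bigr => j _; subst w.
      rewrite DE !PE eqxx (negPf nyx) (negPf nyw) /=.
      by rewrite mul0r addr0 -[m x j](subrK (m u j)) h0 add0r.
  move=> z i; have := mu z i; case: eqP => [-> _|//].
  by rewrite -[m x i](subrK (m u i)) h0 add0r; have := mu u i; rewrite (negPf nux).
have [s [s0 sq _]] := nonroot (horner_neq0 q0) (horner_neq0 q0).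
exists (fun z j => (P z j).[s]), J, (fun j z i => (phi' j z i).[s]); split=> //.
move=> m [mA mE] mP; apply: (qP s sq) => // z y /and3P[zA yA ezy].
have {}mE := mE z y zA yA ezy.
have -> : \sum_i ((D z y i).[s] * m z i + (- D z y i).[s] * m y i) =
  \sum_i (D z y i).[s] * (m z i - m y i).
  by apply: eq_bigr => i _; rewrite hornerN; ring.
case: (boolP ((z == u) && (y == x))) => [/andP[/eqP zu /eqP yx]|n1].
  apply: (mulfI s0); rewrite mulr0 -[RHS]mE mulr_sumr; subst; apply: eq_bigr => i _.
  by rewrite DE !PE !eqxx (negPf nux) /=; ring.
case: (boolP ((z == x) && (y == u))) => [/andP[/eqP zx /eqP yu]|n2].
  apply: (mulfI s0); rewrite mulr0 -[RHS]mE mulr_sumr; subst; apply: eq_bigr => i _.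
  by rewrite DE !PE !eqxx (negPf nux) (eq_sym x u) (negPf nux) /=; ring.
by rewrite -[RHS]mE; apply: eq_bigr => i _; rewrite DE (negPf n1) (negPf n2).
Qed.

Definition add_edge e (x y : V) : rel V :=
  fun z w => [|| e z w, (z == x) && (w == y) | (z == y) && (w == x)].

(* One-extension: [v] is placed at the midpoint of [x] and [y]. *)
Lemma pinned_ext1 A e v x y (c : 'I_d -> V) k :
  symmetric e -> v \in A -> x \in A -> y \in A -> v != x -> v != y -> x != y ->
  e v x -> e v y -> injective c -> (forall i, c i \in A /\ c i != v) ->
  (forall i, c i != y) -> (forall i, e v (c i)) ->
  pinned F d (A :\ v) (add_edge e x y) k -> pinned F d A e k.
Proof.
move=> se vA xA yA nvx nvy nxy evx evy injc cA cy ev [p0 [J [phi [cJ pin0]]]].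
(* At [p1] the points [x] and [y] are antipodal, so their midpoint is the origin, while [c i] is the
   [i]-th basis vector. *)
pose p1 z j : F := if z == y then - (c j == x)%:R else (c j == z)%:R.
have [q1 q10 q1P] := pinned_perturb p1 pin0.
pose P0 z j : {poly F} := (p0 z j)%:P + 'X * (p1 z j - p0 z j)%:P.
have P0E t z j : (P0 z j).[t] = p0 z j + t * (p1 z j - p0 z j) by rewrite /P0 !hornerE.
have [|q2 q20 q2P] := @sys_inj_limit F 'I_d 'I_d
  (fun i j => 2%:R^-1 *: (P0 x j + P0 y j) - P0 (c i) j) 1.
  move=> h hP i; have := hP i.
  rewrite (bigD1 i) //= big1 ?addr0 => [|j nji].
    rewrite hornerD hornerN hornerZ hornerD !P0E !mul1r !subrKC /p1 eqxx (negPf nxy).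
    rewrite (negPf (cy i)) eqxx subrr mulr0 sub0r mulN1r => /eqP.
    by rewrite oppr_eq0 => /eqP.
  rewrite hornerD hornerN hornerZ hornerD !P0E !mul1r !subrKC /p1 eqxx (negPf nxy).
  by rewrite (negPf (cy i)) subrr mulr0 sub0r (inj_eq injc) (negPf nji) oppr0 mul0r.
have [t [_ t1 t2]] := nonroot q10 (horner_neq0 q20).
move: (q1P t t1) (q2P t t2); clear q1P q2P.
set p := (fun x i => p0 x i + _) => pin hinj0.
pose pv j := 2%:R^-1 * (p x j + p y j).
have hinj (h : 'I_d -> F) :
    (forall i, \sum_j (pv j - p (c i) j) * h j = 0) -> forall j, h j = 0.
  move=> h1; apply: hinj0 => i; rewrite -[RHS](h1 i); apply: eq_bigr => j _.
  by rewrite hornerD hornerN hornerZ hornerD !P0E.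
clear hinj0.
pose pp z j := if z == v then pv j else p z j.
exists pp, J, (fun j z i => if z == v then 0 else phi j z i); split=> //.
move=> m [mA mE] mP.
have mu z i : (if z == v then 0 else m z i) = 0.
  apply: (pin (fun z i => if z == v then 0 else m z i)); last first.
    move=> j; rewrite -[RHS](mP j); do 2!apply: eq_bigr => ? _.
    by case: ifP; rewrite ?mulr0 ?mul0r.
  (* With [v] at the midpoint, the equations of [v x] and [v y] add up to half the equation of the
     missing edge [x y]. *)
  have exy : \sum_i (p x i - p y i) * (m x i - m y i) = 0.
    have E1 := mE v x vA xA evx; have E2 := mE v y vA yA evy.
    apply: (mulfI (_ : 2%:R^-1 != 0)); first by rewrite invr_eq0 pnatr_eq0.
    rewrite mulr0 -[RHS](addr0 0) -[X in _ = X + _]E1 -[X in _ = _ + X]E2 -big_split mulr_sumr.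
    apply: eq_bigr => l _; rewrite /pp eqxx (eq_sym x) (negPf nvx) (eq_sym y) (negPf nvy) /pv /=.
    by field.
  split=> [z' j|z' w].
    by rewrite !inE negb_and negbK; case: eqP => //= _; apply: mA.
  rewrite !inE => /andP[nzv zA] /andP[nwv wA]; rewrite (negPf nzv) (negPf nwv).
  move=> /or3P[ezw|/andP[/eqP-> /eqP->]|/andP[/eqP-> /eqP->]]; last 2 first.
  + exact: exy.
  + by rewrite -[RHS]exy; apply: eq_bigr => l _; ring.
  by rewrite -[RHS](mE z' w zA wA ezw); apply: eq_bigr => l _; rewrite /pp (negPf nzv) (negPf nwv).
have mv : forall j, m v j = 0.
  apply: hinj => i; have [ciA civ] := cA i.
  rewrite -[RHS](mE v (c i) vA ciA (ev i)); apply: eq_bigr => j _.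
  rewrite /pp eqxx (negPf civ); have := mu (c i) j; rewrite (negPf civ) => ->.
  by rewrite subr0.
by move=> z i; have := mu z i; case: eqP => [->|//].
Qed.
End MoveLemmas.

(** * Removing an apex and one dimension *)

Section OrderCone.
Variables (F : realFieldType) (V : finType).
Implicit Types (A : {set V}) (e : rel V) (s : seq V).

Definition parent e (v : V) s (b : V) : V := nth v s (find (e b) s).

Definition uncone e (v : V) s : rel V := fun x y =>
  [&& e x y, ~~ (~~ e v x && (y == parent e v s x)) & ~~ (~~ e v y && (x == parent e v s y))].

Lemma find_le_index e s x y : e x y -> (find (e x) s <= index y s)%N.
Proof.
move=> exy; rewrite leqNgt; apply/negP=> lt.
have ys : y \in s by rewrite -index_mem (leq_trans lt) // find_size.
by have := before_find y lt; rewrite nth_index // exy.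
Qed.

Lemma index_parent e v s x :
  (find (e x) s < size s)%N -> e x (parent e v s x) /\ index (parent e v s x) s = find (e x) s.
Proof.
rewrite -has_find => hs; have exp := nth_find v hs; split=> //.
apply/eqP; rewrite eqn_leq find_le_index // andbT leqNgt.
by apply/negP=> /(before_find v) /=; rewrite eqxx.
Qed.

Lemma index_eq_parent e v s x y :
  (find (e x) s < size s)%N -> index y s = find (e x) s -> y = parent e v s x.
Proof. by move=> h E; rewrite /parent -E nth_index // -index_mem E. Qed.

(* The apex [v] is the origin and [x] lies at [lambda_x * (q_x, 1)], where the
   scales [lambda_x = c ^- index x s] spread out as [c] tends to [0].  A vertex
   [b] outside the neighbourhood of [v] keeps a radial degree of freedom; in the
   limit the edge to its first neighbour in [s] is used up to remove it, and all
   other edges become edges of the framework [q] one dimension lower. *)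
Lemma pinned_cone d A e v s k :
  symmetric e -> v \in A -> {subset s <= A :\ v} ->
  (forall b, b \in A :\ v -> ~~ e v b -> (find (e b) s < index b s)%N) ->
  pinned F d (A :\ v) (uncone e v s) k -> pinned F d.+1 A e (k + d.+1).
Proof.
move=> se vA sA dom [q [J [phi [cJ pin]]]].
pose pf x := find (e x) s; pose ix x := index x s; pose Y x := ~~ e v x.
have pfs b : b \in A :\ v -> Y b -> (pf b < size s)%N.
  by move=> bA Yb; apply: leq_trans (dom b bA Yb) (index_size _ _).
(* The truncated subtractions are exact: [pf x] is at most the index of any neighbour and less than
   [ix x]. At 0 the first power is 1 exactly when [y] is the parent of [x], and the second
   vanishes. *)
pose cf x y : {poly F} := if Y x then 'X^(ix y - pf x) - 'X^(ix x - pf x) else 0.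
pose a x y i : {poly F} :=
  if unlift ord0 i is Some j then (q x j - q y j)%:P else cf x y.
pose b x y i : {poly F} :=
  if unlift ord0 i is Some j then (q y j - q x j)%:P else cf y x.
(* For a neighbour of [v], the edge to the apex already removes the radial coordinate. *)
pose Z x i := (x \notin A :\ v) || ((i == ord0 :> 'I_d.+1) && ~~ Y x).
pose phi' j x i : {poly F} := if unlift ord0 i is Some l then (phi j x l)%:P else 0.
have sumE x y c (m : V -> 'I_d.+1 -> F) :
    \sum_i ((a x y i).[c] * m x i + (b x y i).[c] * m y i) =
    (cf x y).[c] * m x ord0 + (cf y x).[c] * m y ord0 +
    \sum_j (q x j - q y j) * (m x (lift ord0 j) - m y (lift ord0 j)).
  rewrite big_ord_recl /a /b unlift_none; congr (_ + _); apply: eq_bigr => j _.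
  by rewrite liftK !hornerC; ring.
have phiE c j (m : V -> 'I_d.+1 -> F) :
    \sum_x \sum_i (phi' j x i).[c] * m x i = \sum_x \sum_l phi j x l * m x (lift ord0 l).
  apply: eq_bigr => x _; rewrite big_ord_recl /phi' unlift_none horner0 mul0r add0r.
  by apply: eq_bigr => l _; rewrite liftK hornerC.
have [|Q Q0 QP] := @edge_inj_limit F V d.+1 J (act (A :\ v) e) Z a b phi' 0.
- move=> m mZ mE mP.
  have cf0 x y : x \in A :\ v -> y \in A :\ v -> e x y ->
      (cf x y).[0] = (Y x && (y == parent e v s x))%:R.
    move=> xA yA exy; rewrite /cf; case: (boolP (Y x)) => Yx; last by rewrite horner0.
    have lt := dom x xA Yx; rewrite hornerD hornerN !hornerXn !expr0n.
    rewrite [(ix x - pf x == 0)%N]subn_eq0 leqNgt lt subr0 /=; congr ((nat_of_bool _)%:R).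
    rewrite subn_eq0; apply/idP/eqP=> [le|->].
      apply: index_eq_parent; first exact: pfs.
      by apply/eqP; rewrite eqn_leq le find_le_index.
    by rewrite /ix (index_parent v (pfs x xA Yx)).2.
  have {}mE x y : x \in A :\ v -> y \in A :\ v -> e x y ->
      (Y x && (y == parent e v s x))%:R * m x ord0 +
      (Y y && (x == parent e v s y))%:R * m y ord0 +
      \sum_j (q x j - q y j) * (m x (lift ord0 j) - m y (lift ord0 j)) = 0.
    move=> xA yA exy; rewrite -(cf0 x y) // -(cf0 y x) 1?se // -sumE //.
    by apply: mE; apply/and3P.
  have m0 : forall x j, m x (lift ord0 j) = 0.
    apply: (pin (fun x j => m x (lift ord0 j))); last by move=> j; rewrite -(phiE 0).
    split=> [z i zA|z w zA wA /and3P[ezw n1 n2]]; first by rewrite mZ // /Z zA.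
    by have := mE z w zA wA ezw; rewrite (negPf n1) (negPf n2) !mul0r !add0r.
  move=> x i; case: (unliftP ord0 i) => [j|] ->; first exact: m0.
  case: (boolP (x \in A :\ v)) => xA; last by apply: mZ; rewrite /Z xA.
  case: (boolP (Y x)) => Yx; last by apply: mZ; rewrite /Z Yx eqxx orbT.
  have [exf ixf] := index_parent v (pfs x xA Yx).
  have fA : parent e v s x \in A :\ v by apply/sA/mem_nth/pfs.
  have := mE x _ xA fA exf; rewrite Yx eqxx mul1r.
  rewrite [X in _ + X]big1 => [|j _]; last by rewrite !m0 subrr mulr0.
  (* Two vertices cannot be each other's parent, since passing to the parent lowers the index. *)
  rewrite addr0; case: andP => [[Yf /eqP xf]|_]; last by rewrite mul0r addr0.
  have := dom _ fA Yf; have := dom x xA Yx.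
  have [_ <-] := index_parent v (pfs _ fA Yf); rewrite -xf ixf.
  by move=> l1 l2; have := ltn_trans l1 l2; rewrite ltnn.
have [c [c0 Qc _]] := nonroot (horner_neq0 Q0) (horner_neq0 Q0).
have cn n : c ^+ n != 0 by rewrite expf_neq0.
pose h x i : F := if unlift ord0 i is Some j then q x j else 1.
pose p x i : F := if x == v then 0 else (c ^+ ix x)^-1 * h x i.
(* The additional [d + 1] pins hold the apex still; the old ones are rescaled to the new
   unknowns. *)
pose psi (t : J + 'I_d.+1) x i : F := match t with
  | inl j => (phi' j x i).[c] * c ^+ ix x | inr l => (x == v)%:R * (i == l)%:R end.
exists p, (J + 'I_d.+1)%type, psi; rewrite card_sum cJ card_ord; split=> //.
move=> m [mA mE] mP.
have mv i : m v i = 0.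
  have := mP (inr i); rewrite (bigD1 v) //= [X in _ + X]big1 ?addr0 => [|x /negPf xv].
    rewrite (bigD1 i) //= [X in _ + X]big1 ?addr0 ?eqxx ?mul1r // => l /negPf li.
    by rewrite li mulr0 mul0r.
  by apply: big1 => l _; rewrite xv !mul0r.
pose S x y := \sum_i h x i * m y i.
have SE x y : S x y = m y ord0 + \sum_j q x j * m y (lift ord0 j).
  rewrite /S big_ord_recl /h unlift_none mul1r; congr (_ + _).
  by apply: eq_bigr => j _; rewrite liftK.
have SN x : x \in A :\ v -> ~~ Y x -> S x x = 0.
  rewrite !inE => /andP[xv xA]; rewrite negbK => evx.
  apply: (mulfI (_ : (c ^+ ix x)^-1 != 0)); first by rewrite invr_eq0.
  rewrite mulr0 -[RHS](mE v x vA xA evx) /S mulr_sumr; apply: eq_bigr => i _.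
  by rewrite /p eqxx (negPf xv) mv; ring.
have edge x y : x \in A :\ v -> y \in A :\ v -> e x y ->
    c ^+ ix y * S x x - c ^+ ix y * S x y - c ^+ ix x * S y x + c ^+ ix x * S y y = 0.
  rewrite !inE => /andP[xv xA] /andP[yv yA] exy.
  rewrite /S !mulr_sumr -!sumrB -big_split /= -[RHS](mulr0 (c ^+ ix x * c ^+ ix y)).
  rewrite -[X in _ = _ * X](mE x y xA yA exy) mulr_sumr; apply: eq_bigr => i _.
  rewrite /p (negPf xv) (negPf yv); field; by rewrite !cn.
(* In these unknowns, the edge equations multiplied by [c ^+ (ix x + ix y)] become the system with
   coefficients [a] and [b]; the new coordinate carries the radial part [S x x]. *)
pose M x i : F := if unlift ord0 i is Some j then c ^+ ix x * m x i
  else if (x \in A :\ v) && Y x then S x x * c ^+ pf x else 0.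
have M0 x : M x ord0 = if (x \in A :\ v) && Y x then S x x * c ^+ pf x else 0.
  by rewrite /M unlift_none.
have ML x j : M x (lift ord0 j) = c ^+ ix x * m x (lift ord0 j) by rewrite /M liftK.
have Mz : forall x i, M x i = 0.
  apply: (QP c Qc).
  - move=> x i; rewrite /Z; case: (unliftP ord0 i) => [j|] ->; rewrite ?ML ?M0.
      rewrite orbF !inE negb_and negbK => /orP[/eqP ->|xA]; first by rewrite mv mulr0.
      by rewrite mA ?mulr0.
    by case: (x \in _) => //=; case: (Y x).
  - move=> x y /and3P[xA yA exy]; rewrite sumE //.
    have cfS z w : z \in A :\ v -> w \in A :\ v -> e z w ->
        (cf z w).[c] * M z ord0 = (c ^+ ix w - c ^+ ix z) * S z z.
      move=> zA wA ezw; rewrite M0 zA /cf; case: (boolP (Y z)) => Yz; last first.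
        by rewrite SN // !mulr0.
      rewrite hornerD hornerN !hornerXn.
      have l1 : (pf z <= ix w)%N by apply: find_le_index.
      have l2 : (pf z <= ix z)%N by apply: ltnW; apply: dom.
      have -> : c ^+ ix w = c ^+ (ix w - pf z) * c ^+ pf z by rewrite -exprD subnK.
      have -> : c ^+ ix z = c ^+ (ix z - pf z) * c ^+ pf z by rewrite -exprD subnK.
      rewrite /=; ring.
    have eyx : e y x by rewrite se.
    rewrite (cfS x y) // (cfS y x) // -[RHS](edge x y xA yA exy) !SE.
    have -> : \sum_j (q x j - q y j) * (M x (lift ord0 j) - M y (lift ord0 j)) =
       c ^+ ix x * (\sum_j q x j * m x (lift ord0 j)) - c ^+ ix y * (\sum_j q x j * m y (lift ord0 j))
       - c ^+ ix x * (\sum_j q y j * m x (lift ord0 j)) + c ^+ ix y * (\sum_j q y j * m y (lift ord0 j)).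
      rewrite !mulr_sumr -!sumrB -big_split /=; apply: eq_bigr => j _; rewrite !ML; ring.
    ring.
  - move=> j; rewrite phiE -[RHS](mP (inl j)) /psi /=; apply: eq_bigr => x _.
    rewrite [RHS]big_ord_recl /phi' unlift_none horner0 !mul0r add0r.
    by apply: eq_bigr => l _; rewrite liftK hornerC ML; ring.
have mL x j : m x (lift ord0 j) = 0.
  by apply: (mulfI (cn (ix x))); rewrite mulr0 -ML.
move=> x i; case: (unliftP ord0 i) => [j|] ->; first exact: mL.
case: (boolP (x \in A :\ v)) => xA; last first.
  by move: xA; rewrite !inE negb_and negbK => /orP[/eqP->|/mA].
have S0 : S x x = 0.
  case: (boolP (Y x)) => Yx; last exact: SN.
  by apply: (mulIf (cn (pf x))); rewrite mul0r -[RHS](Mz x ord0) M0 xA Yx.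
move: S0; rewrite SE big1 ?addr0 // => j _; by rewrite mL mulr0.
Qed.

Lemma pinned0 A e : pinned F 0 A e 0.
Proof. by exists (fun _ _ => 0), 'I_0, (fun _ _ _ => 0); rewrite card_ord; split=> // m _ _ x []. Qed.

End OrderCone.

End Moves.

(** * Minimum degree forces infinitesimal rigidity *)

Section Process.
Variables (F : realFieldType) (V : finType).
Implicit Types (A R G W Y : {set V}) (e : rel V) (s ys : seq V).

Definition nonnbrs A e (x : V) : {set V} := [set w in A | (w != x) && ~~ e x w].

(** Greedy choice: the next vertex [r] is taken outside the set [W] of undominated vertices, so if
    [r] lies in [Y] it already has an earlier neighbour. For [b] outside [s] the index is [size s],
    and the conclusion just asks for a neighbour in [s]. *)
Lemma dominating_seq e G Y :
  symmetric e ->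
  (forall b, b \in Y -> ~~ e b b) ->
  (forall W, W \subset Y -> W != set0 -> exists r w, [/\ r \in G, r \notin W, w \in W & e w r]) ->
  exists2 s, {subset s <= G} & forall b, b \in Y -> find (e b) s < index b s.
Proof.
move=> se irr ext.
suff H n s : {subset s <= G} -> (forall b, b \in Y -> b \in s -> find (e b) s < index b s) ->
    #|[set b in Y | ~~ has (e b) s]| <= n ->
    exists2 s, {subset s <= G} & forall b, b \in Y -> find (e b) s < index b s.
  by apply: (H _ [::]) => //; apply: leqnn.
elim: n s => [|n IH] s sG inv; set W := [set b in Y | _].
  rewrite leqn0 cards_eq0 => /eqP W0; exists s => // b bY.
  case: (boolP (b \in s)) => bs; first exact: inv.
  have hb : has (e b) s.
    apply/negPn/negP => nh; have : b \in W by rewrite inE bY nh.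
    by rewrite W0 inE.
  by rewrite (memNindex bs) -has_find.
have [W0|Wn0] := eqVneq W set0; first by move=> _; apply: (IH s) => //; rewrite -/W W0 cards0.
have WY : W \subset Y by apply/subsetP => x; rewrite inE => /andP[].
have [r [w [rG rW wW ewr]]] := ext W WY Wn0.
move=> Wn; apply: (IH (rcons s r)).
- by move=> x; rewrite mem_rcons inE => /predU1P[->|/sG].
- move=> b bY; rewrite mem_rcons inE -!cats1 find_cat index_cat.
  case: (boolP (b \in s)) => [bs _|bs].
    have lt := inv b bY bs; rewrite has_find (leq_trans lt) ?index_size //.
  rewrite orbF => /eqP br; subst b.
  have : r \notin W := rW; rewrite inE bY /= negbK => hr; rewrite hr.
  by rewrite (leq_trans _ (leq_addr _ _)) // -has_find.
- rewrite -ltnS; apply: leq_trans Wn; apply: proper_card; apply/properP; split.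
    by apply/subsetP=> b; rewrite !inE has_rcons negb_or => /and3P[-> _ ->].
  by exists w => //; rewrite !inE has_rcons ewr andbF.
Qed.

Section Step.
Variables (A : {set V}) (e : rel V) (v : V) (s : seq V).
Hypotheses (se : symmetric e) (vA : v \in A) (sA : {subset s <= A :\ v}).
Hypothesis dom : forall b, b \in A :\ v -> ~~ e v b -> find (e b) s < index b s.

Definition children (x : V) : {set V} := [set b in nonnbrs A e v | parent e v s b == x].

Lemma uncone_sym : symmetric (uncone e v s).
Proof. by move=> x y; rewrite /uncone se; congr (_ && _); apply: andbC. Qed.

(** If [x] is not adjacent to [v], losing the edge to its parent is offset by [v] leaving its
    non-neighbours; only the edges to its children are a net loss. *)
Lemma nonnbrs_uncone x : x \in A :\ v ->
  #|nonnbrs (A :\ v) (uncone e v s) x| <= #|nonnbrs A e x| + #|children x|.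
Proof.
move=> xA; have [xv xA'] : x != v /\ x \in A by move: xA; rewrite !inE => /andP.
have sub : nonnbrs (A :\ v) (uncone e v s) x \subset
    (nonnbrs A e x :\ v :|: (if e v x then set0 else [set parent e v s x])) :|: children x.
  apply/subsetP => w; rewrite !inE => /and3P[/andP[wv wA] wx].
  rewrite /uncone !negb_and !negbK; case: (e x w) => /=; last by rewrite wv wA wx.
  rewrite wv wA wx /= (eq_sym x (parent e v s w)); case: (e v x); rewrite /= ?inE.
    by rewrite negb_or negbK.
  by rewrite negb_or !negbK.
apply: leq_trans (subset_leq_card sub) _; rewrite (leq_trans (leq_card_setU _ _)) // leq_add2r.
apply: leq_trans (leq_card_setU _ _) _.
have := cardsD1 v (nonnbrs A e x); rewrite !inE vA eq_sym xv se /=.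
by case: (e v x) => /= ->; rewrite ?cards0 ?cards1; lia.
Qed.

Lemma sum_children : \sum_x #|children x| = #|nonnbrs A e v|.
Proof.
rewrite -[RHS]sum1_card [RHS](partition_big (parent e v s) xpredT) //=; apply: eq_bigr => x _.
by rewrite -sum1_card; apply: eq_bigl => b; rewrite !inE.
Qed.

Lemma children_mem x : children x != set0 -> x \in s.
Proof.
case/set0Pn=> b; rewrite !inE => /andP[/and3P[bA bv evb] /eqP <-].
rewrite /parent mem_nth // (leq_trans (dom _ evb)) ?index_size //.
by rewrite !inE bv.
Qed.
End Step.

(* [dm x] bounds the number of edges that [x] has lost by serving as a parent;
   [B] bounds the initial number of non-neighbours. *)
Lemma pinned_apexes R B w d0 :
  B + 3 * w + d0 + 1 < #|R| ->
  forall j ys e (dm : V -> nat),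
  size ys = j -> uniq ys -> (forall y, y \in ys -> y \notin R) ->
  symmetric e -> irreflexive e ->
  (forall y, y \in ys -> #|nonnbrs (R :|: [set z in ys]) e y| <= w) ->
  (forall x, x \in R -> #|nonnbrs (R :|: [set z in ys]) e x| <= B + dm x) ->
  (forall x, x \in R -> dm x <= 2 * w) ->
  \sum_(x in R) dm x + w * j <= w * d0 ->
  pinned F j (R :|: [set z in ys]) e 'C(j.+1, 2).
Proof.
move=> Rbig; elim=> [|j IH] ys e dm; first by move=> _ _ _ _ _ _ _ _ _; apply: pinned0.
case: ys => [|v ys] // [szys] /= /andP[vys uys] ysR se irr nny nnR dmw sdm.
set A := R :|: _ in nny nnR *.
have vR : v \notin R by apply: ysR; rewrite mem_head.
have vA : v \in A by rewrite !inE eqxx orbT.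
have Av : A :\ v = R :|: [set z in ys].
  apply/setP=> x; rewrite !inE; case: eqP => //= ->.
  by rewrite (negPf vys) (negPf vR).
set Y := nonnbrs A e v; have Yw : #|Y| <= w by apply: nny; rewrite mem_head.
(* Only vertices that have lost at most [w] edges become parents; one removal costs each at most [w]
   more, whence the bound [2 * w]. *)
pose G := [set x in R | dm x <= w].
have heavy : #|R :\: G| <= d0.
  rewrite leqNgt; apply/negP=> lt.
  have : #|R :\: G| * w.+1 <= \sum_(x in R) dm x.
    rewrite -sum_nat_const [X in _ <= X](big_setID G) /= (leq_trans _ (leq_addl _ _)) //.
    by apply: leq_sum => x; rewrite !inE => /andP[+ xR]; rewrite xR -ltnNge.
  move: (leq_mul lt (leqnn w.+1)); rewrite [d0.+1 * _]mulSn [d0 * _]mulnS => h1 h2.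
  by have := leq_trans h1 h2; move: sdm; rewrite (mulnC w d0); lia.
have GA : {subset G <= A :\ v}.
  by move=> x; rewrite Av !inE => /andP[-> _].
(* For an undominated [w0], the candidates in [R] exclude at most [d0] heavy vertices, [w] vertices
   of [W], [w0] itself and [B + 2 * w] non-neighbours; [Rbig] leaves one over. *)
have [b|W WY Wn0|s sG dom] := @dominating_seq e G Y se; first by rewrite irr.
  have [w0 w0W] := set0Pn _ Wn0.
  have w0A : w0 \in A by have := subsetP WY w0 w0W; rewrite inE => /andP[].
  have nnw : #|nonnbrs A e w0| <= B + 2 * w.
    move: w0A; rewrite inE => /orP[w0R|]; last first.
      by rewrite inE => /nny h; lia.
    by have := nnR _ w0R; have := dmw _ w0R; lia.
  have Ww : #|W| <= w by apply: leq_trans Yw; apply: subset_leq_card.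
  case: (set_0Vmem ((G :\: W) :\: (w0 |: nonnbrs A e w0))) => [E|[r]].
    have RA : R \subset (R :\: G) :|: (W :|: (w0 |: nonnbrs A e w0)).
      apply/subsetP=> x xR; move/setP/(_ x): E; rewrite !inE xR /=.
      by case: (dm x <= w); case: (x \in W); rewrite ?orbT //= andbT => /negbFE.
    have := subset_leq_card RA.
    have := (leq_card_setU (R :\: G) (W :|: (w0 |: nonnbrs A e w0))).1.
    have := (leq_card_setU W (w0 |: nonnbrs A e w0)).1.
    have := (leq_card_setU [set w0] (nonnbrs A e w0)).1; rewrite cards1.
    by move: Rbig heavy nnw Ww; clear; lia.
  rewrite !inE => /andP[/norP[rw0 H] /and3P[rW rR rl]].
  exists r, w0; split=> //; first by rewrite inE rR.
  by move: H; rewrite rR rw0 /= negbK.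
have sA : {subset s <= A :\ v} by move=> x /sG/GA.
have dom' b : b \in A :\ v -> ~~ e v b -> find (e b) s < index b s.
  by rewrite !inE => /andP[bv bA] evb; apply: dom; rewrite !inE bv evb bA.
have -> : 'C(j.+2, 2) = 'C(j.+1, 2) + j.+1 by rewrite binS bin1.
apply: (pinned_cone se vA sA dom'); rewrite Av.
pose ch x := #|children A e v s x|.
have chG x : 0 < ch x -> x \in G.
  by rewrite card_gt0 => /(children_mem dom') /sG.
have chw x : ch x <= w.
  by apply: leq_trans Yw; apply: subset_leq_card; apply/subsetP=> b; rewrite !inE => /andP[].
have nnu x : x \in A :\ v ->
    #|nonnbrs (R :|: [set z in ys]) (uncone e v s) x| <= #|nonnbrs A e x| + ch x.
  by move=> xA; rewrite -Av; apply: nonnbrs_uncone.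
apply: (IH ys _ (fun x => dm x + ch x)) => //.
- by move=> y yys; apply: ysR; rewrite inE yys orbT.
- exact: uncone_sym.
- by move=> x; rewrite /uncone irr.
(* Parents lie in [R], so the remaining apexes lose no edge to children. *)
- move=> y yys; have yA : y \in A :\ v by rewrite Av !inE yys orbT.
  apply: leq_trans (nnu y yA) _; have -> : ch y = 0.
    apply/eqP; rewrite -leqn0 leqNgt; apply/negP=> /chG; rewrite inE => /andP[yR _].
    by have := ysR y; rewrite inE yys orbT yR => /(_ isT).
  by rewrite addn0; apply: nny; rewrite inE yys orbT.
- move=> x xR; have xA : x \in A :\ v by rewrite Av !inE xR.
  by apply: leq_trans (nnu x xA) _; rewrite addnA leq_add2r; apply: nnR.
- move=> x xR; have [c0|/chG] := posnP (ch x); first by rewrite c0 addn0 dmw.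
  by rewrite inE => /andP[_ l]; have := chw x; lia.
- rewrite big_split /=; have : \sum_(x in R) ch x <= w.
    apply: leq_trans Yw; rewrite -(sum_children A e v s).
    by rewrite [X in _ <= X](bigID (mem R)) /= leq_addr.
  by move: sdm; rewrite mulnS; lia.
Qed.

End Process.

Lemma inj_of_card (V : finType) (C : {set V}) d :
  d <= #|C| -> exists2 c : 'I_d -> V, injective c & forall i, c i \in C.
Proof.
move=> dC; exists (fun i => enum_val (widen_ord dC i)) => [i j|i]; last exact: enum_valP.
by move/enum_val_inj/(congr1 val) => /= /val_inj.
Qed.

(** * Contracted graphs and their blocks *)

Section Blocks.
Variables (F : realFieldType) (V : finType) (e : rel V).
Hypotheses (se : symmetric e) (irr : irreflexive e).
Implicit Types (A S T : {set V}) (B : V -> {set V}) (ys : seq V).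

(* [qrel B] is the graph obtained by contracting each block [B z] to [z]. *)
Definition qrel B : rel V :=
  fun z w => (z != w) && [exists z' in B z, [exists w' in B w, e z' w']].

Lemma qrelP B z w :
  reflect (z != w /\ exists z' w', [/\ z' \in B z, w' \in B w & e z' w']) (qrel B z w).
Proof.
apply: (iffP andP) => -[zw].
  by move=> /exists_inP[z' zz /exists_inP[w' ww ezw]]; split=> //; exists z', w'.
by move=> [z' [w' [zz ww ezw]]]; split=> //; apply/exists_inP; exists z' => //; apply/exists_inP; exists w'.
Qed.

Lemma qrel_sym B : symmetric (qrel B).
Proof.
by move=> z w; apply/qrelP/qrelP => -[zw [x [y [xz yw exy]]]]; (split; first by rewrite eq_sym);
  exists y, x; rewrite se.
Qed.

Lemma qrel_irr B : irreflexive (qrel B).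
Proof. by move=> z; rewrite /qrel eqxx. Qed.

Definition upd B u S : V -> {set V} := fun z => if z == u then S else B z.

Definition common A B u x : {set V} :=
  [set c in A | [&& c != u, c != x, qrel B u c & qrel B x c]].

Lemma pinned_block_merge d A B u x k :
  u \in A -> x \in A -> u != x -> d <= #|common A B u x| + qrel B u x ->
  pinned F d (A :\ x) (qrel (upd B u (B u :|: B x))) k -> pinned F d A (qrel B) k.
Proof.
move=> uA xA ux dC pin.
have {pin} pin : pinned F d (A :\ x) (merge_rel (qrel B) u x) k.
  apply: pinned_sub pin => z w; rewrite !inE => /andP[zx zA] /andP[wx wA] zw.
  move=> /qrelP[_ [z' [w' [+ + ezw]]]]; rewrite /upd /merge_rel.
  case: (eqVneq z u) => zu; case: (eqVneq w u) => wu.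
  - by rewrite zu wu eqxx in zw.
  - rewrite inE => /orP[zz|zz] ww; apply/orP; [left|right; apply/orP; left].
      by apply/qrelP; split=> //; exists z', w'; rewrite zu.
    by rewrite /=; apply/qrelP; split; [rewrite eq_sym|exists z', w'].
  - move=> zz; rewrite inE => /orP[ww|ww]; apply/orP; [left|right].
      by apply/qrelP; split=> //; exists z', w'; rewrite wu.
    by rewrite /=; apply/qrelP; split=> //; exists z', w'.
  - by move=> zz ww; rewrite /= orbF; apply/qrelP; split=> //; exists z', w'.
have [dC'|] := leqP d #|common A B u x|.
  have [c ci cC] := inj_of_card dC'.
  apply: (pinned_merge (good := xpredT) (qrel_sym B) uA xA ux ci _ _ pin) => // i _.
  by have := cC i; rewrite inE => /and5P[].
case: d dC pin => // d dC pin ltC.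
have [dC' uxq] : d <= #|common A B u x| /\ qrel B u x.
  by move: dC ltC; case: (qrel B u x) => /=; lia.
have [c ci cC] := inj_of_card dC'.
(* The slot [ord0] is the bad index, replaced by the edge [u x]; it holds [u], which differs from
   every [c j], only to keep [c'] injective. *)
pose c' i := if unlift ord0 i is Some j then c j else u.
have cu j : c j != u by have := cC j; rewrite inE => /and5P[].
apply: (pinned_merge (good := fun i : 'I_d.+1 => i != ord0) (c := c') (qrel_sym B) uA xA ux _ _ _ pin).
- move=> i j; rewrite /c'; case: (unliftP ord0 i) => [i'|] ->; case: (unliftP ord0 j) => [j'|] -> //.
  + by move/ci->.
  + by move=> E; have := cu i'; rewrite E eqxx.
  + by move=> E; have := cu j'; rewrite -E eqxx.
- move=> i; rewrite /c'; case: (unliftP ord0 i) => [i'|] -> // _.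
  by have := cC i'; rewrite inE => /and5P[].
- by move=> i; rewrite negbK => /eqP ->.
Qed.

Variable A0 : {set V}.

Definition nbrs S : {set V} := [set w in A0 | [exists z in S, e z w]].

Lemma nbrsP S w : reflect (w \in A0 /\ exists2 z, z \in S & e z w) (w \in nbrs S).
Proof.
rewrite inE; apply: (iffP andP) => -[wA]; first by move=> /exists_inP[z zS ezw]; split=> //; exists z.
by move=> [z zS ezw]; split=> //; apply/exists_inP; exists z.
Qed.

Lemma nbrsU S T : nbrs (S :|: T) = nbrs S :|: nbrs T.
Proof.
apply/setP=> w; rewrite in_setU; apply/nbrsP/orP.
  by move=> [wA [z]]; rewrite inE => /orP[zS|zT] ezw; [left|right]; apply/nbrsP; split=> //; exists z.
by case=> /nbrsP[wA [z zS ezw]]; split=> //; exists z; rewrite // inE zS ?orbT.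
Qed.

Definition rest ys B : {set V} := [set z in A0 | ~~ has (fun y => z \in B y) ys].
Definition active ys B : {set V} := rest ys B :|: [set z in ys].

Definition wf ys B : Prop :=
  [/\ uniq ys, (forall y, y \in ys -> y \in B y), (forall y, y \in ys -> B y \subset A0),
      (forall y y', y \in ys -> y' \in ys -> y != y' -> [disjoint B y & B y']) &
      (forall z, z \notin ys -> B z = [set z])].

Lemma rest_notin ys B z : wf ys B -> z \in rest ys B -> z \notin ys.
Proof.
case=> _ yB _ _ _; rewrite inE => /andP[_ /hasPn h]; apply/negP=> zys.
by have := h z zys; rewrite yB.
Qed.

Lemma active_sub ys B : wf ys B -> active ys B \subset A0.
Proof.
move=> wfB; apply/subsetP=> z; rewrite !inE => /orP[/andP[]//|zys].
by case: wfB => _ yB BA _ _; apply: (subsetP (BA z zys)); apply: yB.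
Qed.

Lemma block_mem ys B z : wf ys B -> z \in B z.
Proof.
case=> _ yB _ _ Bz; case: (boolP (z \in ys)) => [/yB //|/Bz ->]; exact: set11.
Qed.

Lemma rest_card ys B : #|A0| <= #|rest ys B| + \sum_(y <- ys) #|B y|.
Proof.
have sub : A0 \subset rest ys B :|: \bigcup_(y <- ys) B y.
  apply/subsetP=> z zA; rewrite !inE zA /=; case: hasP => //= -[y yys zy].
  by rewrite (big_rem y yys) /= in_setU zy.
apply: leq_trans (subset_leq_card sub) _; apply: leq_trans (leq_card_setU _ _).1 _.
rewrite leq_add2l; elim: ys {sub} => [|y ys IH]; first by rewrite !big_nil cards0.
rewrite !big_cons; apply: leq_trans (leq_card_setU _ _).1 _; by rewrite leq_add2l.
Qed.

(** Common neighbours are counted in [rest] only: there blocks are singletons, so distinct vertices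
    stay distinct after contraction. *)
Lemma extend_unit d ys B y v k :
  wf ys B -> y \in ys -> v \in rest ys B ->
  d <= #|nbrs (B y) :&: nbrs [set v] :&: rest ys B| ->
  wf ys (upd B y (B y :|: [set v])) /\
  (pinned F d (active ys (upd B y (B y :|: [set v]))) (qrel (upd B y (B y :|: [set v]))) k ->
   pinned F d (active ys B) (qrel B) k).
Proof.
move=> wfB yys vR dC; have vys := rest_notin wfB vR.
have [uys yB BA dis Bz] := wfB; have Bv := Bz v vys.
have vy : y != v by apply: contraNneq vys => <-.
have vB y' : y' \in ys -> v \notin B y'.
  by move=> y'ys; move: vR; rewrite inE => /andP[_ /hasPn]; apply.
have vA0 : v \in A0 by move: vR; rewrite inE => /andP[].
set B' := upd _ _ _.
have B'y : B' y = B y :|: [set v] by rewrite /B' /upd eqxx.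
have B'n z : z != y -> B' z = B z by rewrite /B' /upd => /negPf ->.
have actE : active ys B' = active ys B :\ v.
  apply/setP=> z; rewrite !inE; case: (eqVneq z v) => [->|zv] /=.
    rewrite (negPf vys) orbF vA0 /=; apply/negbTE; rewrite negbK.
    by apply/hasP; exists y; rewrite // B'y !inE eqxx orbT.
  congr (_ && ~~ _ || _); apply: eq_in_has => y' y'ys.
  by rewrite /B' /upd; case: (eqVneq y' y) => [->|//]; rewrite !inE (negPf zv) orbF.
split.
  split=> //.
  - move=> z zys; case: (eqVneq z y) => [->|zy]; last by rewrite B'n ?yB.
    by rewrite B'y inE yB.
  - move=> z zys; case: (eqVneq z y) => [->|zy]; last by rewrite B'n ?BA.
    by rewrite B'y subUset BA // sub1set.
  - move=> z w zys wys zw; case: (eqVneq z y) => [zy|zy]; case: (eqVneq w y) => [wy|wy].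
    + by rewrite zy wy eqxx in zw.
    + rewrite zy B'y B'n // -setI_eq0 setIUl setU_eq0 !setI_eq0 disjoints1 vB // andbT; apply: dis => //; by rewrite eq_sym.
    + rewrite wy B'y B'n // disjoint_sym -setI_eq0 setIUl setU_eq0 !setI_eq0 disjoints1 vB // andbT.
      by apply: dis => //; rewrite eq_sym.
    + by rewrite !B'n //; apply: dis.
  - by move=> z zys; rewrite B'n ?Bz //; apply: contraNneq zys => ->.
have B'E : B' = upd B y (B y :|: B v) by rewrite Bv.
rewrite actE B'E => pin; apply: (pinned_block_merge (u := y) (x := v)) pin.
- by rewrite !inE yys orbT.
- by rewrite inE vR.
- exact: vy.
- apply: leq_trans (leq_addr _ _); apply: leq_trans dC _; apply: subset_leq_card.
  apply/subsetP=> c; rewrite in_setI in_setI => /andP[/andP[/nbrsP[cA [b bB ebc]] /nbrsP[_ [v']]]].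
  rewrite inE => /eqP -> evc cR; have cys := rest_notin wfB cR; have Bc := Bz c cys.
  have cy : c != y by apply: contraNneq cys => ->.
  have cv : c != v by apply: contraTneq evc => ->; rewrite irr.
  rewrite inE cy cv /= in_setU cR /=; apply/andP; split; apply/qrelP.
    by split; [rewrite eq_sym|exists b, c; rewrite Bc set11].
  by split; [rewrite eq_sym|exists v, c; rewrite Bc Bv !set11].
Qed.

End Blocks.

Lemma card_sum_pred (V : finType) (W : {set V}) (P : pred V) :
  #|[set w in W | P w]| = \sum_(w in W) P w.
Proof.
rewrite -sum1_card big_mkcond [RHS]big_mkcond; apply: eq_bigr => w _ /=.
by rewrite inE; case: (w \in W); case: (P w).
Qed.

Lemma double_count (V : finType) (e : rel V) (R W : {set V}) :
  symmetric e ->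
  \sum_(v in R) #|[set w in W | e v w]| = \sum_(w in W) #|[set v in R | e w v]|.
Proof.
move=> se; under eq_bigr => v _ do rewrite card_sum_pred.
rewrite exchange_big; apply: eq_bigr => w _; rewrite card_sum_pred.
by apply: eq_bigr => v _; rewrite se.
Qed.

(** * Growing the merged vertices into dominating units *)

Section Rounds.
Variables (F : realFieldType) (V : finType) (e : rel V).
Hypotheses (se : symmetric e) (irr : irreflexive e).
Variable A0 : {set V}.
Implicit Types (A S T R W : {set V}) (B : V -> {set V}) (ys : seq V).
Local Notation nbrs := (nbrs e A0).
Local Notation rest := (rest A0).
Local Notation active := (active A0).
Local Notation wf := (wf A0).
Variables (d D : nat).
Hypotheses (degD : forall z, z \in A0 -> D <= #|nbrs [set z]|) (d0 : 0 < d).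
(** One unit weaker than the bounds of the whole graph, so that they still hold after a vertex is
    deleted and both [#|A0|] and [D] drop by one. *)
Hypotheses (HD : #|A0| + d <= 2 * D + 3) (Hn : 29 * d <= #|A0| + 1).

Lemma nbrs1 z : nbrs [set z] = [set w in A0 | e z w].
Proof.
apply/setP=> w; rewrite [RHS]inE; apply/nbrsP/andP.
  by move=> [-> [z']]; rewrite inE => /eqP ->.
by move=> [-> ezw]; split=> //; exists z; rewrite ?inE.
Qed.

(** At most [5 * d] vertices lie outside [rest], so each vertex of [W] is adjacent to at least a
    third of [rest]; by double counting, some vertex of [rest] sees a third of [W]. *)
Lemma covering_vertex ys B W :
  #|A0| <= #|rest ys B| + 5 * d -> W \subset A0 ->
  exists2 v, v \in rest ys B & #|W| <= 3 * #|W :&: nbrs [set v]|.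
Proof.
set R := rest ys B => bigR WA.
have RA : R \subset A0 by apply/subsetP=> z; rewrite inE => /andP[].
have R0 : 0 < #|R| by lia.
clearbody R.
have [/existsP[v /andP[vR H]]|/existsPn nex] :=
  boolP [exists v, (v \in R) && (#|W| <= 3 * #|W :&: nbrs [set v]|)]; first by exists v.
have H1 : 3 * (\sum_(v in R) #|[set w in W | e v w]|) + #|R| <= #|R| * #|W|.
  have : \sum_(v in R) (3 * #|[set w in W | e v w]| + 1) <= \sum_(v in R) #|W|; last first.
    by rewrite big_split -big_distrr /= sum1_card sum_nat_const.
  apply: leq_sum => v vR.
  have := nex v; rewrite vR /= -ltnNge addn1.
  suff -> : W :&: nbrs [set v] = [set w in W | e v w] by [].
  apply/setP=> w; rewrite nbrs1 !inE; case: (boolP (w \in W)) => //= wW.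
  by rewrite (subsetP WA).
have H2 : #|W| * (D + #|R| - #|A0|) <= \sum_(w in W) #|[set v in R | e w v]|.
  rewrite -sum_nat_const; apply: leq_sum => w wW.
  have wA := subsetP WA w wW; have := degD wA; rewrite nbrs1.
  have : #|[set v in A0 | e w v]| <= #|[set v in R | e w v]| + #|A0 :\: R|.
    apply: leq_trans (leq_card_setU _ _).1; apply: subset_leq_card; apply/subsetP => v.
    by rewrite !inE => /andP[-> ->]; case: (_ \in R); rewrite ?orbT.
  by have := cardsID R A0; rewrite (setIidPr RA); lia.
move: H1; rewrite (double_count _ _ se) => H1.
have H3 : 3 * #|W| * (D + #|R| - #|A0|) + #|R| <= #|R| * #|W| by lia.
have H4 : #|R| <= 3 * (D + #|R| - #|A0|) by lia.
by move: (leq_mul (leqnn #|W|) H4); lia.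
Qed.

(** Induction on the number of absorptions still to be made, [f y] for the unit [y]. Each takes a
    vertex seeing a third of what [y] still misses, which gives the factor 2/3. *)
Lemma extend_units ys B (f : V -> nat) k :
  wf ys B -> size ys = d -> (forall y, y \in ys -> #|B y| <= 2) ->
  (forall y, y \in ys -> #|A0| + 11 * d + 3 <= 2 * #|nbrs (B y)|) ->
  (forall y, y \in ys -> f y <= 3) ->
  exists B', [/\ wf ys B',
    pinned F d (active ys B') (qrel e B') k -> pinned F d (active ys B) (qrel e B) k,
    (forall y, y \in ys -> #|B' y| <= 2 + f y),
    (forall y, y \in ys -> nbrs (B y) \subset nbrs (B' y)) &
    (forall y, y \in ys -> 3 ^ f y * #|A0 :\: nbrs (B' y)| <= 2 ^ f y * #|A0 :\: nbrs (B y)|)].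
Proof.
move=> wfB sz B2 cov; move Em: (\sum_(y <- ys) f y) => m.
elim: m f Em => [|m IH] f Em f3.
  have f0 y : y \in ys -> f y = 0.
    by move=> yys; apply/eqP; move/eqP: Em; rewrite (big_rem y yys) addn_eq0 => /andP[].
  exists B; split=> // y yys; rewrite ?f0 // ?addn0 ?B2 //.
have [y yys fy] : exists2 y, y \in ys & 0 < f y.
  apply/hasP/negPn/negP => /hasPn nh; move: Em; rewrite big1_seq // => y /= yys.
  by apply/eqP; rewrite -leqn0 leqNgt nh.
have uys : uniq ys by case: wfB.
pose f' z := if z == y then (f y).-1 else f z.
have f'y : f' y = (f y).-1 by rewrite /f' eqxx.
have f'n z : z != y -> f' z = f z by rewrite /f' => /negPf ->.
have sumf' : \sum_(z <- ys) f' z = m.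
  apply: succn_inj; rewrite -Em !(bigD1_seq y) //= f'y.
  rewrite (eq_bigr f) => [|z /f'n //]; by move: fy; lia.
have f'3 z : z \in ys -> f' z <= 3.
  by move=> zys; rewrite /f'; case: eqP => _; [have := f3 y yys; lia | apply: f3].
have [B1 [wf1 pin1 c1 n1 w1]] := IH f' sumf' f'3.
set W := A0 :\: nbrs (B1 y) in w1.
(* Strict because [y] has yet to take its last vertex, so its block has at most four. *)
have tot : \sum_(z <- ys) #|B1 z| < 5 * d.
  have : \sum_(z <- ys) #|B1 z| + 1 <= \sum_(z <- ys) 5.
    rewrite !(bigD1_seq y) //= addnAC leq_add //.
      by have := c1 y yys; rewrite f'y; have := f3 y yys; move: fy; lia.
    rewrite big_seq_cond [X in _ <= X]big_seq_cond; apply: leq_sum => z /andP[zys zy].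
    by apply: leq_trans (c1 z zys) _; have := f'3 z zys; lia.
  by rewrite big_const_seq count_predT iter_addn_0 sz addn1.
have bigR : #|A0| < #|rest ys B1| + 5 * d.
  by apply: leq_ltn_trans (rest_card A0 ys B1) _; rewrite ltn_add2l.
have [v vR vW] : exists2 v, v \in rest ys B1 & #|W| <= 3 * #|W :&: nbrs [set v]|.
  by apply: covering_vertex; rewrite ?subsetDl // ltnW.
have vA : v \in A0 by move: vR; rewrite inE => /andP[].
(* The two neighbourhoods have total size at least [#|A0| + 6 * d], hence [6 * d] vertices in
   common, of which fewer than [5 * d] lie in blocks. The [11 * d + 3] in [cov] provides this. *)
have legal : d <= #|nbrs (B1 y) :&: nbrs [set v] :&: rest ys B1|.
  have sub S : nbrs S \subset A0 by apply/subsetP=> z; rewrite inE => /andP[].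
  have := subset_leq_card (n1 y yys); have := cov y yys; have := degD vA.
  have RA : rest ys B1 \subset A0 by apply/subsetP=> z; rewrite inE => /andP[].
  have := subset_leq_card (_ : nbrs (B1 y) :|: nbrs [set v] \subset A0).
  rewrite subUset !sub => /(_ isT).
  have := subset_leq_card (_ : (nbrs (B1 y) :&: nbrs [set v]) :|: rest ys B1 \subset A0).
  rewrite subUset RA subIset ?sub // => /(_ isT).
  have := cardsUI (nbrs (B1 y)) (nbrs [set v]).
  have := cardsUI (nbrs (B1 y) :&: nbrs [set v]) (rest ys B1).
  move: bigR HD Hn; lia.
have [wf2 pin2] := extend_unit F se irr k wf1 yys vR legal.
set B2' := upd _ _ _ in wf2 pin2.
have B2y : B2' y = B1 y :|: [set v] by rewrite /B2' /upd eqxx.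
have B2n z : z != y -> B2' z = B1 z by rewrite /B2' /upd => /negPf ->.
exists B2'; split=> //.
- by move=> /pin2.
- move=> z zys; case: (eqVneq z y) => [->|zy]; last by rewrite B2n // -(f'n z) // c1.
  rewrite B2y; have := (leq_card_setU (B1 y) [set v]).1; rewrite cards1.
  by have := c1 y yys; rewrite f'y; move: fy; lia.
- move=> z zys; case: (eqVneq z y) => [->|zy]; last by rewrite B2n // n1.
  by rewrite B2y nbrsU (subset_trans (n1 y yys)) // subsetUl.
- move=> z zys; case: (eqVneq z y) => [->|zy]; last by rewrite B2n // -(f'n z) // w1.
  rewrite B2y nbrsU; have := w1 y yys; rewrite -/W f'y.
  have -> : A0 :\: (nbrs (B1 y) :|: nbrs [set v]) = W :\: nbrs [set v] by rewrite setDDl.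
  have := cardsID (nbrs [set v]) W; case: (f y) fy => // g _ /= E h.
  have : 3 * #|W :\: nbrs [set v]| <= 2 * #|W| by lia.
  by move=> h2; rewrite !expnS; move: h h2; set a := 3 ^ g; set b := 2 ^ g; nia.
Qed.

Lemma pinned_of_units ys B :
  wf ys B -> size ys = d -> (forall y, y \in ys -> #|B y| <= 2) ->
  (forall y, y \in ys -> #|A0| + 11 * d + 3 <= 2 * #|nbrs (B y)|) ->
  pinned F d (active ys B) (qrel e B) 'C(d.+1, 2).
Proof.
move=> wfB sz B2 cov.
have [|B' [wf' pin c n w]] := extend_units (f := fun => 3) 'C(d.+1, 2) wfB sz B2 cov; first by [].
apply: pin; set R := rest ys B'.
(* A pair misses at most [(#|A0| - 11 * d - 3) / 2] vertices, and three absorptions multiply this by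
   [8/27]. *)
pose om := (8 * (#|A0| - 11 * d - 3)) %/ 54.
have bigR : #|A0| <= #|R| + 5 * d.
  apply: leq_trans (rest_card A0 ys B') _; rewrite leq_add2l.
  rewrite big_seq; apply: leq_trans (_ : \sum_(y <- ys | y \in ys) 5 <= _).
    by apply: leq_sum => y yys; apply: c.
  by rewrite -big_seq big_const_seq count_predT iter_addn_0 sz.
have RA : R \subset A0 by apply/subsetP=> z; rewrite inE => /andP[].
have AA := active_sub wf'.
have sub S : nbrs S \subset A0 by apply/subsetP=> z; rewrite inE => /andP[].
have nn x w0 : x \in active ys B' -> w0 \in nonnbrs (active ys B') (qrel e B') x ->
    w0 \in A0 :\: nbrs (B' x).
  move=> xA; rewrite inE => /and3P[wA wx nq]; rewrite inE (subsetP AA) // andbT.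
  apply: contra nq => /nbrsP[_ [z zB ezw]]; apply/qrelP; split; first by rewrite eq_sym.
  by exists z, w0; split=> //; apply: block_mem wf'.
apply: (@pinned_apexes F V R (#|A0| - 1 - D) om d _ d ys (qrel e B') (fun => 0)) => //.
- have := leq_trunc_div (8 * (#|A0| - 11 * d - 3)) 54; rewrite -/om.
  have := degD; move: HD Hn bigR d0; clear; move=> *; lia.
- by case: wf'.
- by move=> y yys; apply/negP=> /(rest_notin wf'); rewrite yys.
- exact: qrel_sym.
- exact: qrel_irr.
- move=> y yys; apply: leq_trans (_ : #|A0 :\: nbrs (B' y)| <= _).
    by apply: subset_leq_card; apply/subsetP=> z; apply: nn; rewrite !inE yys orbT.
  rewrite /om leq_divRL //; have := w y yys; have := cov y yys.
  rewrite (cardsD A0 (nbrs (B y))) (setIidPr (sub _)) /=; lia.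
- move=> x xR; rewrite addn0.
  have xA0 := subsetP RA x xR; have := degD xA0.
  have xys := rest_notin wf' xR.
  have Bx : B' x = [set x] by case: wf' => _ _ _ _; apply.
  have : nonnbrs (active ys B') (qrel e B') x \subset (A0 :\: nbrs [set x]) :\ x.
    apply/subsetP=> z zn; rewrite in_setD1; apply/andP; split.
      by move: zn; rewrite inE => /and3P[].
    by rewrite -Bx; apply: nn zn; rewrite inE xR.
  move/subset_leq_card; have := cardsID (nbrs [set x]) A0; rewrite (setIidPr (sub _)).
  have := cardsD1 x (A0 :\: nbrs [set x]).
  have -> : x \in A0 :\: nbrs [set x] by rewrite nbrs1 !inE xA0 irr.
  by rewrite /=; clear => e1 e2 le1 le2; apply: leq_trans le1 _; lia.
- by rewrite sum_nat_const muln0.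
Qed.

End Rounds.

Lemma sum_andb (V : finType) (S T : {set V}) (P Q : pred V) :
  \sum_(a in S) \sum_(b in T) (P a && Q b) = #|[set a in S | P a]| * #|[set b in T | Q b]|.
Proof.
by rewrite !card_sum_pred big_distrlr /=; do 2!apply: eq_bigr => ? _; rewrite mulnb.
Qed.

(* On each side of a bipartition, [p], [q], [a] (resp. [r], [s], [b]) count the vertices adjacent
   to only the first, only the second, and both members of a fixed pair. *)
Lemma cross_gain d p q a r s b :
  a + b <= 2 * d - 2 -> d + 2 <= p + q -> d + 2 <= r + s ->
  8 * d + 2 <= p + r -> 8 * d + 2 <= q + s ->
  (p + a) * (r + b) + (q + a) * (s + b) < (p + q + a) * (r + s + b).
Proof.
move=> ab pq rs pr qs.
have ab2 : a * b <= d * d.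
  have [ad|da] := leqP a d; first have [bd|db] := leqP b d; first exact: leq_mul.
  - by nia.
  - by nia.
(* The right side exceeds the left by exactly [p * s + q * r - a * b]. *)
suff : d * d < p * s + q * r by nia.
have [p4|p4] := leqP (4 * d + 1) p; have [s4|s4] := leqP (4 * d + 1) s.
- by nia.
- have q4 : 4 * d + 1 <= q by lia.
  by nia.
- have r4 : 4 * d + 1 <= r by lia.
  by nia.
- have r4 : 4 * d + 1 <= r by lia.
  have q4 : 4 * d + 1 <= q by lia.
  by nia.
Qed.

(** * Adding a merged pair next to the existing ones *)

Section Pairs.
Variables (F : realFieldType) (V : finType) (e : rel V).
Hypotheses (se : symmetric e) (irr : irreflexive e).
Variable A0 : {set V}.
Implicit Types (A S T R W : {set V}) (B : V -> {set V}) (ys : seq V).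
Local Notation nbrs := (nbrs e A0).
Local Notation rest := (rest A0).
Local Notation active := (active A0).
Local Notation wf := (wf A0).
Variable d : nat.

Definition cnbrs a b : {set V} := nbrs [set a] :&: nbrs [set b].

Lemma rest_cardI S ys B : S \subset A0 ->
  #|S| <= #|S :&: rest ys B| + \sum_(y <- ys) #|B y :&: S|.
Proof.
move=> SA.
have sub : S \subset (S :&: rest ys B) :|: \bigcup_(y <- ys) (B y :&: S).
  apply/subsetP=> z zS; rewrite in_setU in_setI zS inE (subsetP SA) //=.
  case: hasP => //= -[y yys zy].
  by rewrite (big_rem y yys) /= in_setU in_setI zy zS.
apply: leq_trans (subset_leq_card sub) _; apply: leq_trans (leq_card_setU _ _).1 _.
rewrite leq_add2l; elim: ys {sub} => [|y ys IH]; first by rewrite !big_nil cards0.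
rewrite !big_cons; apply: leq_trans (leq_card_setU _ _).1 _; by rewrite leq_add2l.
Qed.

Definition touch B y a b : bool := (a \in nbrs (B y)) && (b \in nbrs (B y)).

(** Inside a block the common neighbours of [a] and [b] are lost individually, but the block itself
    counts once as soon as both are adjacent to it, possibly through different members. *)
Lemma common_pair ys B a b : wf ys B -> a \in rest ys B -> b \in rest ys B ->
  #|cnbrs a b| + \sum_(y <- ys) touch B y a b <=
    #|common e (active ys B) B a b| + \sum_(y <- ys) #|B y :&: cnbrs a b|.
Proof.
move=> wfB aR bR; have [uys yB BA dis Bz] := wfB.
have aN := rest_notin wfB aR; have bN := rest_notin wfB bR.
have Ba := Bz a aN; have Bb := Bz b bN.
have nA S : nbrs S \subset A0 by apply/subsetP=> z; rewrite inE => /andP[].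
have CA : cnbrs a b \subset A0 by rewrite subIset ?nA.
apply: leq_trans (leq_add (rest_cardI ys B CA) (leqnn _)) _.
rewrite addnAC leq_add2r.
have -> : \sum_(y <- ys) touch B y a b = #|[set y in ys | touch B y a b]|.
  rewrite big_uniq //= -(eq_bigl _ _ (in_set (mem ys))) -card_sum_pred.
  by congr #|pred_of_set _|; apply/setP=> y; rewrite !inE.
have I0 : #|(cnbrs a b :&: rest ys B) :&: [set y in ys | touch B y a b]| = 0.
  apply/eqP; rewrite cards_eq0; apply/eqP/setP=> c; rewrite !in_setI in_set0; apply/negbTE.
  apply/negP=> /andP[/andP[_ cR]]; rewrite inE => /andP[cys _].
  by have := rest_notin wfB cR; rewrite cys.
have := cardsUI (cnbrs a b :&: rest ys B) [set y in ys | touch B y a b].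
rewrite I0 addn0 => <-.
apply: subset_leq_card; apply/subsetP=> c.
  rewrite in_setU => /orP[|].
    rewrite /cnbrs !in_setI => /andP[/andP[/nbrsP[cA [a']]]].
    rewrite inE => /eqP -> eac /nbrsP[_ [b']]; rewrite inE => /eqP -> ebc cR.
    have cN := rest_notin wfB cR; have Bc := Bz c cN.
    have ca : c != a by apply: contraTneq eac => ->; rewrite irr.
    have cb : c != b by apply: contraTneq ebc => ->; rewrite irr.
    rewrite inE in_setU cR ca cb /=; apply/andP; split; apply/qrelP; split; rewrite 1?eq_sym //.
      by exists a, c; rewrite Ba Bc !set11.
    by exists b, c; rewrite Bb Bc !set11.
  rewrite inE => /andP[cys] /andP[/nbrsP[_ [z zB eza]] /nbrsP[_ [w wB ewb]]].
  have ca : c != a by apply: contraTneq cys => ->.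
  have cb : c != b by apply: contraTneq cys => ->.
  rewrite inE in_setU [c \in [set y in _]]inE cys orbT ca cb /=; apply/andP; split; apply/qrelP; split; rewrite 1?eq_sym //.
    by exists a, z; rewrite Ba set11 se.
  by exists b, w; rewrite Bb set11 se.
Qed.

Lemma add_pair ys B a b k : wf ys B -> a \in rest ys B -> b \in rest ys B -> a != b ->
  d + \sum_(y <- ys) #|B y :&: cnbrs a b| <= #|cnbrs a b| + \sum_(y <- ys) touch B y a b + e a b ->
  wf (a :: ys) (upd B a [set a; b]) /\
  (pinned F d (active (a :: ys) (upd B a [set a; b])) (qrel e (upd B a [set a; b])) k ->
   pinned F d (active ys B) (qrel e B) k).
Proof.
move=> wfB aR bR ab cnt; have [uys yB BA dis Bz] := wfB.
have aN := rest_notin wfB aR; have bN := rest_notin wfB bR.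
have Ba := Bz a aN; have Bb := Bz b bN.
have out z y : z \in rest ys B -> y \in ys -> z \notin B y.
  by rewrite inE => /andP[_ /hasPn h] /h.
have inA z : z \in rest ys B -> z \in A0 by rewrite inE => /andP[].
set B' := upd _ _ _.
have B'a : B' a = [set a; b] by rewrite /B' /upd eqxx.
have B'n z : z != a -> B' z = B z by rewrite /B' /upd => /negPf ->.
have na z : z \in ys -> z != a by move=> zys; apply: contraNneq aN => <-.
have dis' z : z \in ys -> [disjoint B' a & B' z].
  move=> zys; rewrite B'a (B'n _ (na _ zys)) -setI_eq0 setIUl setU_eq0 !setI_eq0 !disjoints1.
  by rewrite !out.
have actE : active (a :: ys) B' = active ys B :\ b.
  apply/setP=> z; rewrite !in_setU in_setD1 in_setU ![z \in [set _ in _]]inE !in_cons.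
  have -> : (z \in rest (a :: ys) B') = [&& z \in rest ys B, z != a & z != b].
    rewrite !inE /= B'a !inE !negb_or -!andbA; case: (z \in A0) => //=.
    rewrite [RHS]andbC -andbA; do 2!congr (_ && _); congr (~~ _); apply: eq_in_has => y yys.
    by rewrite B'n // na.
  case: (eqVneq z a) => [->|za] /=; first by rewrite ab aR andbF.
  case: (eqVneq z b) => [->|zb] /=; first by rewrite andbF (negPf bN).
  by rewrite andbT.
split.
  split; rewrite /=.
  - by rewrite aN.
  - move=> y; rewrite in_cons => /orP[/eqP ->|yys]; first by rewrite B'a !inE eqxx.
    by rewrite B'n ?na ?yB.
  - move=> y; rewrite in_cons => /orP[/eqP ->|yys].
      by rewrite B'a subUset !sub1set !inA.
    by rewrite B'n ?na ?BA.
  - move=> y y'; rewrite !in_cons => /orP[/eqP ->|yys] /orP[/eqP ->|y'ys] yy'.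
    + by rewrite eqxx in yy'.
    + exact: dis'.
    + by rewrite disjoint_sym dis'.
    + by rewrite !B'n ?na //; apply: dis.
  - move=> z; rewrite in_cons negb_or => /andP[za zys]; by rewrite B'n ?Bz.
have B'E : B' = upd B a (B a :|: B b) by rewrite Ba Bb.
rewrite actE B'E; apply: pinned_block_merge => //.
- by rewrite in_setU aR.
- by rewrite in_setU bR.
- have := common_pair wfB aR bR.
  have -> : qrel e B a b = e a b.
    apply/qrelP/idP; first by move=> [_ [z [w []]]]; rewrite Ba Bb !inE => /eqP -> /eqP ->.
    by move=> eab; split=> //; exists a, b; rewrite Ba Bb !set11.
  by move: cnt; clear; lia.
Qed.

Lemma pinned_start k :
  pinned F d (active [::] set1) (qrel e set1) k -> pinned F d A0 e k.
Proof.
have -> : active [::] set1 = A0 by apply/setP=> z; rewrite !inE in_nil /= orbF andbT.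
apply: pinned_sub => x y _ _ _ /qrelP[_ [z [w []]]].
by rewrite !inE => /eqP -> /eqP ->.
Qed.

Lemma wf_start : wf [::] set1.
Proof. by split. Qed.

Lemma rest_start : rest [::] set1 = A0.
Proof. by apply/setP=> z; rewrite !inE andbT. Qed.

End Pairs.

Lemma card_set1I (V : finType) (y : V) (S : {set V}) : #|[set y] :&: S| = (y \in S).
Proof.
case: (boolP (y \in S)) => yS; first by rewrite (setIidPl _) ?sub1set // cards1.
by apply/eqP; rewrite cards_eq0 setI_eq0 disjoints1.
Qed.

(** * Pairs running between two sides *)

Section Cross.
Variables (F : realFieldType) (V : finType) (e : rel V).
Hypotheses (se : symmetric e) (irr : irreflexive e).
Variable A0 : {set V}.
Implicit Types (A S T R W : {set V}) (B : V -> {set V}) (ys : seq V).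
Local Notation nbrs := (nbrs e A0).
Local Notation cnbrs := (cnbrs e A0).
Local Notation rest := (rest A0).
Local Notation active := (active A0).
Local Notation wf := (wf A0).
Variables (d D : nat).
Hypotheses (degD : forall z, z \in A0 -> D <= #|nbrs [set z]|) (d0 : 0 < d).
Hypotheses (HD : #|A0| + d <= 2 * D + 3) (Hn : 29 * d <= #|A0| + 1).

Lemma nbrs_sub S : nbrs S \subset A0.
Proof. by apply/subsetP=> z; rewrite inE => /andP[]. Qed.

Lemma card_nbrs2 a b :
  #|nbrs [set a; b]| + #|cnbrs a b| = #|nbrs [set a]| + #|nbrs [set b]|.
Proof. by rewrite nbrsU /cnbrs cardsUI. Qed.

Variables al be : {set V}.
Hypotheses (alA : al \subset A0) (beA : be \subset A0) (dis : [disjoint al & be]).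
Hypotheses (al5 : 5 * d <= #|al|) (be5 : 5 * d <= #|be|) (albe : #|A0| <= #|al| + #|be| + 3 * d).
Hypothesis cod : forall a b, a \in al -> b \in be -> #|cnbrs a b| <= 2 * d - 2.
Hypothesis low : forall a b, a \in al -> b \in be -> d <= #|cnbrs a b| + e a b + 1.
Variables a1 b1 : V.
Hypotheses (a1al : a1 \in al) (b1be : b1 \in be) (first : d <= #|cnbrs a1 b1| + e a1 b1).

(** [cross_gain] applies with no room to spare in its hypotheses. Sides of size [5 * d] give
    [d + 2]. From [29 * d <= #|A0| + 1] one gets [D >= 15 * d - 2]; subtracting [2 * d - 2] common
    neighbours and [5 * d - 2] vertices outside [A] and [B] leaves [8 * d + 2]. *)
Lemma gain_pair y w R (A := al :&: R) (B := be :&: R) :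
  y \in al -> w \in be -> #|al| <= #|A| + (d - 1) -> #|be| <= #|B| + (d - 1) ->
  #|A :&: nbrs [set y]| * #|B :&: nbrs [set y]| + #|A :&: nbrs [set w]| * #|B :&: nbrs [set w]| <
  #|A :&: nbrs [set y; w]| * #|B :&: nbrs [set y; w]|.
Proof.
move=> yal wbe cA cB.
have AA : A \subset A0 by rewrite subIset ?alA.
have BA : B \subset A0 by rewrite subIset ?beA.
have AB0 : A :&: B = set0.
  apply/eqP; rewrite setI_eq0; apply: disjointWl (subsetIl _ _) _.
  exact: disjointWr (subsetIl _ _) dis.
have split S : S \subset A0 -> #|S| <= #|A :&: S| + #|B :&: S| + (#|A0| - #|A| - #|B|).
  move=> SA.
  have e1 : #|S :\: (A :|: B)| <= #|A0 :\: (A :|: B)| by apply: subset_leq_card; apply: setSD.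
  have e2 := cardsID (A :|: B) S; have e3 := cardsID (A :|: B) A0.
  have e5 : A0 :&: (A :|: B) = A :|: B by apply/setIidPr; rewrite subUset AA.
  have e4 := cardsUI A B; rewrite AB0 cards0 addn0 in e4.
  have e6 : #|S :&: (A :|: B)| <= #|A :&: S| + #|B :&: S|.
    by rewrite setIUr ![S :&: _]setIC; apply: (leq_card_setU _ _).1.
  by rewrite e5 in e3; move: e1 e2 e3 e4 e6; clear; lia.
have inc (X : {set V}) : #|X :&: nbrs [set y; w]| + #|X :&: cnbrs y w| =
    #|X :&: nbrs [set y]| + #|X :&: nbrs [set w]|.
  by rewrite nbrsU setIUr /cnbrs -[RHS]cardsUI setIIr.
have mono (X Y Z : {set V}) : Y \subset Z -> #|X :&: Y| <= #|X :&: Z|.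
  by move=> YZ; apply: subset_leq_card; apply: setIS.
have uA : nbrs [set y] \subset nbrs [set y; w] by rewrite nbrsU subsetUl.
have uB : nbrs [set w] \subset nbrs [set y; w] by rewrite nbrsU subsetUr.
have cw := cod yal wbe.
have CAB : #|A :&: cnbrs y w| + #|B :&: cnbrs y w| <= #|cnbrs y w|.
  have := cardsUI (A :&: cnbrs y w) (B :&: cnbrs y w).
  have -> : A :&: cnbrs y w :&: (B :&: cnbrs y w) = set0.
    by apply/eqP; rewrite -subset0 -AB0; apply/subsetP=> z; rewrite !in_setI => /andP[/andP[-> _] /andP[->]].
  rewrite cards0 addn0 => <-; apply: subset_leq_card; by rewrite subUset !subsetIr.
have miss (X : {set V}) : X \subset A0 -> #|X| <= #|X :&: nbrs [set y; w]| + (d + 1).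
  move=> XA; have := cardsID (nbrs [set y; w]) X.
  have e1 : #|X :\: nbrs [set y; w]| <= #|A0 :\: nbrs [set y; w]| by apply: subset_leq_card; apply: setSD.
  have := cardsID (nbrs [set y; w]) A0; rewrite (setIidPr (nbrs_sub _)).
  have := card_nbrs2 y w; have := degD (subsetP alA y yal); have := degD (subsetP beA w wbe).
  by move: e1 cw HD d0; clear; lia.
have sy := split _ (nbrs_sub [set y]); have sw := split _ (nbrs_sub [set w]).
have mA := miss _ AA; have mB := miss _ BA.
have iA := inc A; have iB := inc B.
have dy := degD (subsetP alA y yal); have dw := degD (subsetP beA w wbe).
have m1 := mono A _ _ uA; have m2 := mono A _ _ uB; have m3 := mono B _ _ uA; have m4 := mono B _ _ uB.
have lA : #|A| + #|B| <= #|A0|.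
  by rewrite -cardsUI AB0 cards0 addn0; apply: subset_leq_card; rewrite subUset AA.
move: sy sw mA mB iA iB dy dw m1 m2 m3 m4 CAB cw HD Hn al5 be5 albe cA cB lA d0; clear.
set X := #|A :&: nbrs [set y]|; set Y := #|A :&: nbrs [set w]|; set Z := #|A :&: nbrs [set y; w]|.
set x := #|B :&: nbrs [set y]|; set y' := #|B :&: nbrs [set w]|; set z := #|B :&: nbrs [set y; w]|.
set a := #|A :&: cnbrs y w|; set b := #|B :&: cnbrs y w|.
clearbody X Y Z x y' z a b => sy sw mA mB iA iB dy dw m1 m2 m3 m4 CAB cw HD Hn al5 be5 albe cA cB lA d0.
have := @cross_gain d (Z - Y) (Z - X) a (z - y') (z - x) b.
have -> : Z - Y + a = X by lia.
have -> : Z - X + a = Y by lia.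
have -> : z - y' + b = x by lia.
have -> : z - x + b = y' by lia.
have -> : Z - Y + (Z - X) + a = Z by lia.
have -> : z - y' + (z - x) + b = z by lia.
apply; lia.
Qed.

Definition crossed ys B : Prop :=
  wf ys B /\ forall y, y \in ys -> y \in al /\ exists2 w, w \in be & B y = [set y; w].

Lemma crossed_rest ys B S : crossed ys B -> S \subset al \/ S \subset be ->
  #|S| <= #|S :&: rest ys B| + size ys.
Proof.
move=> [_ cr] SS.
have SA : S \subset A0 by case: SS => h; apply: subset_trans h _.
apply: leq_trans (rest_cardI ys B SA) _; rewrite leq_add2l -sum1_size big_seq [X in _ <= X]big_seq.
apply: leq_sum => y yys; have [yal [w wbe ->]] := cr y yys.
have nda z : z \in al -> z \in be -> False by move=> za zb; move: (disjointFr dis za); rewrite zb.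
apply: leq_trans (_ : #|[set (if S \subset al then y else w)]| <= _); last by rewrite cards1.
apply: subset_leq_card; apply/subsetP=> z; rewrite !inE => /andP[+ zS].
case: ifP => [sal|nal] /orP[] // /eqP E; exfalso.
  by apply: (nda w) => //; rewrite -E (subsetP sal).
case: SS => [sal|sbe]; first by rewrite sal in nal.
by apply: (nda y) => //; rewrite -E (subsetP sbe).
Qed.

(** By [low], a cross pair may be one short of what [add_pair] requires. On average over the free
    cross pairs, each block is touched more often than it contains common neighbours, so some pair
    gains the missing unit. Without blocks there is nothing to gain, whence the assumption [first]
    on the initial pair. *)
Lemma next_pair ys B : crossed ys B -> 0 < size ys < d ->
  exists a b, [/\ a \in al :&: rest ys B, b \in be :&: rest ys B &
    \sum_(y <- ys) #|B y :&: cnbrs a b| < \sum_(y <- ys) touch e A0 B y a b].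
Proof.
move=> crB /andP[ys0 ysd]; have [wfB cr] := crB.
set A := al :&: rest ys B; set T := be :&: rest ys B.
have cA : #|al| <= #|A| + (d - 1).
  by have := crossed_rest crB (or_introl (subxx al)); move: ysd; rewrite -/A; lia.
have cT : #|be| <= #|T| + (d - 1).
  by have := crossed_rest crB (or_intror (subxx be)); move: ysd; rewrite -/T; lia.
have key y : y \in ys -> \sum_(a in A) \sum_(b in T) #|B y :&: cnbrs a b| <
    \sum_(a in A) \sum_(b in T) touch e A0 B y a b.
  move=> yys; have [yal [w wbe By]] := cr y yys.
  have yA0 := subsetP alA y yal; have wA0 := subsetP beA w wbe.
  have yw : y != w by apply: contraTneq wbe => <-; rewrite (disjointFr dis yal).
  have E a b : a \in A -> b \in T -> #|B y :&: cnbrs a b| =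
      ((a \in nbrs [set y]) && (b \in nbrs [set y])) + ((a \in nbrs [set w]) && (b \in nbrs [set w])).
    move=> /setIP[aal _] /setIP[bbe _].
    have aA := subsetP alA a aal; have bA := subsetP beA b bbe.
    rewrite By setIUl cardsU; have -> : [set y] :&: cnbrs a b :&: ([set w] :&: cnbrs a b) = set0.
      apply/setP=> z; rewrite !in_setI in_set0 !in_set1; case: (eqVneq z y) => //= ->.
      by rewrite (negPf yw) /= andbF.
    rewrite cards0 subn0 !card_set1I /cnbrs !in_setI.
    have sw z z' : z \in A0 -> z' \in A0 -> (z \in nbrs [set z']) = (z' \in nbrs [set z]).
      by move=> zA zA'; rewrite !nbrs1 !inE zA zA' se.
    by rewrite !(sw y) // !(sw w).

  under eq_bigr => a aA do (under eq_bigr => b bT do rewrite (E a b aA bT)).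
  under eq_bigr => a aA do rewrite big_split.
  rewrite big_split /= !sum_andb.
  have eqI (X S : {set V}) : [set a in X | a \in S] = X :&: S by apply/setP=> z; rewrite !inE.
  rewrite By !eqI; exact: gain_pair.
have [/exists_inP[a aA /exists_inP[b bT lt]]|nex] := boolP [exists a in A, [exists b in T,
  \sum_(y <- ys) #|B y :&: cnbrs a b| < \sum_(y <- ys) touch e A0 B y a b]]; first by exists a, b.
exfalso; have le a b : a \in A -> b \in T ->
    \sum_(y <- ys) touch e A0 B y a b <= \sum_(y <- ys) #|B y :&: cnbrs a b|.
  move=> aA bT; rewrite leqNgt; apply: contra nex => lt.
  by apply/exists_inP; exists a => //; apply/exists_inP; exists b.
have : \sum_(y <- ys) \sum_(a in A) \sum_(b in T) #|B y :&: cnbrs a b| <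
    \sum_(y <- ys) \sum_(a in A) \sum_(b in T) touch e A0 B y a b.
  case: (ys) ys0 key => // y0 ys' _ key; rewrite !big_cons -addSn leq_add ?key ?mem_head //.
  by rewrite big_seq [X in _ <= X]big_seq; apply: leq_sum => y yys; rewrite ltnW ?key // in_cons yys orbT.
rewrite ltnNge => /negP; apply.
rewrite exchange_big [X in _ <= X]exchange_big /=; apply: leq_sum => a aA.
by rewrite exchange_big [X in _ <= X]exchange_big /=; apply: leq_sum => b bT; apply: le.
Qed.

(** Few common neighbours mean a large joint neighbourhood, so cross pairs are units at once. *)
Lemma crossed_pinned k ys B : crossed ys B -> size ys = d ->
  k = 'C(d.+1, 2) -> pinned F d (active ys B) (qrel e B) k.
Proof.
move=> [wfB cr] sz ->; apply: (pinned_of_units F se irr degD) => // y /cr[yal [w wbe ->]].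
  by rewrite cards2; case: (_ != _).
have := card_nbrs2 y w; have := cod yal wbe.
have := degD (subsetP alA y yal); have := degD (subsetP beA w wbe).
by move: HD Hn d0; clear; lia.
Qed.

Lemma pinned_cross : pinned F d A0 e 'C(d.+1, 2).
Proof.
set k := 'C(_, _).
have nda z w : z \in al -> w \in be -> z != w.
  by move=> za wb; apply: contraTneq wb => <-; rewrite (disjointFr dis za).
have key m : m < d -> exists ys B, [/\ crossed ys B, size ys = m.+1 &
    pinned F d (active ys B) (qrel e B) k -> pinned F d A0 e k].
  elim: m => [_|m IH md].
    have r1 : a1 \in rest [::] set1 by rewrite rest_start (subsetP alA).
    have r2 : b1 \in rest [::] set1 by rewrite rest_start (subsetP beA).
    have [|wf1 pin1] := @add_pair F V e se irr A0 d [::] set1 a1 b1 k (wf_start _) r1 r2 (nda _ _ a1al b1be).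
      by rewrite !big_nil !addn0.
    exists [:: a1], (upd set1 a1 [set a1; b1]); split=> //; last by move/pin1/pinned_start.
    split=> // y; rewrite mem_seq1 => /eqP ->; split=> //; exists b1 => //.
    by rewrite /upd eqxx.
  have [ys [B [crB sz pin]]] := IH (ltnW md).
  have [|a [b [/setIP[aal aR] /setIP[bbe bR] lt]]] := next_pair crB; first by rewrite sz.
  have [wfB cr] := crB.
  have [|wf1 pin1] := @add_pair F V e se irr A0 d ys B a b k wfB aR bR (nda _ _ aal bbe).
    by move: lt (low aal bbe); clear; lia.
  exists (a :: ys), (upd B a [set a; b]); split; [|by rewrite /= sz|by move/pin1].
  split=> // y; rewrite in_cons; case: (eqVneq y a) => [-> _|ya /= /cr[yal [w wbe By]]].
    by split=> //; exists b; rewrite // /upd eqxx.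
  by split=> //; exists w; rewrite // /upd (negPf ya).
have [|ys [B [crB sz pin]]] := key d.-1; first by rewrite prednK.
by apply/pin/crossed_pinned; rewrite // sz prednK.
Qed.

End Cross.

(** * Graphs of large minimum degree *)

Section MinDegree.
Variables (F : realFieldType) (V : finType) (e : rel V).
Hypotheses (se : symmetric e) (irr : irreflexive e).
Implicit Types (A S T R W : {set V}) (B : V -> {set V}) (ys : seq V).
Local Notation n := #|V|.
Local Notation N v := (nbrs e [set: V] [set v]).
Local Notation C := (cnbrs e [set: V]).
Local Notation U u v := (nbrs e [set: V] [set u; v]).
Variables (d D : nat).
Hypotheses (degD : forall z, D <= #|N z|) (HD : n + d <= 2 * D + 2) (Hn : 29 * d <= n).

Lemma mem_N v w : (w \in N v) = e v w.
Proof. by rewrite nbrs1 !inE. Qed.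

Lemma mem_C a b c : (c \in C a b) = e a c && e b c.
Proof. by rewrite /cnbrs in_setI !mem_N. Qed.

Lemma card_U a b : #|U a b| + #|C a b| = #|N a| + #|N b|.
Proof. exact: card_nbrs2. Qed.

Lemma U_setU a b : U a b = N a :|: N b.
Proof. exact: nbrsU. Qed.

(** Inclusion-exclusion; if [a] and [b] are not adjacent, the union of their neighbourhoods misses
    both of them, which gains 2. *)
Lemma codeg_low a b : a != b -> d <= #|C a b| + 2 * e a b.
Proof.
move=> ab; have := card_U a b; have := degD a; have := degD b.
have [eab|nab] := boolP (e a b).
  by have := cardsC (U a b); move: HD; clear; lia.
have : U a b \subset ~: [set a; b].
  apply/subsetP=> c; rewrite U_setU in_setU !mem_N !inE negb_or => h; apply/andP; split.
    by apply: contraTneq h => ->; rewrite irr se (negPf nab).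
  by apply: contraTneq h => ->; rewrite irr (negPf nab).
move/subset_leq_card; have := cardsC [set a; b]; rewrite cards2 ab.
by move: HD; clear; lia.
Qed.

(** One cone suffices, over any vertex [v]: each non-neighbour of [v] has a common neighbour with
    it, so with the neighbours of [v] listed first every parent precedes its children. *)
Lemma pinned_mindeg1 : d = 1 -> pinned F d [set: V] e 'C(d.+1, 2).
Proof.
move=> d1; have [v _] : exists v, v \in [set: V].
  by apply/card_gt0P; rewrite cardsT; move: Hn; rewrite d1; lia.
have mem_s b : b \in enum (N v) ++ enum (~: N v :\ v) -> b \in [set: V] :\ v.
  rewrite mem_cat !mem_enum !in_setD1 in_setT andbT; case: (eqVneq b v) => [->|//].
  by rewrite mem_N irr.
rewrite d1; apply: (pinned_cone (k := 0) (v := v) (s := enum (N v) ++ enum (~: N v :\ v)) se) => //.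
- move=> b; rewrite in_setD1 => /andP[bv _] nvb.
  have vb : v != b by rewrite eq_sym.
  have : 0 < #|C v b| by have := codeg_low vb; rewrite (negPf nvb) d1; lia.
  move=> /card_gt0P[c]; rewrite mem_C => /andP[vc bc].
  have hc : has (e b) (enum (N v)) by apply/hasP; exists c; rewrite // mem_enum mem_N.
  rewrite find_cat hc index_cat mem_enum mem_N (negPf nvb).
  by apply: leq_trans (leq_addr _ _); rewrite -has_find.
- exact: pinned0.
Qed.

Hypothesis d2 : 1 < d.

(* Pairs with many common neighbours and many neighbours: merging them is always allowed, and
   they dominate enough vertices to serve as units. *)
Definition medium a b := [&& a != b, 2 * d <= #|C a b| + 1 & n + 11 * d + 3 <= 2 * #|U a b|].

Definition built ys B : Prop :=
  [/\ wf [set: V] ys B, (forall y, y \in ys -> #|B y| <= 2),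
   (forall y, y \in ys -> n + 11 * d + 3 <= 2 * #|nbrs e [set: V] (B y)|) &
   (pinned F d (active [set: V] ys B) (qrel e B) 'C(d.+1, 2) -> pinned F d [set: V] e 'C(d.+1, 2))].

Lemma built_extend ys B : built ys B -> size ys < d ->
  (exists ys' B', built ys' B' /\ size ys' = (size ys).+1) \/
  (exists V0 : {set V}, n <= #|V0| + 2 * (d - 1) /\ forall a b, a \in V0 -> b \in V0 -> ~~ medium a b).
Proof.
move=> [wfB B2 cov pin] sz.
have [/exists_inP[a aR /exists_inP[b bR]]|nex] :=
  boolP [exists a in rest [set: V] ys B, [exists b in rest [set: V] ys B, medium a b]]; last first.
  right; exists (rest [set: V] ys B); split=> [|a b aR bR].
    have := rest_card [set: V] ys B; rewrite cardsT.
    have : \sum_(y <- ys) #|B y| <= \sum_(y <- ys) 2.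
      by rewrite big_seq [X in _ <= X]big_seq; apply: leq_sum => y /B2.
    by rewrite big_const_seq count_predT iter_addn_0; move: sz; clear; lia.
  by apply: contra nex => mab; apply/exists_inP; exists a => //; apply/exists_inP; exists b.
move=> /and3P[ab cab uab]; left.
have [|wf' pin'] := @add_pair F V e se irr _ d ys B a b 'C(d.+1, 2) wfB aR bR ab.
  (* A block of two vertices meeting [C a b] is touched by both [a] and [b], so its net cost is at
     most one; fewer than [d] blocks leave [d] of the [2 * d - 1] common neighbours. *)
  have : \sum_(y <- ys) #|B y :&: C a b| <= \sum_(y <- ys) (1 + touch e [set: V] B y a b).
    rewrite big_seq [X in _ <= X]big_seq; apply: leq_sum => y yys.
    case: (set_0Vmem (B y :&: C a b)) => [->|[c]]; first by rewrite cards0.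
    rewrite in_setI mem_C => /andP[cB /andP[ac bc]].
    have -> : touch e [set: V] B y a b.
      by apply/andP; split; apply/nbrsP; (split; [rewrite inE|exists c; rewrite // se]).
    by exact: leq_trans (subset_leq_card (subsetIl _ _)) (B2 y yys).
  rewrite big_split /= sum1_size; move: cab sz; clear; lia.
exists (a :: ys), (upd B a [set a; b]); split=> //; split=> //.
- move=> y; rewrite in_cons /upd; case: eqP => [_ _|_ /= /B2 //]; by rewrite cards2; case: (_ != _).
- by move=> y; rewrite in_cons /upd; case: eqP => [_ _|_ /= /cov].
- by move/pin'.
Qed.

Lemma built_or : (exists ys B, built ys B /\ size ys = d) \/
  (exists V0 : {set V}, n <= #|V0| + 2 * (d - 1) /\ forall a b, a \in V0 -> b \in V0 -> ~~ medium a b).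
Proof.
have key m : m <= d -> (exists ys B, built ys B /\ size ys = m) \/
  (exists V0 : {set V}, n <= #|V0| + 2 * (d - 1) /\ forall a b, a \in V0 -> b \in V0 -> ~~ medium a b).
  elim: m => [_|m IH md].
    left; exists [::], set1; split=> //.
    by split=> //; exact: pinned_start.
  case: (IH (ltnW md)) => [[ys [B [bu sz]]]|]; last by right.
  have [|[ys' [B' [bu' sz']]]|] := built_extend bu; first by rewrite sz.
    by left; exists ys', B'; rewrite sz' sz.
  by right.
exact: key.
Qed.

Lemma built_pinned ys B : built ys B -> size ys = d -> pinned F d [set: V] e 'C(d.+1, 2).
Proof.
move=> [wfB B2 cov pin] sz; apply: pin.
apply: (@pinned_of_units F V e se irr [set: V] d D) => //; rewrite ?cardsT //.
- by move: d2; lia.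
- by move: HD; lia.
- by move: Hn; lia.
Qed.

(** The numerical contradiction behind [exists_opp]. It is false for [c = 1] and [m = 29]. *)
Lemma poly_ineq (m c : nat) : 1 < c -> 29 * c <= m ->
  m * (m + 2 - c) ^ 2 < 2 * ((m + 2 - 2 * c) * (m + 1 - 2 * c) * (m - 11 * c - 2)).
Proof.
move=> c2 mc; have [t Ec] : exists t, c = t + 2 by exists (c - 2); lia.
subst c.
have [r ->] : exists r, m = 29 * (t + 2) + r by exists (m - 29 * (t + 2)); lia.
clear; have [m' Em] : exists m', m' = 29 * (t + 2) + r by exists (29 * (t + 2) + r).
rewrite -Em.
have -> : m' + 2 - (t + 2) = 28 * t + 58 + r by lia.
have -> : m' + 2 - 2 * (t + 2) = 27 * t + 56 + r by lia.
have -> : m' + 1 - 2 * (t + 2) = 27 * t + 55 + r by lia.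
have -> : m' - 11 * (t + 2) - 2 = 18 * t + 34 + r by lia.
have -> : m' = 29 * t + 58 + r by lia.
nia.
Qed.

Lemma sum_uncovered (V0 : {set V}) : \sum_(u in V0) \sum_(v in V0) #|~: U u v| =
  \sum_x #|V0 :\: N x| ^ 2.
Proof.
have E u v : #|~: U u v| = \sum_x ((x \notin N u) && (x \notin N v)).
  rewrite -sum1_card big_mkcond; apply: eq_bigr => x _.
  by rewrite inE U_setU in_setU negb_or; case: (_ && _).
under eq_bigr => u _ do (under eq_bigr => v _ do rewrite E).
under eq_bigr => u _ do rewrite exchange_big.
rewrite exchange_big; apply: eq_bigr => x _ /=.
rewrite sum_andb; rewrite -mulnn; congr (_ * _); congr #|pred_of_set _|;
  by apply/setP=> u; rewrite in_setD inE andbC !mem_N se.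
Qed.

(** The negation of the codegree condition in [medium]: distinct vertices that are neither opposite
    nor medium have a small joint neighbourhood. *)
Definition opp a b := #|C a b| <= 2 * d - 2.

(** Otherwise every two distinct vertices of [V0] leave at least [(n - 11 * d - 2) / 2] vertices
    uncovered. Counted by the uncovered vertex, the total is a sum of squares of numbers of
    non-neighbours, each at most [n - D], which is too small. *)
Lemma exists_opp (V0 : {set V}) : n <= #|V0| + 2 * (d - 1) ->
  (forall a b, a \in V0 -> b \in V0 -> ~~ medium a b) ->
  exists a b, [/\ a \in V0, b \in V0, a != b & opp a b].
Proof.
move=> cV0 nm.
have [/exists_inP[a aV /exists_inP[b bV /andP[ab o]]]|nex] :=
  boolP [exists a in V0, [exists b in V0, (a != b) && opp a b]]; first by exists a, b.
exfalso.
have big a b : a \in V0 -> b \in V0 -> a != b -> n - 11 * d - 2 <= 2 * #|~: U a b|.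
  move=> aV bV ab; have := nm a b aV bV; rewrite /medium ab /= negb_and -!ltnNge.
  have : ~~ opp a b.
    apply: contra nex => o; apply/exists_inP; exists a => //.
    by apply/exists_inP; exists b => //; rewrite ab.
  rewrite /opp -ltnNge => h; have := cardsC (U a b); move: h d2; clear => h h2 h3 /orP[]; first lia; set u := #|U a b| in h3 *; set v := #|~: U a b| in h3 *; set m := #|V| in h3 *; lia.
have H1 : #|V0| * (#|V0| - 1) * (n - 11 * d - 2) <= 2 * \sum_(u in V0) \sum_(v in V0) #|~: U u v|.
  rewrite -mulnA -sum_nat_const big_distrr /=; apply: leq_sum => u uV.
  rewrite big_distrr /= (bigD1 u) //=; apply: leq_trans (leq_addl _ _).
  have -> : #|V0| - 1 = #|V0 :\ u| by rewrite (cardsD1 u V0) uV; lia.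
  rewrite -sum_nat_const; under [X in _ <= X]eq_bigl => v do rewrite andbC -in_setD1.
  by apply: leq_sum => v; rewrite in_setD1 => /andP[vu vV]; apply: big; rewrite // eq_sym.
have H2 : \sum_x #|V0 :\: N x| ^ 2 <= n * (n - D) ^ 2.
  rewrite -sum_nat_const; apply: leq_sum => x _; apply: leq_mul;
  by have := degD x; have := cardsC (N x); have := subset_leq_card (subsetDr V0 (N x)); clear; lia.
rewrite sum_uncovered in H1.
have := poly_ineq d2 Hn.
have H3 : 4 * (n - D) ^ 2 <= (n + 2 - d) ^ 2.
  have : 2 * (n - D) <= n + 2 - d by move: HD; clear; lia.
  by move=> h; have := leq_mul h h; rewrite -!mulnn; nia.
have H4 : (n + 2 - 2 * d) * (n + 1 - 2 * d) * (n - 11 * d - 2) <= #|V0| * (#|V0| - 1) * (n - 11 * d - 2).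
  by rewrite leq_mul2r leq_mul ?orbT //; move: cV0 d2; clear; lia.
have H5 : n * (4 * (n - D) ^ 2) <= n * (n + 2 - d) ^ 2 by rewrite leq_mul2l H3 orbT.
move: H1 H2 H4 H5; set X := #|V0| * _ * _; set Y := (_ * (_ + 1 - _) * _); set Z := \sum_x _.
set W := (n - D) ^ 2; set Q := n * (n + 2 - d) ^ 2; set K := n * W.
have -> : n * (4 * W) = 4 * K by rewrite /K; lia.
by clearbody X Y Z Q K; clear; lia.
Qed.

Lemma C_sym a b : C a b = C b a.
Proof. by rewrite /cnbrs setIC. Qed.

Lemma degree_of_opp a b : opp a b -> 2 * #|N a| <= n + 3 * d - 2.
Proof.
rewrite /opp => o; have := card_U a b; have := degD b; have := cardsC (U a b).
by move: o d2 Hn HD; clear; lia.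
Qed.

(* [N b] is nearly [N b0] because their union is small, so [a] cannot share much of [N b] either. *)
Lemma cross_opp a b b0 : opp a b0 -> ~~ opp b b0 -> ~~ medium b b0 -> ~~ medium a b -> a != b ->
  b != b0 -> opp a b.
Proof.
move=> oab nob nmb nmab ab bb0; apply/negPn/negP => noab.
have h1 : 2 * #|U b b0| < n + 11 * d + 3.
  by move: nmb nob; rewrite /medium /opp bb0 /= negb_and -!ltnNge; move: d2; clear => h /orP[]; lia.
have h2 : 2 * #|U a b| < n + 11 * d + 3.
  by move: nmab noab; rewrite /medium /opp ab /= negb_and -!ltnNge; move: d2; clear => h /orP[]; lia.
have h3 : #|C a b| <= #|C a b0| + #|U b b0 :\: N b0|.
  apply: leq_trans (leq_card_setU _ _).1; apply: subset_leq_card; apply/subsetP=> c.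
  rewrite in_setU in_setD U_setU in_setU !mem_C !mem_N => /andP[-> ->] /=.
  by case: (e b0 c).
have h4 : #|U b b0 :\: N b0| = #|U b b0| - #|N b0|.
  by rewrite cardsD U_setU (setIidPr (subsetUr _ _)).
have := card_U a b; have := degD a; have := degD b; have := degD b0.
by move: oab h1 h2 h3 h4 d2 Hn HD; rewrite /opp; clear; lia.
Qed.

(** The non-neighbours [X] of [b0] make up nearly half the graph or more. If few lie in [S], they
    fill [T]. If many do, then, as each [a] in [S] together with [b0] misses at most [d] vertices,
    some [x] in [X :&: S] is adjacent to four fifths of [S]; its degree is at most about [n / 2],
    which bounds [S] and leaves room for [T]. *)
Lemma big_side S T a0 b0 : a0 \in S -> b0 \in T -> [disjoint S & T] ->
  n <= #|S| + #|T| + 2 * (d - 1) -> (forall a, a \in S -> opp a b0) -> 6 * d <= #|T|.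
Proof.
move=> a0S b0T dis cST o.
have ST0 : S :&: T = set0 by apply/eqP; rewrite setI_eq0.
have oST : #|~: (S :|: T)| <= 2 * (d - 1).
  by have := cardsC (S :|: T); have := cardsUI S T; rewrite ST0 cards0; move: cST; clear; lia.
set X := ~: N b0.
have cX : n <= 2 * #|X| + 3 * d - 2.
  have := degree_of_opp (_ : opp b0 a0); rewrite /opp C_sym => /(_ (o a0 a0S)).
  by have := cardsC (N b0); rewrite -/X; move: d2; clear; lia.
have XST : #|X| <= #|X :&: S| + #|T| + 2 * (d - 1).
  have : #|X| <= #|X :&: S| + #|T| + #|~: (S :|: T)|.
    apply: leq_trans (leq_trans (leq_card_setU (X :&: S :|: T) (~: (S :|: T))).1 _); last first.
      by rewrite leq_add2r (leq_card_setU _ _).1.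
    apply: subset_leq_card; apply/subsetP=> x xX; rewrite !in_setU in_setC in_setU in_setI xX.
    by case: (x \in S); case: (x \in T).
  by move: oST; clear; lia.
have [small|large] := leqP (5 * d) #|X :&: S|; last first.
  by move: cX XST large Hn d2; clear; lia.
have count : \sum_(x in X :&: S) #|S :\: N x| <= #|S| * d.
  have -> : \sum_(x in X :&: S) #|S :\: N x| = \sum_(a in S) #|(X :&: S) :\: N a|.
    have dE (A : {set V}) x : A :\: N x = [set w in A | ~~ e x w].
      by apply/setP=> w; rewrite in_setD inE mem_N andbC.
    under eq_bigr => x _ do rewrite dE.
    rewrite (double_count (e := fun x y => ~~ e x y)) => [|x y]; last by rewrite se.
    by apply: eq_bigr => a _; rewrite dE.
  rewrite -sum_nat_const; apply: leq_sum => a aS.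
  have : #|X :&: S :\: N a| <= #|~: U a b0|.
    apply: subset_leq_card; apply/subsetP=> x; rewrite in_setD in_setI in_setC U_setU in_setU.
    by rewrite in_setC => /and3P[/negPf -> /negPf ->].
  have := cardsC (U a b0); have := card_U a b0; have := degD a; have := degD b0.
  by have := o a aS; rewrite /opp; move: HD d2; clear; lia.
have [x xXS lex] : exists2 x, x \in X :&: S & 5 * #|S :\: N x| <= #|S|.
  apply/exists_inP; apply: contraT => /exists_inPn nex; exfalso.
  have : \sum_(x in X :&: S) #|S|.+1 <= \sum_(x in X :&: S) 5 * #|S :\: N x|.
    by apply: leq_sum => x xXS; have := nex x xXS; rewrite -ltnNge.
  rewrite sum_nat_const -big_distrr /=; move: count small d2; set s := \sum_(x in _) _.
  by clearbody s; clear; nia.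
have xS : x \in S by case/setIP: xXS.
have := degree_of_opp (o x xS); have := subset_leq_card (subsetIr S (N x)).
have := cardsID (N x) S; have := cardsC (S :|: T).
have := cardsUI S T; rewrite ST0 cards0.
by move: lex oST Hn d2; clear; lia.
Qed.

Lemma low_pair a b : a != b -> d <= #|C a b| + e a b + 1.
Proof. by move=> ab; have := codeg_low ab; case: (e a b) => /=; lia. Qed.

(* All the cross pairs are adjacent with few common neighbours: removing a vertex [z] of [be]
   buys an edge inside [al], which creates a cross pair with one more common neighbour. *)
Lemma pinned_extremal (al be : {set V}) : [disjoint al & be] ->
  6 * d <= #|al| -> 6 * d <= #|be| -> n <= #|al| + #|be| + 2 * (d - 1) ->
  (forall a b, a \in al -> b \in be -> #|C a b| + e a b < d) ->
  pinned F d [set: V] e 'C(d.+1, 2).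
Proof.
move=> dis cal cbe cover ext.
have nda z w : z \in al -> w \in be -> z != w.
  by move=> za wb; apply: contraTneq wb => <-; rewrite (disjointFr dis za).
have adj a b : a \in al -> b \in be -> e a b /\ #|C a b| + 1 < d.
  move=> aal bbe; have := codeg_low (nda _ _ aal bbe); have := ext _ _ aal bbe.
  by case: (e a b) => /=; lia.
have [z zbe] : exists z, z \in be by apply/card_gt0P; move: cbe d2; clear; lia.
have [a aal] : exists a, a \in al by apply/card_gt0P; move: cal d2; clear; lia.
(* All cross edges are present, so neighbours within a side are common neighbours of a cross pair:
   both sides are sparse inside. *)
have inner x y (S : {set V}) : e x y -> (forall s, s \in S -> e x s) -> #|N y :&: S| <= #|C x y|.
  move=> exy xS; apply: subset_leq_card; apply/subsetP=> s.
  by rewrite in_setI mem_N mem_C => /andP[-> /xS ->].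
(* Keeping only vertices not adjacent to [z], so that deleting [z] costs their pairs no common
   neighbour. *)
set be1 := (be :\: N z) :\ z.
have cbe1 : #|be| <= #|be1| + (d - 1).
  have h : #|N z :&: be| <= #|C a z|.
    by apply: inner => [|s sbe]; [have [] := adj a z aal zbe | have [] := adj a s aal sbe].
  have := cardsD1 z (be :\: N z); have := cardsID (N z) be; rewrite setIC -/be1.
  by have [_ +] := adj a z aal zbe; move: h; case: (_ \in _); clear => /=; lia.
have [a' a'al [a'a na]] : exists2 a', a' \in al & a' != a /\ ~~ e a a'.
  have h : #|N a :&: al| <= #|C z a|.
    by apply: inner => [|s sal]; rewrite se; [have [] := adj a z aal zbe | have [] := adj s z sal zbe].
  have : 0 < #|(al :\: N a) :\ a|.
    have := cardsD1 a (al :\: N a); have := cardsID (N a) al; rewrite setIC.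
    by have [_ +] := adj a z aal zbe; rewrite C_sym; move: h cal; case: (_ \in _); clear => /=; lia.
  case/card_gt0P=> a'; rewrite in_setD1 in_setD mem_N => /and3P[h1 h2 h3]; by exists a'.
have zal x : x \in al -> e z x by move=> xal; rewrite se; have [] := adj x z xal zbe.
have [|c ci cN] := @inj_of_card V (N z :\ a') d.
  have := cardsD1 a' (N z); have := degD z; case: (_ \in _); move: HD Hn d2; clear => /=; lia.
set e' := add_edge e a a'.
have se' : symmetric e'.
  by move=> x y; rewrite /e' /add_edge se orbC [in RHS]orbC; congr (_ || _); rewrite orbC andbC [X in _ || X]andbC.
have irr' : irreflexive e'.
  move=> x; rewrite /e' /add_edge irr /=; apply/negbTE/negP.
  by case/orP=> /andP[/eqP -> /eqP E]; rewrite E eqxx in a'a.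
have ee' x y : e x y -> e' x y by rewrite /e' /add_edge => ->.
set A1 := [set: V] :\ z.
have cA1 : #|A1| + 1 = n by rewrite /A1 -cardsT (cardsD1 z [set: V]) in_setT addnC.
have memN x y : (y \in nbrs e' A1 [set x]) = (y != z) && e' x y by rewrite nbrs1 inE in_setD1 in_setT andbT.
have memC x y w : (w \in cnbrs e' A1 x y) = [&& w != z, e' x w & e' y w].
  by rewrite /cnbrs in_setI !memN; case: (w != z).
have be1P q : q \in be1 -> [/\ q \in be, q != z & ~~ e z q].
  by rewrite in_setD1 in_setD mem_N => /and3P[].
have Csub p q : q \in be1 -> C p q \subset cnbrs e' A1 p q.
  move=> /be1P[_ _ nzq]; apply/subsetP=> w; rewrite mem_C memC => /andP[pw qw].
  by rewrite (ee' _ _ pw) (ee' _ _ qw) !andbT; apply: contraNneq nzq => <-; rewrite se.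
have zna x : x \in al -> x != z by move=> xal; apply: nda.
have beal q : q \in be -> (q == a = false) * (q == a' = false).
  by move=> qbe; rewrite ![q == _]eq_sym !(negPf (nda _ _ _ qbe)).
apply: (@pinned_ext1 F V d [set: V] e z a a' c) => //; rewrite ?in_setT ?zal //.
- by rewrite eq_sym zna.
- by rewrite eq_sym zna.
- by rewrite eq_sym.
- by move=> i; rewrite in_setT; split=> //; have := cN i; rewrite in_setD1 mem_N => /andP[_]; apply: contraTneq => ->; rewrite irr.
- by move=> i; have := cN i; rewrite in_setD1 => /andP[].
- by move=> i; have := cN i; rewrite in_setD1 mem_N => /andP[].
rewrite -/e' -/A1.
have [q qbe1] : exists q, q \in be1 by apply/card_gt0P; move: cbe1 cbe d2; clear; lia.
apply: (@pinned_cross F V e' se' irr' A1 d (D - 1) _ _ _ _ al be1 _ _ _ _ _ _ _ _ a q) => //.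
- move=> x _; have : #|N x :\ z| <= #|nbrs e' A1 [set x]|.
    apply: subset_leq_card; apply/subsetP=> y; rewrite in_setD1 memN mem_N => /andP[-> /ee' //].
  by have := degD x; have := cardsD1 z (N x); case: (_ \in _); clear => /=; lia.
- by move: d2; clear; lia.
- by move: HD cA1 d2 Hn; clear; lia.
- by move: cA1 Hn; clear; lia.
- by apply/subsetP=> x xal; rewrite in_setD1 zna ?in_setT.
- by apply/subsetP=> x /be1P[_ xz _]; rewrite in_setD1 xz in_setT.
- by apply: disjointWr dis; apply/subsetP=> x /be1P[].
- by move: cal; clear; lia.
- by move: cbe cbe1 d2; clear; lia.
- by move: cover cbe1 cA1 d2; clear; lia.
(* The new edge adds at most the common neighbours [a] and [a'] to the previous [d - 2], and
   [d <= 2 * d - 2]. *)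
- move=> p r pal /be1P[rbe _ _].
  have : #|cnbrs e' A1 p r| <= #|C p r :|: [set a; a']|.
    apply: subset_leq_card; apply/subsetP=> w; rewrite memC in_setU mem_C in_set2 => /and3P[_].
    rewrite /e' /add_edge !(beal _ rbe) /= orbF => /orP[-> ->//|].
    by case/orP=> /andP[_ ->] _; rewrite ?orbT.
  have := (leq_card_setU (C p r) [set a; a']).1; have [_] := adj p r pal rbe.
  by rewrite cards2; case: (_ != _); move: d2; clear => /=; lia.
- move=> p r pal rbe1; have [rbe _ _] := be1P r rbe1.
  have := low_pair (nda _ _ pal rbe); have := subset_leq_card (Csub p r rbe1).
  by have [epr _] := adj p r pal rbe; rewrite epr (ee' _ _ epr); clear; lia.
(* The new edge makes [a'] a common neighbour of [a] and [q]: the unit missing for the initial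
   pair. *)
- have [qbe _ nzq] := be1P q qbe1; have [eaq _] := adj a q aal qbe; have [ea'q _] := adj a' q a'al qbe.
  have : a' |: C a q \subset cnbrs e' A1 a q.
    rewrite subUset Csub // andbT sub1set memC zna // (ee' q) 1?se // andbT /=.
    by rewrite /e' /add_edge !eqxx orbT.
  move/subset_leq_card; rewrite cardsU1 mem_C (negPf na) /= (ee' _ _ eaq).
  by have := low_pair (nda _ _ aal qbe); rewrite eaq; clear; lia.
Qed.

Lemma pinned_mindeg2 : pinned F d [set: V] e 'C(d.+1, 2).
Proof.
have [[ys [B [bu sz]]]|[V0 [cV0 nm]]] := built_or; first exact: built_pinned bu sz.
have [a0 [b0 [a0V b0V ab0 o0]]] := exists_opp cV0 nm.
pose al : {set V} := [set v in V0 | opp v b0].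
pose be := V0 :\: al.
have dis : [disjoint al & be] by rewrite -setI_eq0 setIDA setDIl setDv ?set0I //.
have alP a : a \in al -> a \in V0 /\ opp a b0 by rewrite inE => /andP.
have beP b : b \in be -> b \in V0 /\ ~~ opp b b0.
  by rewrite in_setD inE => /andP[+ bV]; rewrite bV.
have nda z w : z \in al -> w \in be -> z != w.
  by move=> za wb; apply: contraTneq wb => <-; rewrite (disjointFr dis za).
have oab a b : a \in al -> b \in be -> opp a b.
  move=> aal bbe; have [aV oa] := alP a aal; have [bV nob] := beP b bbe.
  case: (eqVneq b b0) => [->//|bb0]; apply: (cross_opp oa nob) => //; try exact: nm.
  exact: nda.
have a0al : a0 \in al by rewrite inE a0V.
(* The codegree of [b0] with itself is its degree, so [b0] is not opposite to itself. *)
have b0be : b0 \in be.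
  rewrite in_setD inE b0V /= andbT /opp; have -> : C b0 b0 = N b0 by apply/setP=> c; rewrite mem_C mem_N andbb.
  by have := degD b0; move: HD Hn d2; clear; lia.
have cab : #|al| + #|be| = #|V0|.
  have := cardsID al V0; rewrite -/be (setIidPr _) //.
  by apply/subsetP=> a /alP[].
have cbe : 6 * d <= #|be|.
  by apply: (big_side a0al b0be dis) => [|a aal]; [rewrite cab | apply: oab].
have cal : 6 * d <= #|al|.
  apply: (big_side b0be a0al) => [||b bbe]; first by rewrite disjoint_sym.
    by rewrite addnC [#|be| + _]addnC addnC cab.
  by rewrite /opp C_sym; apply: oab.
have [/exists_inP[a aal /exists_inP[b bbe first]]|nex] :=
    boolP [exists a in al, [exists b in be, d <= #|C a b| + e a b]]; last first.
  apply: (pinned_extremal dis cal cbe); first by rewrite cab.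
  move=> a b aal bbe; rewrite ltnNge; apply: contra nex => h.
  by apply/exists_inP; exists a => //; apply/exists_inP; exists b.
apply: (@pinned_cross F V e se irr [set: V] d D _ _ _ _ al be _ _ _ _ _ _ _ _ a b) => //;
  rewrite ?cardsT //.
- by move: d2; lia.
- by move: HD; clear; lia.
- by move: Hn; clear; lia.
- by move: cal; clear; lia.
- by move: cbe; clear; lia.
- by move: cab cV0; clear; lia.
- by move=> p q pal qbe; apply/low_pair/nda.
Qed.

End MinDegree.

Lemma pinned_mindeg (F : realFieldType) (V : finType) (e : rel V) (d D : nat) :
  symmetric e -> irreflexive e -> (forall z, D <= #|[set w | e z w]|) ->
  #|V| + d <= 2 * D + 2 -> 29 * d <= #|V| -> 0 < d ->
  pinned F d [set: V] e 'C(d.+1, 2).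
Proof.
move=> se irr degD HD Hn d0.
have degD' z : D <= #|nbrs e [set: V] [set z]|.
  by rewrite nbrs1; apply: leq_trans (degD z) _; apply: subset_leq_card; apply/subsetP=> w; rewrite !inE.
have [d2|d1] := ltnP 1 d; first exact: (pinned_mindeg2 F se irr degD').
by apply: (pinned_mindeg1 F se irr degD'); lia.
Qed.

From mathcomp Require Import all_classical all_reals all_analysis.
From mathcomp Require Import Rstruct Rstruct_topology.
Import numFieldNormedType.Exports.

(** * From infinitesimal rigidity to generic rigidity *)

Section GenericRigidity.
Local Open Scope ring_scope.

(** * Determinants as functions of a point or a parameter *)

Section FunctionRing.
Variables (X : Type) (R : comNzRingType) (P : (X -> R) -> Prop).
Hypotheses (Pn : forall n, P (fun=> n%:R)) (PN : forall f, P f -> P (fun x => - f x)).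
Hypotheses (PD : forall f g, P f -> P g -> P (fun x => f x + g x)).
Hypotheses (PM : forall f g, P f -> P g -> P (fun x => f x * g x)).

(** The class [P] will be both the rational polynomial functions of the coordinates and the
    continuous functions of time. *)
Lemma sum_closed (A : Type) (r : seq A) (F : A -> X -> R) :
  (forall a, P (F a)) -> P (fun x => \sum_(a <- r) F a x).
Proof.
move=> PF; elim: r => [|a r IH].
  by rewrite (_ : (fun=> _) = fun=> 0%:R) //; apply/funext => x; rewrite big_nil.
rewrite (_ : (fun x => _) = fun x => F a x + \sum_(a <- r) F a x); first exact: PD.
by apply/funext => x; rewrite big_cons.
Qed.

Lemma prod_closed (A : Type) (r : seq A) (F : A -> X -> R) :
  (forall a, P (F a)) -> P (fun x => \prod_(a <- r) F a x).
Proof.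
move=> PF; elim: r => [|a r IH].
  by rewrite (_ : (fun=> _) = fun=> 1%:R) //; apply/funext => x; rewrite big_nil.
rewrite (_ : (fun x => _) = fun x => F a x * \prod_(a <- r) F a x); first exact: PM.
by apply/funext => x; rewrite big_cons.
Qed.

Lemma det_closed n (M : X -> 'M[R]_n) :
  (forall i j, P (fun x => M x i j)) -> P (fun x => \det (M x)).
Proof.
move=> PMx; rewrite /determinant; apply: sum_closed => s; apply: PM.
  by case: (odd_perm s) => /=; rewrite ?expr0 ?expr1; [exact: PN (Pn 1)|exact: Pn 1].
by apply: prod_closed => i.
Qed.

Lemma gram_closed (A J : finType) (M : X -> A -> J -> R) :
  (forall a j, P (fun x => M x a j)) -> P (fun x => \det (gram (M x))).
Proof.
move=> PMx; apply: det_closed => i j.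
rewrite (_ : (fun x => _) = fun x => \sum_a M x a (enum_val i) * M x a (enum_val j)).
  by apply: sum_closed => a; apply: PM.
by apply/funext => x; rewrite mxE.
Qed.

End FunctionRing.

(** [alg_indep_Q] over any [realType]; over the Stdlib reals the two unfold to the same
    statement. *)
Definition alg_indep (F : realType) (I : finType) (x : I -> F) : Prop :=
  forall (k : nat) (c : {ffun {ffun I -> 'I_k} -> rat}),
    \sum_(m : {ffun I -> 'I_k}) ratr (c m) * \prod_(i : I) x i ^+ (m i) = 0 -> c = 0.

Section RationalFunctions.
Variables (R : realType) (I : finType).
Implicit Types (f g : (I -> R) -> R) (s : seq (rat * {ffun I -> nat})).

Definition mono (x : I -> R) (t : rat * {ffun I -> nat}) : R := ratr t.1 * \prod_i x i ^+ t.2 i.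

Definition qpolyfun f : Prop := exists s, forall x, f x = \sum_(t <- s) mono x t.

Lemma qpolyfun_const (a : rat) : qpolyfun (fun=> ratr a).
Proof.
exists [:: (a, [ffun=> 0%N])] => x; rewrite big_seq1 /mono big1 ?mulr1 // => i _.
by rewrite ffunE expr0.
Qed.

Lemma qpolyfun_nat n : qpolyfun (fun=> n%:R).
Proof. by have [s sP] := qpolyfun_const n%:R; exists s => x; rewrite -sP ratr_nat. Qed.

Lemma qpolyfun_var i : qpolyfun (fun x => x i).
Proof.
exists [:: (1, [ffun j => (j == i)%N : nat])] => x; rewrite big_seq1 /mono rmorph1 mul1r.
rewrite (bigD1 i) //= ffunE eqxx big1 ?mulr1 // => j ji.
by rewrite ffunE (negPf ji).
Qed.

Lemma qpolyfunD f g : qpolyfun f -> qpolyfun g -> qpolyfun (fun x => f x + g x).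
Proof. by move=> [s sP] [t tP]; exists (s ++ t) => x; rewrite big_cat sP tP. Qed.

Lemma qpolyfunM f g : qpolyfun f -> qpolyfun g -> qpolyfun (fun x => f x * g x).
Proof.
move=> [s sP] [t tP].
pose mul (a b : rat * {ffun I -> nat}) : rat * {ffun I -> nat} :=
  (a.1 * b.1, [ffun i => (a.2 i + b.2 i)%N]).
exists [seq mul a b | a <- s, b <- t] => x.
rewrite big_allpairs_dep sP tP mulr_suml; apply: eq_bigr => a _.
rewrite mulr_sumr; apply: eq_bigr => b _; rewrite /mono rmorphM /=.
rewrite mulrACA -big_split /=; congr (_ * _); apply: eq_bigr => i _.
by rewrite ffunE exprD.
Qed.

Lemma qpolyfunN f : qpolyfun f -> qpolyfun (fun x => - f x).
Proof.
move=> /(qpolyfunM (qpolyfun_const (-1))) [s sP]; exists s => x.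
by rewrite -sP rmorphN1 mulN1r.
Qed.

Lemma qpolyfunB f g : qpolyfun f -> qpolyfun g -> qpolyfun (fun x => f x - g x).
Proof. by move=> rf rg; apply: qpolyfunD rf (qpolyfunN rg). Qed.

Lemma qpolyfun_gram (A J : finType) (M : (I -> R) -> A -> J -> R) :
  (forall a j, qpolyfun (fun x => M x a j)) -> qpolyfun (fun x => \det (gram (M x))).
Proof.
move=> rM; apply: (gram_closed (P := @qpolyfun)) => //.
- exact: qpolyfun_nat.
- exact: qpolyfunN.
- exact: qpolyfunD.
- exact: qpolyfunM.
Qed.

(** The list representing [f] may repeat monomials; once collected, its coefficients must all
    vanish. The bound [k] exceeds every exponent, so [inord] alters none. *)
Lemma qpolyfun_generic f x y : alg_indep x -> qpolyfun f -> f x = 0 -> f y = 0.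
Proof.
move=> indep [s sP]; rewrite !sP.
pose k := (\max_(t <- s) \max_i t.2 i).+1.
have ltk t i : t \in s -> (t.2 i < k)%N.
  move=> ts; rewrite ltnS; apply: (leq_trans (leq_bigmax (F := t.2) i)).
  exact: (leq_bigmax_seq (F := fun t : rat * {ffun I -> nat} => \max_i t.2 i)).
pose tr (t : rat * {ffun I -> nat}) : {ffun I -> 'I_k} := [ffun i => inord (t.2 i)].
pose c : {ffun {ffun I -> 'I_k} -> rat} := [ffun m => \sum_(t <- s | tr t == m) t.1].
have E z : \sum_(t <- s) mono z t = \sum_(m : {ffun I -> 'I_k}) ratr (c m) * \prod_i z i ^+ (m i).
  rewrite (partition_big tr xpredT) //=; apply: eq_bigr => m _.
  rewrite ffunE rmorph_sum /= mulr_suml big_seq_cond [RHS]big_seq_cond.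
  apply: eq_bigr => t /andP[ts /eqP <-]; rewrite /mono; congr (_ * _).
  by apply: eq_bigr => i _; rewrite ffunE inordK // ltk.
rewrite !E => /indep ->; rewrite big1 // => m _; by rewrite ffunE rmorph0 mul0r.
Qed.

End RationalFunctions.

(** * Existence of algebraically independent reals *)

Section Existence.
Variables (R : realType) (I : finType).

(** The first condition freezes the exponents outside [s], so distinct monomials stay distinct when
    only the variables in [s] are evaluated. *)
Definition indep_on (s : seq I) (x : I -> R) : Prop :=
  forall k (c : {ffun {ffun I -> 'I_k} -> rat}),
  (forall m m', c m != 0 -> c m' != 0 -> forall i, i \notin s -> m i = m' i) ->
  \sum_m ratr (c m) * \prod_(i <- s) x i ^+ (m i) = 0 -> c = 0.

Lemma finite_roots (q : {poly R}) : q != 0 -> exists rs : seq R, forall t, root q t -> t \in rs.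
Proof.
move En: (size q) => n; elim: n q En => [|n IH] q En q0.
  by move/eqP: En; rewrite size_poly_eq0 (negPf q0).
have [[t rt]|nr] := pselect (exists t, root q t); last first.
  by exists [::] => t rt; case: nr; exists t.
have /factor_theorem[q' Eq] := rt.
have q'0 : q' != 0 by apply: contraNneq q0 => E; rewrite Eq E mul0r.
have [|rs rsP] := IH q' _ q'0.
  by apply/succn_inj; rewrite -En Eq size_Mmonic ?monicXsubC // size_XsubC addn2.
exists (t :: rs) => z; rewrite Eq rootM root_XsubC in_cons => /orP[/rsP ->|/eqP ->].
  by rewrite orbT.
by rewrite eqxx.
Qed.

(** The roots to avoid form a countable set, of Lebesgue measure zero, whereas the unit interval has
    measure one. *)
Lemma avoid_countable (T : countType) (q : T -> {poly R}) :
  exists t : R, forall a, q a != 0 -> (q a).[t] != 0.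
Proof.
pose bad : set R := (\bigcup_(a in [set a | q a != 0]) [set t | root (q a) t])%classic.
have cb : countable bad.
  apply: bigcup_countable => [|a qa]; first exact: countableP.
  have [rs rsP] := finite_roots qa.
  apply: (@sub_countable _ _ _ [set` rs]); first by apply: subset_card_le => t; apply: rsP.
  exact: finite_set_countable.
apply: contrapT => nex.
have : (`[0%R, 1%R]%classic `<=` bad)%classic.
  move=> t _; apply: contrapT => nb; apply: nex; exists t => a qa.
  by apply/negP => rt; apply: nb; exists a.
move=> /subset_card_le/sub_countable/(_ cb)/countable_lebesgue_measure0.
by rewrite lebesgue_measure_itv /= lte_fin ltr01 oppr0 adde0 => /eqP; rewrite eqe oner_eq0.
Qed.

(** Candidate relations become countably many polynomials in the new coordinate; [t] avoids the
    roots of the nonzero ones. A relation at [t] then has all its coefficients zero, and each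
    coefficient is a relation on [s], the slice [c']. *)
Lemma indep_on_cons i s x : i \notin s -> indep_on s x ->
  exists t, indep_on (i :: s) (fun j => if j == i then t else x j).
Proof.
move=> is_ indep.
pose q (kc : {k & {ffun {ffun I -> 'I_k} -> rat}}) : {poly R} :=
  \sum_(m : {ffun I -> 'I_(tag kc)}) (ratr (tagged kc m) * \prod_(j <- s) x j ^+ (m j)) *: 'X^(m i).
have [t tP] := avoid_countable q; exists t => k c fib c0.
have E : (q (Tagged _ c)).[t] = 0.
  rewrite -[RHS]c0 horner_sum; apply: eq_bigr => m _.
  rewrite hornerZ hornerXn big_cons eqxx mulrCA mulrC; congr (_ * (_ * _)).
  rewrite big_seq [RHS]big_seq; apply: eq_bigr => j js.
  by case: eqP => // E; rewrite -E js in is_.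
have q0 : q (Tagged _ c) = 0.
  by apply/eqP; apply: contraT => /tP; rewrite E eqxx.
apply/ffunP=> m0; rewrite [RHS]ffunE.
pose c' : {ffun {ffun I -> 'I_k} -> rat} := [ffun m : {ffun I -> 'I_k} => if m i == m0 i then c m else 0].
suff c'0 : c' = 0 by have := congr1 (fun f : {ffun _ -> _} => f m0) c'0; rewrite !ffunE eqxx.
apply: indep => [m m'|].
  rewrite !ffunE; case: (m i =P m0 i) => [mi|_]; last by rewrite eqxx.
  case: (m' i =P m0 i) => [mi'|_]; last by rewrite eqxx.
  move=> cm cm' j js; case: (eqVneq j i) => [->|ji]; first by rewrite mi mi'.
  by apply: fib => //; rewrite in_cons negb_or ji.
have := congr1 (fun p : {poly R} => p`_(m0 i)) q0; rewrite coef0 coef_sum => E0.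
rewrite -[RHS]E0; apply: eq_bigr => m _; rewrite coefZ coefXn ffunE eq_sym -val_eqE /=.
by case: eqP; rewrite ?rmorph0 ?mul0r ?mulr1 ?mulr0.
Qed.

Lemma exists_alg_indep : exists x : I -> R, alg_indep x.
Proof.
have key (s : seq I) : uniq s -> exists x, indep_on s x.
  elim: s => [_|i s IH /= /andP[is_ us]].
    exists (fun=> 0) => k c fib c0; apply/ffunP=> m; rewrite [RHS]ffunE.
    apply/eqP; apply: contraT => cm; move: c0; rewrite (bigD1 m) //= big_nil mulr1.
    rewrite [X in _ + X]big1 => [|m' m'm]; first by rewrite addr0 => /eqP; rewrite fmorph_eq0 (negPf cm).
    have [->|cm'] := eqVneq (c m') 0; first by rewrite rmorph0 mul0r.
    case/negP: m'm; apply/eqP/ffunP => i; exact: fib.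
  have [x xP] := IH us; have [t tP] := indep_on_cons is_ xP.
  by exists (fun j => if j == i then t else x j).
have [x xP] := key _ (enum_uniq I); exists x => k c c0; apply: xP => [m m' _ _ i|].
  by rewrite mem_enum.
by rewrite -[RHS]c0; apply: eq_bigr => m _; rewrite big_enum.
Qed.

End Existence.

(** * Transfer from a rational point to a generic real one *)

Section PinMatrix.
Variables (V : finType) (d : nat) (e : rel V).

Definition pin_mx (S : comNzRingType) (J : finType) (p : V -> 'I_d -> S)
    (phi : J -> V -> 'I_d -> S) :=
  edge_mx e (fun _ _ => false) (fun x y i => p x i - p y i) (fun x y i => - (p x i - p y i)) phi.

Lemma pin_mxP (F : realFieldType) (J : finType) (p : V -> 'I_d -> F) (phi : J -> V -> 'I_d -> F) :
  sys_inj (pin_mx p phi) <-> pinned_at [set: V] e p phi.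
Proof.
have E x y m : \sum_i ((p x i - p y i) * m x i + - (p x i - p y i) * m y i) =
   \sum_i (p x i - p y i) * (m x i - m y i).
  by apply: eq_bigr => i _; ring.
split=> [/edge_mxP inj m [_ mE] mP | pin]; first apply: inj => // x y exy.
  by rewrite E mE ?inE.
apply/edge_mxP => m _ mE mP; apply: pin => //; split=> [x i|x y _ _ exy]; first by rewrite inE.
by rewrite -E mE.
Qed.

Lemma pin_mx_closed (X : Type) (S : comNzRingType) (P : (X -> S) -> Prop) (J : finType)
    (p : X -> V -> 'I_d -> S) (phi : J -> V -> 'I_d -> S) :
  (forall n, P (fun=> n%:R)) -> (forall f, P f -> P (fun x => - f x)) ->
  (forall f g, P f -> P g -> P (fun x => f x + g x)) ->
  (forall f g, P f -> P g -> P (fun x => f x * g x)) ->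
  (forall v i, P (fun x => p x v i)) -> (forall j v i, P (fun=> phi j v i)) ->
  P (fun x => \det (gram (pin_mx (p x) phi))).
Proof.
move=> Pn PN PD PM Pp Pphi; apply: gram_closed => // a u.
case: a => [[[x y]|j]|xi] /=; [|exact: Pphi|exact: Pn].
case: (e x y); last exact: Pn 0.
have Pxy : P (fun z => p z x u.2 - p z y u.2) by apply: PD => //; apply: PN.
by apply: PD; apply: PM => //; apply: PN.
Qed.

End PinMatrix.

(** With the rational pins kept, the Gram determinant is a rational polynomial in the coordinates;
    being nonzero at [p0], it cannot vanish at a generic point. *)
Lemma generic_pinned (R : realType) (V : finType) (d k : nat) (e : rel V) (p : V -> 'I_d -> R) :
  alg_indep (fun u : V * 'I_d => p u.1 u.2) -> pinned rat d [set: V] e k ->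
  exists (J : finType) (phi : J -> V -> 'I_d -> R), #|J| = k /\ pinned_at [set: V] e p phi.
Proof.
move=> indep [p0 [J [phi [cJ /pin_mxP/gram_inj pin]]]].
exists J, (fun j v i => ratr (phi j v i)); split=> //; apply/pin_mxP/gram_inj.
pose f (c : V * 'I_d -> R) := \det (gram (pin_mx e (fun v i => c (v, i)) (fun j v i => ratr (phi j v i)))).
have rf : qpolyfun f.
  apply: pin_mx_closed; [exact: qpolyfun_nat|exact: qpolyfunN|exact: qpolyfunD|exact: qpolyfunM| |].
    by move=> v i; apply: qpolyfun_var.
  by move=> j v i; apply: qpolyfun_const.
apply: contraNneq pin => f0.
have : f (fun u => ratr (p0 u.1 u.2)) = 0 by apply: qpolyfun_generic indep rf _.
rewrite /f; set M := gram _ => M0.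
have EM : M = map_mx ratr (gram (pin_mx e p0 phi)).
  apply/matrixP=> a b; rewrite !mxE rmorph_sum /=; apply: eq_bigr => t _; rewrite rmorphM /=.
  have E u : ratr (pin_mx e p0 phi t u) = pin_mx e (fun v i => ratr (p0 v i)) (fun j v i => ratr (phi j v i)) t u :> R.
    case: t => [[[x y]|j]|xi] //=; last by rewrite ratr_nat.
    case: (e x y); last by rewrite rmorph0.
    by rewrite !(rmorphD, rmorphM, rmorphN, rmorph_nat) /=.
  by rewrite !E.
by move: M0; rewrite EM det_map_mx => /eqP; rewrite fmorph_eq0.
Qed.

Lemma sys_inj_solve (F : realFieldType) (J T : finType) (M : J -> T -> F) :
  #|J| = #|T| -> sys_inj M -> forall b, exists a, forall j, \sum_t M j t * a t = b j.
Proof.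
move=> cJT inj b.
pose A : 'M[F]_(#|T|, #|J|) := \matrix_(t, j) M (enum_val j) (enum_val t).
have fA : row_full A.
  suff : row_free A by rewrite /row_free /row_full => /eqP ->; rewrite cJT.
  rewrite -kermx_eq0; apply/rowV0P => u /sub_kermxP uA; apply/matrixP=> i t; rewrite ord1 mxE.
  rewrite -[t]enum_valK; apply: (inj (fun t => u 0 (enum_rank t))) => j.
  have := congr1 (fun z : 'rV_ _ => z 0 (enum_rank j)) uA; rewrite !mxE => E.
  rewrite -[RHS]E (reindex_onto (@enum_val _ T) enum_rank) => [|t' _]; last exact: enum_rankK.
  by apply: eq_big => [t'|t' _]; rewrite ?enum_valK ?eqxx // mxE enum_rankK mulrC.
have /submxP[D DA] : (\row_j b (enum_val j) <= A)%MS by apply: submx_full.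
exists (fun t => D 0 (enum_rank t)) => j.
have := congr1 (fun z : 'rV_ _ => z 0 (enum_rank j)) DA; rewrite !mxE enum_rankK => ->.
rewrite (reindex_onto (@enum_val _ T) enum_rank) => [|t' _]; last exact: enum_rankK.
by apply: eq_big => [t'|t' _]; rewrite ?enum_valK ?eqxx // mxE enum_rankK mulrC.
Qed.

(** * Infinitesimal isometries *)

Section Trivial.
Variables (F : realFieldType) (V : finType) (d : nat).
Implicit Types (p q m : V -> 'I_d -> F).

Definition spans p := sys_inj (fun (xy : V * V) i => p xy.1 i - p xy.2 i).

Definition hom p (x : V) (i : 'I_d.+1) : F := if unlift ord_max i is Some j then p x j else 1.

Lemma hom_inj p : spans p -> (0 < #|V|)%N -> sys_inj (hom p).
Proof.
move=> sp /card_gt0P[x0 _] h h0.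
have E x : \sum_i p x i * h (lift ord_max i) + h ord_max = 0.
  rewrite -[RHS](h0 x) big_ord_recr /= {2}/hom unlift_none mul1r; congr (_ + _).
  apply: eq_bigr => i _; have -> : widen_ord (leqnSn d) i = lift ord_max i.
    by apply: val_inj; rewrite /= /bump leqNgt ltn_ord.
  by rewrite /hom liftK.
have hl i : h (lift ord_max i) = 0.
  apply: (sp (fun i => h (lift ord_max i))) => -[x y] /=.
  under eq_bigr => j _ do rewrite mulrBl.
  by rewrite sumrB; have := E x; have := E y; lra.
move=> i; case: (unliftP ord_max i) => [j|] -> //.
by have := E x0; rewrite big1 ?add0r // => j _; rewrite hl mulr0.
Qed.

(* Infinitesimal isometries are [x |-> S x] for skew [S] in homogeneous coordinates. *)
Definition skew_ix := {ij : 'I_d.+1 * 'I_d.+1 | (ij.1 < ij.2)%N}.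

Lemma card_skew_ix : #|{: skew_ix}| = 'C(d.+1, 2).
Proof.
rewrite card_sig -sum1_card; under eq_bigl => ij do rewrite inE.
rewrite (eq_bigr (fun ij => (fun i j => 1%N) ij.1 ij.2)) // -(pair_big_dep xpredT (fun i j : 'I_d.+1 => (i < j)%N) (fun _ _ => 1%N)) /=.
rewrite (exchange_big_dep xpredT) //= -triangular_sum big_mkord; apply: eq_bigr => j _.
rewrite sum1_card -[RHS]card_ord.
have -> : #|[pred i : 'I_d.+1 | (i < j)%N]| = #|[set widen_ord (ltnW (ltn_ord j)) i | i : 'I_j]|.
  apply: eq_card => i; rewrite inE; apply/idP/imsetP => [ij|[i' _ ->]]; last exact: (ltn_ord i').
  by exists (Ordinal ij) => //; apply: val_inj.
by rewrite card_imset // => a b /(congr1 val) /= /val_inj.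
Qed.

Definition skew_motion p (t : skew_ix) (x : V) (l : 'I_d) : F :=
  hom p x (val t).1 * (lift ord_max l == (val t).2)%:R - hom p x (val t).2 * (lift ord_max l == (val t).1)%:R.

Lemma skew_motion_flex p t x y :
  \sum_l (p x l - p y l) * (skew_motion p t x l - skew_motion p t y l) = 0.
Proof.
pose D i := hom p x i - hom p y i; case: t => -[i j] ij.
have DE l : p x l - p y l = D (lift ord_max l) by rewrite /D /hom liftK.
have D0 : D ord_max = 0 by rewrite /D /hom unlift_none subrr.
transitivity (\sum_h D h * (D i * (h == j)%:R - D j * (h == i)%:R)); last first.
  under eq_bigr => h _ do rewrite mulrBr !mulrA.
  have pk (f : 'I_d.+1 -> F) k : \sum_h f h * (h == k)%:R = f k.
    rewrite (bigD1 k) //= eqxx mulr1 big1 ?addr0 // => h /negPf ->; exact: mulr0.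
  by rewrite sumrB (pk (fun h => D h * D i)) (pk (fun h => D h * D j)) mulrC subrr.
rewrite [RHS]big_ord_recr /= D0 mul0r addr0; apply: eq_bigr => l _.
have -> : widen_ord (leqnSn d) l = lift ord_max l.
  by apply: val_inj; rewrite /= /bump leqNgt ltn_ord.
rewrite DE /skew_motion /=; congr (_ * _); rewrite /D; ring.
Qed.

(** For each [l], the form with coefficients [b i l - b l i] kills all homogeneous points, which
    span, so it is zero; [b] lives above the diagonal, hence vanishes. *)
Lemma skew_motion_inj p (a : skew_ix -> F) : spans p -> (0 < #|V|)%N ->
  (forall x l, \sum_t skew_motion p t x l * a t = 0) -> forall t, a t = 0.
Proof.
move=> sp V0 a0.
pose b i j : F := if insub (i, j) is Some t then a t else 0.
have bE (i j : 'I_d.+1) (ij : (i < j)%N) : b i j = a (exist _ (i, j) ij).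
  by rewrite /b insubT.
have b0 (i j : 'I_d.+1) : ~~ (i < j)%N -> b i j = 0 by move=> ij; rewrite /b insubN.
have S0 i l : b i (lift ord_max l) - b (lift ord_max l) i = 0.
  apply: (hom_inj sp V0 (m := fun i => b i (lift ord_max l) - b (lift ord_max l) i)) => x.
  rewrite -[RHS](a0 x l).
  transitivity (\sum_(ij : 'I_d.+1 * 'I_d.+1) b ij.1 ij.2 *
    (hom p x ij.1 * (lift ord_max l == ij.2)%:R - hom p x ij.2 * (lift ord_max l == ij.1)%:R)).
    rewrite -(pair_big xpredT xpredT (fun i j => b i j *
     (hom p x i * (lift ord_max l == j)%:R - hom p x j * (lift ord_max l == i)%:R))) /=.
    have pk (f : 'I_d.+1 -> F) k : \sum_h f h * (k == h)%:R = f k.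
      rewrite (bigD1 k) //= eqxx mulr1 big1 ?addr0 // => h; rewrite eq_sym => /negPf ->; exact: mulr0.
    under [LHS]eq_bigr => k _ do rewrite mulrBr.
    rewrite [LHS]sumrB.
    under [RHS]eq_bigr => k _.
      under eq_bigr => j _ do rewrite mulrBr !mulrA.
      rewrite sumrB (pk (fun j => b k j * hom p x k)).
      over.
    rewrite sumrB; congr (_ - _); first by apply: eq_bigr => k _; rewrite mulrC.
    rewrite exchange_big /=; apply: eq_bigr => k _.
    by rewrite (pk (fun i => b i k * hom p x k)) mulrC.
  rewrite (bigID (fun ij : 'I_d.+1 * 'I_d.+1 => (ij.1 < ij.2)%N)) /= [X in _ + X]big1 ?addr0.
    rewrite (reindex_omap (val : skew_ix -> _) insub) /= => [|ij ltij]; last by rewrite insubT.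
    apply: eq_big => [t|t _]; first by rewrite valK eqxx (valP t).
    by rewrite /skew_motion mulrC; case: t => -[i1 j1] ij1 /=; rewrite bE.
  by move=> ij nij; rewrite b0 ?mul0r.
move=> [[i j] ij] /=.
rewrite -(bE _ _ ij).
case: (unliftP ord_max j) => [l|] Ej.
  by have := S0 i l; rewrite -Ej (b0 j i) ?subr0 // -leqNgt ltnW.
case: (unliftP ord_max i) => [l|] Ei.
  by have := S0 j l; rewrite -Ei (b0 j i) ?sub0r -?leqNgt 1?ltnW // => /eqP; rewrite oppr_eq0 => /eqP.
by move: ij; rewrite /= Ei Ej ltnn.
Qed.

(** The pins are injective on the isometries, which have the same dimension, so some isometry has
    the pin values of [m]. Its difference with [m] is a pinned flex, hence zero. *)
Lemma pinned_flex_trivial e p m (J : finType) (phi : J -> V -> 'I_d -> F) :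
  spans p -> #|J| = 'C(d.+1, 2) -> pinned_at [set: V] e p phi -> 
  (forall x y, e x y -> \sum_i (p x i - p y i) * (m x i - m y i) = 0) ->
  forall x y, \sum_i (p x i - p y i) * (m x i - m y i) = 0.
Proof.
move=> sp cJ pin mE x y; have V0 : (0 < #|V|)%N by apply/card_gt0P; exists x.
pose M j t := \sum_x \sum_i phi j x i * skew_motion p t x i.
have lin (a : skew_ix -> F) z w : \sum_i (p z i - p w i) *
   (\sum_t skew_motion p t z i * a t - \sum_t skew_motion p t w i * a t) = 0.
  under eq_bigr => i _ do rewrite -sumrB mulr_sumr.
  rewrite exchange_big big1 //= => t _.
  transitivity ((\sum_l (p z l - p w l) * (skew_motion p t z l - skew_motion p t w l)) * a t).
    by rewrite mulr_suml; apply: eq_bigr => i _; ring.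
  by rewrite skew_motion_flex mul0r.
have Mlin (a : skew_ix -> F) j : \sum_t M j t * a t =
    \sum_x \sum_i phi j x i * \sum_t skew_motion p t x i * a t.
  under eq_bigr => t _ do rewrite mulr_suml.
  rewrite exchange_big; apply: eq_bigr => z _ /=.
  under eq_bigr => t _ do rewrite mulr_suml.
  rewrite exchange_big; apply: eq_bigr => i _ /=.
  by rewrite mulr_sumr; apply: eq_bigr => t _; rewrite mulrA.
have Minj : sys_inj M.
  move=> a Ma; apply: (skew_motion_inj sp V0); apply: pin => [|j]; last by rewrite -Mlin.
  by split=> [z i|z w _ _ _]; [rewrite inE | apply: lin].
have [|a aP] := sys_inj_solve _ Minj (fun j => \sum_x \sum_i phi j x i * m x i).
  by rewrite cJ card_skew_ix.
have E z i : m z i = \sum_t skew_motion p t z i * a t.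
  apply/eqP; rewrite -subr_eq0; apply/eqP; move: z i; apply: pin => [|j]; last first.
    under eq_bigr => z _ do under eq_bigr => i _ do rewrite mulrBr.
    under eq_bigr => z _ do rewrite sumrB.
    by rewrite sumrB -aP Mlin subrr.
  split=> [z i|z w _ _ ezw]; first by rewrite inE.
  transitivity (\sum_i (p z i - p w i) * (m z i - m w i) -
    \sum_i (p z i - p w i) * (\sum_t skew_motion p t z i * a t - \sum_t skew_motion p t w i * a t)).
    by rewrite -sumrB; apply: eq_bigr => i _; ring.
  by rewrite mE // lin subrr.
rewrite -[RHS](lin a x y); by apply: eq_bigr => i _; rewrite !E.
Qed.

End Trivial.

(** * Congruent configurations *)

Section Congruence.
Variables (F : realFieldType) (V : finType) (d : nat).
Implicit Types (p q m : V -> 'I_d -> F).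

Definition dist2 p x y := \sum_i (p x i - p y i) ^+ 2.

Lemma dist2_polar p x y z w :
  \sum_i (p x i - p y i) * (p z i - p w i) =
    (dist2 p x w + dist2 p y z - dist2 p x z - dist2 p y w) / 2.
Proof.
rewrite /dist2 -!sumrN -!big_split /= mulr_suml; apply: eq_bigr => i _; by field.
Qed.

Definition diff_mx p : 'M[F]_(#|{: V * V}|, d) :=
  \matrix_(a, i) (p (enum_val a).1 i - p (enum_val a).2 i).

Lemma diff_mx_full p : spans p -> row_full (diff_mx p).
Proof.
move=> sp; rewrite /row_full -mxrank_tr -/(row_free _) -kermx_eq0.
apply/rowV0P => u /sub_kermxP uP; apply/matrixP=> i j; rewrite ord1 mxE.
apply: (sp (fun i => u 0 i)) => xy.
have := congr1 (fun z : 'rV_ _ => z 0 (enum_rank xy)) uP; rewrite !mxE => E.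
by rewrite -[RHS]E; apply: eq_bigr => k _; rewrite !mxE enum_rankK mulrC.
Qed.

(** Polarization turns equal distances into [Q *m Q^T = P *m P^T]. With [L] a left inverse of [P],
    the matrix [L *m Q] is orthogonal, and the error [X] of [Q = P *m (L *m Q)] satisfies
    [X *m X^T = 0]. *)
Lemma congr_orthogonal p q : spans p -> (forall x y, dist2 q x y = dist2 p x y) ->
  exists A : 'M[F]_d, A *m A^T = 1%:M /\ forall x y j, q x j - q y j = \sum_i (p x i - p y i) * A i j.
Proof.
move=> sp qp; set P := diff_mx p; set Q := diff_mx q.
have PQ : Q *m Q^T = P *m P^T.
  apply/matrixP=> a b; rewrite !mxE.
  under eq_bigr => i _ do rewrite !mxE.
  under [RHS]eq_bigr => i _ do rewrite !mxE.
  by rewrite !dist2_polar !qp.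
have [L LP] := row_fullP (diff_mx_full sp); rewrite -/P in LP.
exists (L *m Q); split.
  by rewrite trmx_mul mulmxA -(mulmxA L) PQ mulmxA LP mul1mx -trmx_mul LP trmx1.
have E : Q = P *m (L *m Q).
  apply/eqP; rewrite -subr_eq0; set X := _ - _.
  have XX : X *m X^T = 0.
    have -> : X = (1%:M - P *m L) *m Q by rewrite /X mulmxBl mul1mx mulmxA.
    rewrite trmx_mul mulmxA -(mulmxA _ Q) PQ mulmxA mulmxBl mul1mx -(mulmxA P) LP mulmx1.
    by rewrite subrr !mul0mx.
  clearbody X; apply/eqP/matrixP=> a j; rewrite [RHS]mxE.
  have s0 : \sum_k X a k ^+ 2 = 0.
    have := congr1 (fun z : 'M[F]_(_, _) => z a a) XX; rewrite !mxE => s0; rewrite -[RHS]s0.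
    by apply: eq_bigr => k _; rewrite mxE expr2.
  by apply/eqP; rewrite -sqrf_eq0; apply/eqP; move/psumr_eq0P: s0 => -> // k _; apply: sqr_ge0.
move=> x y j; have := congr1 (fun z : 'M[F]_(_, _) => z (enum_rank (x, y)) j) E.
rewrite mxE enum_rankK /= => ->; rewrite mxE; apply: eq_bigr => i _.
by rewrite !mxE enum_rankK.
Qed.

Lemma congr_spans p q : spans p -> (forall x y, dist2 q x y = dist2 p x y) -> spans q.
Proof.
move=> sp qp; have [A [AA qA]] := congr_orthogonal sp qp.
move=> h h0.
have Ah i : \sum_j A i j * h j = 0.
  apply: (sp (fun i => \sum_j A i j * h j)) => xy.
  rewrite -[RHS](h0 xy); under [RHS]eq_bigr => j _ do rewrite qA mulr_suml.
  rewrite exchange_big; apply: eq_bigr => i' _ /=; rewrite mulr_sumr.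
  by apply: eq_bigr => j _; rewrite mulrA.
have AtA : A^T *m A = 1%:M by apply: mulmx1C.
move=> j; pose hc := \col_j h j.
have : A^T *m (A *m hc) = hc by rewrite mulmxA AtA mul1mx.
have -> : A *m hc = 0.
  by apply/matrixP=> i k; rewrite !mxE -[RHS](Ah i); apply: eq_bigr => j' _; rewrite !mxE.
by rewrite mulmx0 => /matrixP/(_ j 0); rewrite !mxE.
Qed.

Lemma congr_pinned e p q (J : finType) (phi : J -> V -> 'I_d -> F) :
  spans p -> (forall x y, dist2 q x y = dist2 p x y) -> pinned_at [set: V] e p phi ->
  exists phi' : J -> V -> 'I_d -> F, pinned_at [set: V] e q phi'.
Proof.
move=> sp qp pin; have [A [AA qA]] := congr_orthogonal sp qp.
have AtA : A^T *m A = 1%:M by apply: mulmx1C.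
exists (fun j x l => \sum_i phi j x i * A i l) => m [mA mE] mP.
pose m' x i := \sum_l A i l * m x l.
have m'0 : forall x i, m' x i = 0.
  apply: pin => [|j].
    split=> [x i|x y xV yV exy]; first by rewrite inE.
    rewrite -[RHS](mE x y xV yV exy); under [RHS]eq_bigr => l _ do rewrite qA mulr_suml.
    rewrite exchange_big; apply: eq_bigr => i _ /=.
    rewrite /m' -sumrB mulr_sumr; apply: eq_bigr => l _; ring.
  rewrite -[RHS](mP j); apply: eq_bigr => x _.
  under [RHS]eq_bigr => l _ do rewrite mulr_suml.
  rewrite exchange_big; apply: eq_bigr => i _ /=.
  by rewrite /m' mulr_sumr; apply: eq_bigr => l _; rewrite mulrA.
move=> x l; pose mc := \col_l m x l.
have : A^T *m (A *m mc) = mc by rewrite mulmxA AtA mul1mx.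
have -> : A *m mc = 0.
  by apply/matrixP=> i k; rewrite !mxE -[RHS](m'0 x i); apply: eq_bigr => j' _; rewrite !mxE.
by rewrite mulmx0 => /matrixP/(_ l 0); rewrite !mxE.
Qed.

End Congruence.

End GenericRigidity.

Section RealFrameworks.
Local Open Scope classical_set_scope.
Local Open Scope ring_scope.

(** * Continuous motions of a pinned framework *)

Section Motions.
Variable R : realType.

(** Extends a motion to the whole line, so that continuity and connectedness are used on [R] itself
    and not on a subspace. *)
Definition clamp (t : R) : R := Num.max 0 (Num.min 1 t).

Lemma clamp_itv t : 0 <= clamp t <= 1.
Proof.
rewrite /clamp le_max lexx /= ge_max ler01 /= ge_min lexx //.
Qed.

Lemma clamp_id t : 0 <= t <= 1 -> clamp t = t.
Proof. by move=> /andP[t0 t1]; rewrite /clamp (min_idPr t1) (max_idPr t0). Qed.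

Lemma clamp_continuous : continuous clamp.
Proof.
have -> : clamp = (cst 0 : R -> R^o) \max ((cst 1 : R -> R^o) \min id) by [].
move=> t; apply: continuous_max; first exact: cst_continuous.
by apply: continuous_min; [exact: cst_continuous|exact: cvg_id].
Qed.

Lemma continuous_clamp (f : R -> R) :
  {within `[0, 1]%classic, continuous f} -> continuous (f \o clamp).
Proof.
move=> /subspace_continuousP cf t.
have At s : `[0, 1]%classic (clamp s) by rewrite /= in_itv /= clamp_itv.
have := cf (clamp t) (At t) => cft W /cft /= h.
have : nbhs t (clamp @^-1` [set z | `[0, 1]%classic z -> W (f z)]) by apply: clamp_continuous.
apply: filterS => s /= hs.
by apply: hs; have := At s; rewrite /=.
Qed.

Section Path.
Variables (V : finType) (d : nat) (e : rel V) (x : R -> V -> 'I_d -> R).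
Hypothesis cx : forall v i, continuous (fun t => x t v i).

Let cD (f g : R -> R) : continuous f -> continuous g -> continuous (fun t => f t + g t).
Proof. by move=> cf cg t; apply: cvgD; [apply: cf|apply: cg]. Qed.
Let cM (f g : R -> R) : continuous f -> continuous g -> continuous (fun t => f t * g t).
Proof. by move=> cf cg t; apply: cvgM; [apply: cf|apply: cg]. Qed.
Let cN (f : R -> R) : continuous f -> continuous (fun t => - f t).
Proof. by move=> cf t; apply: cvgN; apply: cf. Qed.
Let cc (a : R) : continuous (fun _ : R => a).
Proof. exact: cst_continuous. Qed.

Let cS (A : Type) (r : seq A) (F : A -> R -> R) :
  (forall a, continuous (F a)) -> continuous (fun t => \sum_(a <- r) F a t).
Proof. by apply: (sum_closed (P := fun f : R -> R => continuous f)). Qed.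

Hypothesis fix_e : forall t u v, e u v -> dist2 (x t) u v = dist2 (x 0) u v.

Lemma path_congruent (J : finType) (phi : J -> V -> 'I_d -> R) :
  spans (x 0) -> #|J| = 'C(d.+1, 2) -> pinned_at [set: V]%SET e (x 0) phi ->
  forall t u v, dist2 (x t) u v = dist2 (x 0) u v.
Proof.
move=> sp cJ pin.
have c2 u v : continuous (fun t => dist2 (x t) u v).
  by apply: cS => i; apply: cM; apply: cD => //; apply: cN.
pose g t := \sum_(u : V) \sum_(v : V) (dist2 (x t) u v - dist2 (x 0) u v) ^+ 2.
have gP t : g t = 0 <-> forall u v, dist2 (x t) u v = dist2 (x 0) u v.
  split=> [/psumr_eq0P g0 u v|h]; last first.
    by rewrite /g big1 // => u _; rewrite big1 // => v _; rewrite h subrr expr0n.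
  have /psumr_eq0P gu : \sum_(v : V) (dist2 (x t) u v - dist2 (x 0) u v) ^+ 2 = 0.
    by apply: g0 => // w _; apply: sumr_ge0 => z _; apply: sqr_ge0.
  have /eqP : (dist2 (x t) u v - dist2 (x 0) u v) ^+ 2 = 0 by apply: gu => // z _; apply: sqr_ge0.
  by rewrite sqrf_eq0 subr_eq0 => /eqP.
have cg : continuous g.
  apply: cS => u; apply: cS => v.
  by apply: cM; apply: cD.
pose C : set R := [set t | g t = 0]%classic.
have CT : C = setT.
  have conT : connected [set: R] by apply/connected_intervalP.
  apply: conT; first by exists 0; apply/gP.
    exists C; last by rewrite setTI.
    rewrite openE => t0 /gP gt0; rewrite /interior /=.
    have sp0 : spans (x t0) by apply: congr_spans sp gt0.
    have [phi' pin'] := congr_pinned sp gt0 pin.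
    (* As a difference of squares is sum times difference, [x t - x t0] is a flex of this midpoint.
       At [t0] the midpoint is [x t0], so both Gram determinants stay nonzero nearby. *)
    pose c t v i := (x t v i + x t0 v i) / 2.
    have ct0 : c t0 = x t0 by apply/funext => v; apply/funext => i; rewrite /c; field.
    have cc' v i : continuous (fun t => c t v i) by apply: cM => //; apply: cD.
    pose D1 t := \det (gram (pin_mx e (c t) phi')).
    have cD1 : continuous D1.
      by apply: (@pin_mx_closed V d e R R (fun f : R -> R => continuous f)).
    have D1n : D1 t0 != 0 by apply/gram_inj/pin_mxP; rewrite ct0.
    pose D2 t := \det (gram (fun (xy : V * V) i => c t xy.1 i - c t xy.2 i)).
    have cD2 : continuous D2.
      apply: (gram_closed (P := fun f : R -> R => continuous f)) => // xy i.
      by apply: cD => //; apply: cN.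
    have D2n : D2 t0 != 0 by apply/gram_inj; rewrite ct0.
    have n1 := cvgr_neq0 (D1 t0) (cD1 t0) D1n.
    have n2 := cvgr_neq0 (D2 t0) (cD2 t0) D2n.
    near=> t; apply/gP => u v.
    have h1 : D1 t != 0 by near: t; exact: n1.
    have h2 : D2 t != 0 by near: t; exact: n2.
    move: h1 h2 => /gram_inj/pin_mxP pc /gram_inj sc.
    have E w z : \sum_i (c t w i - c t z i) * ((x t w i - x t0 w i) - (x t z i - x t0 z i)) =
       (dist2 (x t) w z - dist2 (x t0) w z) / 2.
      by rewrite /dist2 -sumrB mulr_suml; apply: eq_bigr => i _; rewrite /c; field.
    have := pinned_flex_trivial (m := fun v i => x t v i - x t0 v i) sc cJ pc.
    move=> /(_ _ u v); rewrite E => h; apply/eqP; rewrite -subr_eq0 -gt0.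
    have /eqP : (dist2 (x t) u v - dist2 (x t0) u v) / 2 = 0.
      by apply: h => w z ewz; rewrite E !fix_e // subrr mul0r.
    by rewrite mulf_eq0 invr_eq0 pnatr_eq0 orbF.
  exists C; last by rewrite setTI.
  rewrite (_ : C = g @^-1` [set 0])%classic //.
  by apply: preimage_closed => [t _|]; [exact: cg|exact: closed_eq].
by move=> t; apply/gP; have : C t by rewrite CT.
Unshelve. all: by end_near. Qed.

End Path.
End Motions.

Lemma generic_spans (R : realType) (n d : nat) (p : 'I_n -> 'I_d -> R) :
  (d < n)%N -> alg_indep (fun u : 'I_n * 'I_d => p u.1 u.2) -> spans p.
Proof.
move=> dn indep; apply/gram_inj.
pose f (c : 'I_n * 'I_d -> R) :=
  \det (gram (fun (xy : 'I_n * 'I_n) i => c (xy.1, i) - c (xy.2, i))).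
have rf : qpolyfun f.
  by apply: qpolyfun_gram => xy i; apply: qpolyfunB; apply: qpolyfun_var.
(* Vertex 0 at the origin, vertex [i + 1] at the [i]-th basis vector. *)
pose p0 (u : 'I_n * 'I_d) : R := (u.1 == u.2.+1 :> nat)%:R.
have fp0 : f p0 != 0.
  apply/gram_inj => h h0 i.
  have ltx : (i.+1 < n)%N by apply: leq_ltn_trans dn.
  have lt0 : (0 < n)%N by apply: leq_ltn_trans dn.
  rewrite -[RHS](h0 (Ordinal ltx, Ordinal lt0)) (bigD1 i) //= big1 => [|j /negPf ji].
    by rewrite /p0 /= eqxx subr0 mul1r addr0.
  have ij : (i == j :> nat) = false by rewrite eq_sym; exact: ji.
  by rewrite /p0 /= eqSS ij subrr mul0r.
by apply: contraNneq fp0 => f0; apply/eqP; apply: qpolyfun_generic indep rf _.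
Qed.

Lemma generic_rigid (R : realType) (n d D : nat) (e : rel 'I_n) (p : 'I_n -> 'rV[R]_d) :
  symmetric e -> irreflexive e -> (forall z, D <= #|[set w | e z w]%SET|)%N ->
  (n + d <= 2 * D + 2)%N -> (29 * d <= n)%N -> (0 < d)%N ->
  alg_indep (fun u : 'I_n * 'I_d => p u.1 ord0 u.2) ->
  forall x : R -> 'I_n -> 'rV[R]_d,
  (forall v k, {within `[0%R, 1%R], continuous (fun t : R => x t v ord0 k)}) -> x 0 = p ->
  (forall t, 0 <= t <= 1 -> forall u v, e u v ->
     Num.sqrt (\sum_(k < d) (x t u ord0 k - x t v ord0 k) ^+ 2) =
     Num.sqrt (\sum_(k < d) (p u ord0 k - p v ord0 k) ^+ 2)) ->
  forall t, 0 <= t <= 1 -> forall u v,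
     Num.sqrt (\sum_(k < d) (x t u ord0 k - x t v ord0 k) ^+ 2) =
     Num.sqrt (\sum_(k < d) (p u ord0 k - p v ord0 k) ^+ 2).
Proof.
move=> se irr degD HD Hn d0 indep x mx x0 xe t t01 u v.
have pin0 : pinned rat d [set: 'I_n]%SET e 'C(d.+1, 2).
  by apply: (@pinned_mindeg rat _ e d D) => //; rewrite card_ord.
have [J [phi [cJ pin]]] := generic_pinned (p := fun v i => p v ord0 i) indep pin0.
have sp : spans (fun v i => p v ord0 i) by apply: generic_spans indep; lia.
pose X t v i := x (clamp t) v ord0 i.
have X0 : X 0 = (fun v i => p v ord0 i) by rewrite /X clamp_id ?lexx ?ler01 // x0.
have cX w i : continuous (fun s => X s w i).
  exact: (@continuous_clamp R (fun t => x t w ord0 i)).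
have sq (y : 'I_n -> 'rV[R]_d) w' z' : 0 <= \sum_(k < d) (y w' ord0 k - y z' ord0 k) ^+ 2.
  by apply: sumr_ge0 => k _; apply: sqr_ge0.
have fixX s w z : e w z -> dist2 (X s) w z = dist2 (X 0) w z.
  move=> ewz; rewrite X0; have := xe (clamp s) (clamp_itv s) w z ewz.
  by move=> /(congr1 (fun a => a ^+ 2)); rewrite !sqr_sqrtr.
rewrite -X0 in sp pin.
have := path_congruent cX fixX sp cJ pin t u v.
by rewrite X0 /dist2 /X (clamp_id t01) => ->.
Qed.

Lemma min_degree_le (V : finType) (e : rel V) (z : V) : (min_degree e <= degree e z)%N.
Proof.
rewrite /min_degree; have : z \in index_enum V by rewrite mem_index_enum.
elim: (index_enum V) => // v s IH; rewrite in_cons big_cons => /orP[/eqP ->|/IH h].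
  exact: geq_minl.
exact: leq_trans (geq_minr _ _) h.
Qed.

(** [(n + d - 1) %/ 2] is the ceiling of [(n + d - 2) / 2], so [n + d] is at most twice it plus
    2. *)
Lemma mindeg_sufficient (n d : nat) : (0 < d)%N -> (29 * d <= n)%N ->
  mindeg_forces_rigid n d ((n + d - 1) %/ 2).
Proof.
move=> d0 Hn e [se irr] mind.
have [y yP] := exists_alg_indep Rdefinitions.R ('I_n * 'I_d)%type.
exists (fun v => \row_i y (v, i)).
have gp : generic (fun v : 'I_n => \row_i y (v, i)).
  rewrite /generic (_ : (fun ik => _) = y) //; apply/funext => -[v i]; exact: mxE.
split=> //; apply: (@generic_rigid Rdefinitions.R n d ((n + d - 1) %/ 2)) => // [z|]; last by lia.
apply: leq_trans mind _; apply: leq_trans (_ : degree e z <= _)%N.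
  exact: min_degree_le.
apply: eq_leq; apply: eq_card => w; rewrite [RHS]inE. by apply/asboolP/idP.
Qed.

(** * The lower bound *)

Section Rotation.
Variables (R : realType) (d : nat).
Implicit Types x y z w : 'I_d -> R.

Definition dot x y := \sum_i x i * y i.

Lemma dotC x y : dot x y = dot y x.
Proof. by apply: eq_bigr => i _; rewrite mulrC. Qed.

Lemma dot_comb x y z a b : dot x (fun i => a * y i + b * z i) = a * dot x y + b * dot x z.
Proof. by rewrite /dot !mulr_sumr -big_split; apply: eq_bigr => i _ /=; ring. Qed.

Lemma dotBl x y z : dot (fun i => x i - y i) z = dot x z - dot y z.
Proof. by rewrite /dot -sumrB; apply: eq_bigr => i _; rewrite mulrBl. Qed.

Lemma dot_ge0 x : 0 <= dot x x.
Proof. by apply: sumr_ge0 => i _; apply: sqr_ge0. Qed.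

Lemma dot_gt0 x y : dot x y != 0 -> 0 < dot y y.
Proof.
move=> xy; rewrite lt_def dot_ge0 andbT; apply: contraNneq xy => /psumr_eq0P y0.
rewrite /dot big1 // => i _; have /eqP : y i * y i = 0 by apply: y0 => // j _; apply: sqr_ge0.
by rewrite mulf_eq0 orbb => /eqP ->; rewrite mulr0.
Qed.

Lemma norm_comb x w1 w2 a b : dot w1 w1 = 1 -> dot w2 w2 = 1 -> dot w1 w2 = 0 ->
  \sum_i (x i + (a * w1 i + b * w2 i)) ^+ 2 =
    \sum_i x i ^+ 2 + (a ^+ 2 + b ^+ 2) + 2 * (a * dot x w1 + b * dot x w2).
Proof.
move=> w11 w22 w12.
have -> : a ^+ 2 + b ^+ 2 = a ^+ 2 * dot w1 w1 + b ^+ 2 * dot w2 w2 + 2 * a * b * dot w1 w2.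
  by rewrite w11 w22 w12; ring.
rewrite /dot !mulr_sumr -!big_split /= mulr_sumr -!big_split /=.
by apply: eq_bigr => i _; ring.
Qed.

(** Rational parametrization of the circle by the tangent of the half angle: no rotation at 0, a
    quarter turn at 1. *)
Definition rcos (t : R) := (1 - t ^+ 2) / (1 + t ^+ 2).
Definition rsin (t : R) := 2 * t / (1 + t ^+ 2).

Lemma one_add_sqr_neq0 (t : R) : 1 + t ^+ 2 != 0.
Proof. by rewrite gt_eqF // ltr_wpDr ?sqr_ge0. Qed.

Lemma rcos_rsin t : rcos t ^+ 2 + rsin t ^+ 2 = 1.
Proof. by rewrite /rcos /rsin; field; apply: one_add_sqr_neq0. Qed.

Lemma rcos_continuous : continuous rcos.
Proof.
move=> t; apply: cvgM; first by apply: cvgB; [exact: cvg_cst|exact: exprn_continuous].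
apply: cvgV; first exact: one_add_sqr_neq0.
by apply: cvgD; [exact: cvg_cst|exact: exprn_continuous].
Qed.

Lemma rsin_continuous : continuous rsin.
Proof.
move=> t; apply: cvgM; first by apply: cvgM; [exact: cvg_cst|exact: cvg_id].
apply: cvgV; first exact: one_add_sqr_neq0.
by apply: cvgD; [exact: cvg_cst|exact: exprn_continuous].
Qed.

(** Stated for isometries of the whole space, so that one [g] carries an entire clique and the
    shared vertices need only satisfy [fixed]. *)
Definition flexing (fixed : ('I_d -> R) -> Prop) u w : Prop :=
  exists g : R -> ('I_d -> R) -> 'I_d -> R,
  [/\ forall x i, continuous (fun t => g t x i), forall x, g 0 x = x,
    forall t x x', \sum_i (g t x i - g t x' i) ^+ 2 = \sum_i (x i - x' i) ^+ 2,
    forall t x, fixed x -> g t x = x &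
    exists2 t, 0 <= t <= 1 & \sum_i (u i - g t w i) ^+ 2 != \sum_i (u i - w i) ^+ 2].

(** Gram-Schmidt on [y], [z] yields an orthonormal basis [w1], [w2] of their plane; [g] rotates this
    plane about the affine subspace through [s0] orthogonal to it. *)
Lemma flexing_rotation s0 u w y z (dt := fun x v => dot (fun i => x i - s0 i) v) :
  dt u y = 1 -> dt w y = 0 -> dt u z = 0 -> dt w z = 1 ->
  flexing (fun x => dt x y = 0 /\ dt x z = 0) u w.
Proof.
move=> uy wy uz wz.
have yy : 0 < dot y y by apply: (@dot_gt0 (fun i => u i - s0 i)); rewrite -/(dt u y) uy oner_eq0.
set ny := Num.sqrt (dot y y); have ny0 : 0 < ny by rewrite sqrtr_gt0.
have nyE : ny ^+ 2 = dot y y by rewrite sqr_sqrtr // ltW.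
pose w1 i := ny^-1 * y i + 0 * y i; pose k := dot z w1.
pose z' i := 1 * z i + - k * w1 i.
have dw1 x : dot x w1 = dot x y / ny by rewrite dot_comb mul0r addr0 mulrC.
have w11 : dot w1 w1 = 1.
  by rewrite dw1 dotC dw1 -nyE; field; rewrite gt_eqF.
have dz' x : dot x z' = dot x z - k * dot x w1 by rewrite dot_comb mul1r mulNr.
have zz : 0 < dot z' z'.
  apply: (@dot_gt0 (fun i => w i - s0 i)); rewrite dz' dw1 -!/(dt w _) wz wy mul0r mulr0 subr0.
  exact: oner_neq0.
set nz := Num.sqrt (dot z' z'); have nz0 : 0 < nz by rewrite sqrtr_gt0.
have nzE : nz ^+ 2 = dot z' z' by rewrite sqr_sqrtr // ltW.
pose w2 i := nz^-1 * z' i + 0 * z' i.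
have dw2 x : dot x w2 = dot x z' / nz by rewrite dot_comb mul0r addr0 mulrC.
have w22 : dot w2 w2 = 1.
  by rewrite dw2 dotC dw2 -nzE; field; rewrite gt_eqF.
have w12 : dot w1 w2 = 0.
  by rewrite dw2 dz' w11 mulr1 /k dotC subrr mul0r.
pose lin a b t := (rcos t - 1) * a + rsin t * b.
have clin a b : continuous (lin a b).
  move=> t; apply: cvgD; apply: cvgM; try exact: cvg_cst; last exact: rsin_continuous.
  by apply: cvgB; [exact: rcos_continuous|exact: cvg_cst].
have lin0 a b : lin a b 0 = 0 by rewrite /lin /rcos /rsin expr0n /=; field.
pose al x := lin (dt x w1) (- dt x w2); pose be x := lin (dt x w2) (dt x w1).
pose g t x i := x i + (al x t * w1 i + be x t * w2 i).
exists g; split.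
- move=> x i t; apply: cvgD; first exact: cvg_cst.
  by apply: cvgD; apply: cvgM; try exact: cvg_cst; exact: clin.
- by move=> x; apply/funext => i; rewrite /g /al /be !lin0 !mul0r !addr0.
- move=> t x x'; have cs := rcos_rsin t.
  set D1 := dot (fun i => x i - x' i) w1; set D2 := dot (fun i => x i - x' i) w2.
  transitivity (\sum_i ((x i - x' i) + (lin D1 (- D2) t * w1 i + lin D2 D1 t * w2 i)) ^+ 2).
    apply: eq_bigr => i _; congr (_ ^+ 2); rewrite /g /al /be /lin /D1 /D2 /dt !dotBl; ring.
  rewrite norm_comb // -/D1 -/D2 -addrA -[RHS]addr0; congr (_ + _); rewrite /lin.
  transitivity ((D1 ^+ 2 + D2 ^+ 2) * (rcos t ^+ 2 + rsin t ^+ 2 - 1)); first by ring.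
  by rewrite cs subrr mulr0.
- move=> t x [xy xz]; have x1 : dt x w1 = 0 by rewrite /dt dw1 -/(dt x y) xy mul0r.
  have x2 : dt x w2 = 0 by rewrite /dt dw2 dz' -/(dt x z) -/(dt x w1) xz x1 mulr0 subrr mul0r.
  by apply/funext => i; rewrite /g /al /be /lin x1 x2 oppr0 !mulr0 !addr0 !mul0r !addr0.
have u1 : dt u w1 = ny^-1 by rewrite /dt dw1 -/(dt u y) uy mul1r.
have ww1 : dt w w1 = 0 by rewrite /dt dw1 -/(dt w y) wy mul0r.
have ww2 : dt w w2 = nz^-1 by rewrite /dt dw2 dz' -/(dt w z) -/(dt w w1) ww1 wz mulr0 subr0 mul1r.
have gE t : \sum_i (u i - g t w i) ^+ 2 = \sum_i (u i - w i) ^+ 2 +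
    2 * nz^-1 * (rsin t * ny^-1 - (rcos t - 1) * dt u w2).
  transitivity (\sum_i ((u i - w i) + (- al w t * w1 i + - be w t * w2 i)) ^+ 2).
    by apply: eq_bigr => i _; congr (_ ^+ 2); rewrite /g; ring.
  rewrite norm_comb // -addrA; congr (_ + _).
  have E v : dot (fun i => u i - w i) v = dt u v - dt w v by rewrite /dt !dotBl; ring.
  rewrite !E /al /be /lin u1 ww1 ww2; move: (dt u w2) (rcos_rsin t) => D; set S := rsin t; set T := rcos t.
  move=> cs; have -> : 2 * nz^-1 * (S * ny^-1 - (T - 1) * D) =
    2 * nz^-1 * (S * ny^-1 - (T - 1) * D) + (T ^+ 2 + S ^+ 2 - 1) * nz^-1 ^+ 2 by rewrite cs subrr mul0r addr0.
  ring.
have ex (t : R) : 0 <= t <= 1 -> rsin t * ny^-1 - (rcos t - 1) * dt u w2 != 0 ->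
    exists2 t, 0 <= t <= 1 & \sum_i (u i - g t w i) ^+ 2 != \sum_i (u i - w i) ^+ 2.
  move=> t01 ne; exists t => //; rewrite gE -subr_eq0 addrAC subrr add0r !mulf_neq0 ?pnatr_eq0 //.
  by rewrite invr_eq0 gt_eqF.
have nyi : ny^-1 != 0 by rewrite invr_eq0 gt_eqF.
(* With [m = ny^-1] and [D = dt u w2], an unchanged distance means [m + D = 0] at [t = 1] and
   [2 * m + D = 0] at [t = 1/2]; both would force [m = 0]. *)
case: (eqVneq (rsin 1 * ny^-1 - (rcos 1 - 1) * dt u w2) 0) => [E1|]; last first.
  by apply: ex; rewrite ler01 lexx.
apply: (ex (1 / 2)); first by lra.
apply: contra_neq nyi => E2; move: E1 E2; rewrite /rsin /rcos.
set D := dt u w2; set m := ny^-1 => E1 E2.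
have -> : m = (2 * (2 / 1) * ((1 + (1 / 2) ^+ 2) * (1 / 2) * ((2 * (1 / 2) / (1 + (1 / 2) ^+ 2)) * m - ((1 - (1 / 2) ^+ 2) / (1 + (1 / 2) ^+ 2) - 1) * D))) - ((2 * 1 / (1 + 1 ^+ 2)) * m - ((1 - 1 ^+ 2) / (1 + 1 ^+ 2) - 1) * D) by field.
by rewrite E1 E2 !mulr0 subrr.
Qed.

End Rotation.

(** Serves dimension one, where the cliques share no vertex and there is nothing to fix. *)
Lemma flexing_translation (R : realType) (d : nat) (u w : 'I_d -> R) : (0 < d)%N ->
  flexing (fun=> False) u w.
Proof.
move=> d0; exists (fun t x i => x i + t); split=> //.
- by move=> x i t; apply: cvgD; [exact: cvg_cst|exact: cvg_id].
- by move=> x; apply/funext => i; rewrite addr0.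
- by move=> t x x'; apply: eq_bigr => i _; congr (_ ^+ 2); ring.
have E (t : R) : \sum_i (u i - (w i + t)) ^+ 2 =
    \sum_i (u i - w i) ^+ 2 + (t ^+ 2 * d%:R - 2 * t * \sum_i (u i - w i)).
  rewrite mulr_sumr -[d in d%:R]card_ord -sumr_const mulr_sumr -sumrB -big_split.
  by apply: eq_bigr => i _ /=; ring.
set S := \sum_i (u i - w i) in E.
have ex (t : R) : 0 <= t <= 1 -> t ^+ 2 * d%:R - 2 * t * S != 0 ->
    exists2 t, 0 <= t <= 1 & \sum_i (u i - (w i + t)) ^+ 2 != \sum_i (u i - w i) ^+ 2.
  by move=> t01 ne; exists t => //; rewrite E -subr_eq0 addrAC subrr add0r.
case: (eqVneq (1 ^+ 2 * d%:R - 2 * 1 * S) 0) => [E1|]; last first.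
  by apply: ex; rewrite ler01 lexx.
apply: (ex (1 / 2)); first by lra.
have dn : d%:R != 0 :> R by rewrite pnatr_eq0 -lt0n.
apply: contra_neq dn => E2; move: E1 E2; lra.
Qed.

(** For [d >= 2], the ends [v0], [v1], the base point [K - 1] and the other [d - 2] shared vertices
    [K - i] are generically affinely independent. The dual basis gives affine coordinates; those
    along [v0] and [v1] vanish at every shared vertex. *)
Lemma generic_flexing (R : realType) (n d K : nat) (p : 'I_n -> 'I_d -> R) (v0 v1 : 'I_n) :
  (0 < d)%N -> (d <= K)%N -> (K < n)%N -> v0 = 0%N :> nat -> v1 = n.-1 :> nat ->
  alg_indep (fun u : 'I_n * 'I_d => p u.1 u.2) ->
  exists2 fixed, flexing fixed (p v0) (p v1) &
    forall v : 'I_n, (K <= v + (d - 1))%N -> (v < K)%N -> fixed (p v).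
Proof.
move=> d0 dK Kn Ev0 Ev1 indep.
have [d2|d1] := ltnP 1 d; last first.
  exists (fun=> False); first exact: flexing_translation.
  move=> v h1 h2; suff : false by []; lia.
have K0 : (K.-1 < n)%N by lia.
pose s0 := Ordinal K0.
have rho_lt i : (i < d)%N -> ((if i == 0%N then 0 else if i == 1%N then n.-1 else K - i) < n)%N.
  by move=> _; case: ifP => _; [|case: ifP => _]; lia.
pose rho (i : 'I_d) : 'I_n := Ordinal (rho_lt i (ltn_ord i)).
have rho_inj i j : rho i = rho j -> i = j.
  move=> /(congr1 val) /= E; apply: val_inj => /=; move: (ltn_ord i) (ltn_ord j) E.
  by case: (i =P 0%N :> nat) => i0; case: (i =P 1%N :> nat) => i1; case: (j =P 0%N :> nat) => j0;
    case: (j =P 1%N :> nat) => j1; lia.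
have rho_s0 i : rho i != s0.
  rewrite -val_eqE /=; move: (ltn_ord i).
  by case: (i =P 0%N :> nat) => i0; case: (i =P 1%N :> nat) => i1; lia.
pose M (c : 'I_n * 'I_d -> R) : 'M[R]_d := \matrix_(i, j) (c (rho i, j) - c (s0, j)).
have rM : qpolyfun (fun c => \det (M c)).
  apply: (det_closed (P := @qpolyfun R _)).
  - exact: qpolyfun_nat.
  - exact: qpolyfunN.
  - exact: qpolyfunD.
  - exact: qpolyfunM.
  move=> i j; rewrite (_ : (fun c => _) = fun c => c (rho i, j) - c (s0, j)).
    by apply: qpolyfunB; apply: qpolyfun_var.
  by apply/funext => c; rewrite mxE.
(* With [s0] at the origin and [rho i] at the [i]-th basis vector the matrix is the identity. *)
pose c0 (u : 'I_n * 'I_d) : R := (u.1 == rho u.2)%:R.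
have Mc0 : \det (M c0) = 1.
  rewrite (_ : M c0 = 1%:M) ?det1 //; apply/matrixP => i j; rewrite !mxE /c0 /=.
  rewrite [s0 == _]eq_sym (negPf (rho_s0 j)) subr0; congr (_%:R); congr nat_of_bool.
  by apply/eqP/eqP => [/rho_inj|->].
set Mp := M (fun u => p u.1 u.2).
have unitM : Mp \in unitmx.
  rewrite unitmxE unitfE; apply/negP => /eqP M0.
  by have := qpolyfun_generic c0 indep rM M0; rewrite Mc0 => /eqP; rewrite oner_eq0.
pose dual (k : 'I_d) (j : 'I_d) := invmx Mp j k.
have dualE i k : dot (fun j => p (rho i) j - p s0 j) (dual k) = (i == k)%:R.
  have := congr1 (fun A : 'M[R]_d => A i k) (mulmxV unitM); rewrite !mxE => <-.
  by apply: eq_bigr => j _; rewrite mxE.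
pose i0 := Ordinal d0; pose i1 := Ordinal d2.
have Ei0 : rho i0 = v0 by apply: val_inj; rewrite /= Ev0.
have Ei1 : rho i1 = v1 by apply: val_inj; rewrite /= Ev1.
have fl := @flexing_rotation R d (p s0) (p (rho i0)) (p (rho i1)) (dual i0) (dual i1)
  (dualE i0 i0) (dualE i1 i0) (dualE i0 i1) (dualE i1 i1).
rewrite Ei0 Ei1 in fl.
exists (fun x => dot (fun i => x i - p s0 i) (dual i0) = 0 /\ dot (fun i => x i - p s0 i) (dual i1) = 0).
  exact: fl.
move=> v Kv vK; case: (eqVneq v s0) => [->|vs0].
  by split; rewrite /dot big1 // => i _; rewrite subrr mul0r.
have vs : v != K.-1 :> nat by rewrite -(inj_eq val_inj) in vs0.
have ltd : (K - v < d)%N by lia.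
have Ev : rho (Ordinal ltd) = v.
  apply: val_inj => /=; case: (K - v =P 0)%N => e0; case: (K - v =P 1)%N => e1; lia.
by rewrite -Ev !dualE; split; rewrite -[RHS](mulr0n 1); congr (_%:R);
  apply/eqP; rewrite eqb0 -val_eqE /=; lia.
Qed.

Definition two_cliques (n d K : nat) : rel 'I_n := fun u v =>
  (u != v) && ((u < K) && (v < K) || (K <= u + (d - 1)) && (K <= v + (d - 1)))%N.

Lemma two_cliques_flexible (R : realType) (n d K : nat) (p : 'I_n -> 'rV[R]_d) :
  (0 < d)%N -> (d <= K)%N -> (K < n)%N ->
  alg_indep (fun u : 'I_n * 'I_d => p u.1 ord0 u.2) ->
  ~ forall x : R -> 'I_n -> 'rV[R]_d,
  (forall v k, {within `[0%R, 1%R], continuous (fun t : R => x t v ord0 k)}) -> x 0 = p ->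
  (forall t, 0 <= t <= 1 -> forall u v, two_cliques d K u v ->
     Num.sqrt (\sum_(k < d) (x t u ord0 k - x t v ord0 k) ^+ 2) =
     Num.sqrt (\sum_(k < d) (p u ord0 k - p v ord0 k) ^+ 2)) ->
  forall t, 0 <= t <= 1 -> forall u v,
     Num.sqrt (\sum_(k < d) (x t u ord0 k - x t v ord0 k) ^+ 2) =
     Num.sqrt (\sum_(k < d) (p u ord0 k - p v ord0 k) ^+ 2).
Proof.
move=> d0 dK Kn indep rig.
have n0 : (0 < n)%N by lia.
have n1 : (n.-1 < n)%N by lia.
have [fixed [g [cg g0 giso gfix [t1 t01 neq]]] fP] :=
  generic_flexing (p := fun v i => p v ord0 i) (v0 := Ordinal n0) (v1 := Ordinal n1) d0 dK Kn erefl erefl indep.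
pose q v : 'I_d -> R := fun i => p v ord0 i.
pose x t (v : 'I_n) : 'rV[R]_d := if (v < K)%N then p v else \row_i g t (q v) i.
have xA t (v : 'I_n) i : (v < K)%N -> x t v ord0 i = q v i by rewrite /x => ->.
have xB t (v : 'I_n) i : (K <= v + (d - 1))%N -> x t v ord0 i = g t (q v) i.
  rewrite /x; case: ltnP => vK Kv; last by rewrite mxE.
  by rewrite gfix //; apply: fP.
have sq (y z : 'I_d -> R) : 0 <= \sum_(k < d) (y k - z k) ^+ 2.
  by apply: sumr_ge0 => k _; apply: sqr_ge0.
have := rig x _ _ _ t1 t01 (Ordinal n0) (Ordinal n1).
have -> : Num.sqrt (\sum_(k < d) (x t1 (Ordinal n0) ord0 k - x t1 (Ordinal n1) ord0 k) ^+ 2) =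
    Num.sqrt (\sum_k (q (Ordinal n0) k - g t1 (q (Ordinal n1)) k) ^+ 2).
  by congr Num.sqrt; apply: eq_bigr => k _; rewrite xA ?xB //=; lia.
move=> h; move/negP: neq; apply; apply/eqP; rewrite -[LHS]sqr_sqrtr ?sq // -[RHS]sqr_sqrtr ?sq //.
congr (_ ^+ 2); apply: h.
- move=> v k; apply: continuous_subspaceT => t.
  rewrite /x; case: (v < K)%N; first exact: cvg_cst.
  have := cg (q v) k t; set f := fun t => g t _ _; set f' := fun t => _.
  by rewrite (_ : f' = f) //; apply/funext => s; rewrite /f' mxE.
- apply/funext => v; apply/matrixP => i k; rewrite ord1 /x; case: ifP => // _.
  by rewrite mxE g0.
- move=> t _ u v /andP[_ /orP[/andP[uK vK]|/andP[uK vK]]]; congr Num.sqrt.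
    by apply: eq_bigr => k _; rewrite !xA.
  rewrite -[RHS](giso t (q u) (q v)); by apply: eq_bigr => k _; rewrite !xB.
Qed.

Lemma card_ord_lt (n K : nat) : (K <= n)%N -> #|[set u : 'I_n | (u < K)%N]%SET| = K.
Proof.
move=> Kn; rewrite -[RHS]card_ord.
have -> : [set u : 'I_n | (u < K)%N]%SET = [set widen_ord Kn i | i : 'I_K]%SET.
  apply/setP => u; rewrite inE; apply/idP/imsetP => [uK|[i _ ->]]; last exact: (ltn_ord i).
  by exists (Ordinal uK) => //; apply: val_inj.
by rewrite card_imset // => a b /(congr1 val) /= /val_inj.
Qed.

(** Vertices outside the first clique have degree [n - K + d - 2], which is at least [K - 1] exactly
    when [2 * K + 1 <= n + d]. *)
Lemma degree_two_cliques (n d K : nat) (v : 'I_n) : (0 < d)%N -> (d <= K)%N -> (2 * K + 1 <= n + d)%N ->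
  (K < n)%N -> (K - 1 <= degree (two_cliques d K) v)%N.
Proof.
move=> d0 dK HK Kn.
have -> : degree (two_cliques d K) v = #|[set u | two_cliques d K v u]%SET|.
  by apply: eq_card => w; rewrite [RHS]inE; apply/asboolP/idP.
have [vK|Kv] := ltnP v K.
  have := cardsD1 v [set u : 'I_n | (u < K)%N]%SET; rewrite inE vK card_ord_lt ?(ltnW Kn) // => E.
  apply: leq_trans (_ : #|([set u : 'I_n | (u < K)%N] :\ v)%SET| <= _)%N; first by move: E => /=; lia.
  apply: subset_leq_card; apply/fintype.subsetP => u.
  by rewrite !inE /two_cliques eq_sym vK => /andP[-> ->].
pose X := [set u : 'I_n | (u < K - (d - 1))%N]%SET.
have cX : #|X| = (K - (d - 1))%N by apply: card_ord_lt; lia.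
have cD := cardsD1 v (finset.setC X); have cC := cardsC X.
apply: leq_trans (_ : #|finset.setD (finset.setC X) (finset.set1 v)| <= _)%N.
  rewrite cX card_ord in cC; move: cC cD HK dK; case: (v \in _); clear => /=; lia.
apply: subset_leq_card; apply/fintype.subsetP => u; rewrite !inE /two_cliques eq_sym => /andP[-> /=].
by move=> h; apply/orP; right; apply/andP; split; lia.
Qed.

Lemma mindeg_necessary (n d k : nat) : (0 < d)%N -> (29 * d <= n)%N ->
  mindeg_forces_rigid n d k -> ((n + d - 1) %/ 2 <= k)%N.
Proof.
move=> d0 Hn forces; rewrite leqNgt; apply/negP => kK.
set K := ((n + d - 1) %/ 2)%N in kK.
have [p [gp rp]] : d_rigid d (two_cliques (n := n) d K).
  apply: forces.
    split=> [u v|u]; last by rewrite /two_cliques eqxx.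
    by rewrite /two_cliques eq_sym; congr (_ && _); rewrite [(u < K)%N && _]andbC [(K <= u + _)%N && _]andbC.
  rewrite /min_degree; elim/big_ind: _ => [|a b ka kb|v _]; first by rewrite card_ord; lia.
    by rewrite leq_min ka.
  apply: leq_trans (degree_two_cliques v d0 _ _ _); lia.
apply: (@two_cliques_flexible Rdefinitions.R n d K p _ _ _ gp rp); lia.
Qed.

End RealFrameworks.

Theorem theorem1p2 (n d : nat) :
  leq 1 n -> leq 1 d -> leq (29 * d) n ->
  f_is n d ((n + d - 1) %/ 2).
Proof.
move=> _ d0 Hn; split; first exact: mindeg_sufficient.
by move=> k; apply: mindeg_necessary.
Qed.
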